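(* Let $W_1,\dots,W_6$ be the $2$-varifolds in $\mathbb{R}^3$ constructed in the context. For each $i=1,\ldots,6$, $W_i$ is a curvature varifold with boundary in $\mathbb{R}^3$, with boundary given by $$\partial W_i=\mathrm{Tan}(W_i)_\sharp\left(\nu_i^+\,\mathcal{H}^1\llcorner L^+ + \nu_i^-\,\mathcal{H}^1\llcorner L^-\right),$$ where $\mathrm{Tan}(W_i)(x)=(x,P_i^\pm)$ for $x\in L^\pm$. In particular $Z_1=W_1+W_3+W_5$ and $Z_2=W_2+W_4+W_6$ are curvature varifolds with non-zero boundary.
   Context: **Varifolds.** For $m\le n$ positive integers and $U\subset\mathbb{R}^n$ open, $\mathbf{G}(n,m)$ is the Grassmannian of $m$-planes in $\mathbb{R}^n$, $\mathbf{G}_m(U)=U\times\mathbf{G}(n,m)$, and $\mathbf{V}_m(U)$ is the set of $m$-varifolds in $U$, i.e. Radon measures on $\mathbf{G}_m(U)$. For $P\in\mathbf{G}(n,m)$, $P_\sharp\in\mathbb{R}^{n^2}$ is (the matrix $(P_{ij})$ of) the orthogonal projection of $\mathbb{R}^n$ onto $P$. For an $\mathcal{H}^m$-rectifiable set $S$, $\boldsymbol{\upsilon}(S)$ is the rectifiable $m$-varifold induced by $S$ with density $1$. $F_\sharp\mu$ denotes the push-forward of a measure $\mu$ under $F$. **Curvature varifolds with boundary.** Let $m<n$. For a $C^1$ compactly supported function $\varphi$ on $\mathbf{G}_m(U)$, $D$ and $D^*$ denote the derivatives of $\varphi(x,P)$ with respect to $x$ and $P$, respectively, where $\mathbf{G}(n,m)$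 is viewed inside $\mathbb{R}^{n^2}$ via $P\mapsto P_\sharp$ ($\varphi$ is regarded as a $C^1$ function of $(x,P)\in U\times\mathbb{R}^{n^2}$ and $D^*_{jk}$ is the partial derivative with respect to $P_{jk}$). $V\in\mathbf{V}_m(U)$ is a curvature varifold with boundary $\partial V$ if there exist $A=(A_{ijk})\in \mathbf{L}^1_{\mathrm{loc}}(\mathbf{G}_m(U),\mathbb{R}^{n^3};V)$ and an $\mathbb{R}^n$-valued Radon vector measure $\partial V=(\partial_1V,\dots,\partial_nV)$ on $\mathbf{G}_m(U)$ (each coordinate a signed Radon measure) such that (summing over repeated indices) $$\int P_{ij}D_j\varphi(x,P)+D^*_{jk}\varphi(x,P)A_{ijk}(x,P)+\varphi(x,P)A_{jij}(x,P)\,\mathrm{d}V(x,P)=-\int\varphi(x,P)\,\mathrm{d}\partial_iV(x,P)$$ for all such $\varphi$ and all $i=1,\dots,n$. **Construction.** Fix a smooth $\Phi:\mathbb{R}\to\mathbb{R}$ with $0\le\Phi\le1$, $\Phi(0)=1$, $\mathrm{supp}\,\Phi\subset(-1,1)$, $\Phi(-t)=\Phi(t)$ and $\Phi'(t)\le0$ for $t\ge0$, $\sup|\Phi'|\le4$, $\int_{\mathbb{R}}\Phi=1$. Let $\Omega=\{x\in\mathbb{R}^2:x_1>0\}$ and $g:\Omega\to\mathbb{R}$, $g(x_1,x_2)=\frac{1}{\sqrt3}\int_{-x_2}^{x_2}\Phi(t/x_1)\,\mathrm{d}t$. Let $r(x_1,x_2,x_3)=(x_1,-x_2,x_3)$ and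 let $R$ be the rotation of $\mathbb{R}^3$ by $\frac{2\pi}{3}$ around the $x_2$-axis, $R(x_1,x_2,x_3)=(-\tfrac12x_1-\tfrac{\sqrt3}{2}x_3,\;x_2,\;\tfrac{\sqrt3}{2}x_1-\tfrac12x_3)$. Put $\Sigma_1=\{(x,g(x))\in\mathbb{R}^3:x\in\Omega\}$, $\Sigma_2=r(\Sigma_1)$, $\Sigma_3=R(\Sigma_1)$, $\Sigma_5=R(\Sigma_3)$, $\Sigma_4=R(\Sigma_2)$, $\Sigma_6=R(\Sigma_4)$, and $W_i=\boldsymbol{\upsilon}(\Sigma_i)\in\mathbf{V}_2(\mathbb{R}^3)$ for $i=1,\dots,6$. Let $L^\pm=\{x\in\mathbb{R}^3:x_1=x_3=0,\ \pm x_2>0\}$; $\nu_1^\pm=(\frac{\sqrt3}{2},0,\pm\frac12)$, $\nu_2^\pm=(\frac{\sqrt3}{2},0,\mp\frac12)$, $\nu_i^\pm=R(\nu_{i-2}^\pm)$ for $i=3,\dots,6$; and $P_i^\pm=\{\lambda\nu_i^\pm+\mu e_2:\lambda,\mu\in\mathbb{R}\}$, with $e_2=(0,1,0)$. (The plane $P_i^\pm$ is the tangent plane of $\Sigma_i$ near and up to $L^\pm$.) *)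

(* Defs.v *)
From HB Require Import structures.
From mathcomp Require Import all_boot all_order all_algebra.
From mathcomp Require Import all_classical all_reals all_analysis.

Set Implicit Arguments.
Unset Strict Implicit.
Unset Printing Implicit Defensive.

Import Order.TTheory GRing.Theory Num.Theory.
Import numFieldNormedType.Exports.

Local Open Scope classical_set_scope.
Local Open Scope ring_scope.

Notation borel T := (g_sigma_algebraType (@open T)).

Section Euclidean.
Variables (R : realType) (n : nat).

(* The library norm on ['rV[R]_n] is the sup norm. *)
Definition enorm (x : 'rV[R]_n) : R := Num.sqrt (\sum_(j < n) x 0 j ^+ 2).

(* [ediam set0] is [-oo]; it only enters through [hgauge] and upper bounds. *)
Definition ediam (S : set 'rV[R]_n) : \bar R :=
  ereal_sup [set (enorm (p.1 - p.2))%:E | p in S `*` S].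

(* Lebesgue measure of the unit ball of R^m:
   alpha (m + 2) = 2 pi / (m + 2) * alpha m *)
Fixpoint alpha (m : nat) : R :=
  match m with
  | 0 => 1
  | 1 => 2
  | k.+2 => 2 * pi / k.+2%:R * alpha k
  end.

Definition hgauge (m : nat) (S : set 'rV[R]_n) : \bar R :=
  (if S == set0 then 0 else (alpha m / 2 ^+ m)%:E * ediam S ^+ m)%E.

Definition hausdorff_premeasure (m : nat) (delta : R) (A : set 'rV[R]_n) :
    \bar R :=
  ereal_inf [set (\sum_(0 <= k <oo) hgauge m (F k))%E | F in
    [set F : nat -> set 'rV[R]_n |
      A `<=` \bigcup_k F k /\ forall k, (ediam (F k) <= delta%:E)%E]].

Definition hausdorff (m : nat) (A : set (borel 'rV[R]_n)) : \bar R :=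
  ereal_sup [set hausdorff_premeasure m delta A | delta in [set d : R | 0 < d]].

Definition restriction (mu : set (borel 'rV[R]_n) -> \bar R)
    (S A : set (borel 'rV[R]_n)) : \bar R :=
  mu (A `&` S).

Definition density_zero (m : nat) (mu : set (borel 'rV[R]_n) -> \bar R)
    (a : 'rV[R]_n) : Prop :=
  (fun r : R => ((alpha m * r ^+ m)^-1)%:E * mu [set x | (enorm (x - a) <= r)%R])%E
    @ 0^'+ --> 0%E.

Definition tangent_cone (S : set 'rV[R]_n) (a : 'rV[R]_n) : set 'rV[R]_n :=
  [set v | forall e : R, 0 < e -> exists x r,
    [/\ S x, 0 < r, enorm (x - a) < e & enorm (r *: (x - a) - v) < e]].

(* Federer's cone Tan^m(mu, a), see Geometric Measure Theory, 3.2.16. *)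
Definition approx_tangent_cone (m : nat)
    (mu : set (borel 'rV[R]_n) -> \bar R) (a : 'rV[R]_n) : set 'rV[R]_n :=
  \bigcap_(S in [set S | density_zero m (restriction mu (~` S)) a])
    tangent_cone S a.

Definition orth_projection (P : 'M[R]_n) : Prop := P^T = P /\ P *m P = P.

Definition Grass (m : nat) : set 'M[R]_n :=
  [set P | orth_projection P /\ \rank P = m].

(* Orthogonal projection onto a linear subspace [S] ([0] if [S] is not a
   linear subspace). *)
Definition proj_onto (S : set 'rV[R]_n) : 'M[R]_n :=
  xget 0 [set P | orth_projection P /\ [set v | v *m P = v] = S].

Definition Gm (m : nat) (U : set 'rV[R]_n) : set ('rV[R]_n * 'M[R]_n) :=
  U `*` Grass m.

(* A Radon measure on the locally compact set [Gm m U] is a Borel measure on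
   R^n x R^(n^2) that is carried by [Gm m U] and finite on its compact
   subsets; regularity is then automatic.  Varifolds are given as set
   functions, only their values on Borel sets being relevant. *)

Local Notation X := (borel ('rV[R]_n * 'M[R]_n)%type).

Definition radon (m : nat) (U : set 'rV[R]_n)
    (mu : {measure set X -> \bar R}) : Prop :=
  mu (~` Gm m U) = 0%E /\
  forall K : set X, compact (K : set ('rV[R]_n * 'M[R]_n)) ->
    K `<=` Gm m U -> (mu K < +oo)%E.

Definition relatively_compact (m : nat) (U : set 'rV[R]_n)
    (B : set ('rV[R]_n * 'M[R]_n)) : Prop :=
  exists K, [/\ compact K, K `<=` Gm m U & B `<=` K].

(* The varifold induced by [S] with density 1: push-forward of the restriction
   of H^m to [S] under x |-> (x, Tan^m(H^m restricted to S, x)). *)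
Definition upsilon (m : nat) (S : set 'rV[R]_n) : set X -> \bar R :=
  pushforward (restriction (hausdorff m) S)
    (fun x => (x, proj_onto
       (approx_tangent_cone m (restriction (hausdorff m) S) x)) : X).

(* A signed Radon measure is a real-valued function on the relatively compact
   Borel sets that is a difference of two Radon measures. *)
Definition signed_radon_decomp (m : nat) (U : set 'rV[R]_n)
    (sigma : set X -> R) (p q : {measure set X -> \bar R}) : Prop :=
  [/\ radon m U p, radon m U q &
    forall B : set X, measurable B -> relatively_compact m U B ->
      sigma B = fine (p B) - fine (q B)].

Definition C1 (phi : 'rV[R]_n * 'M[R]_n -> R) : Prop :=
  (forall z, differentiable phi z) /\
  forall v, continuous (fun z => 'D_v phi z).

(* A C^1 function with compact support in [U] x R^(n^2) is identified with its
   extension by zero. *)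
Definition test_function (U : set 'rV[R]_n)
    (phi : 'rV[R]_n * 'M[R]_n -> R) : Prop :=
  [/\ C1 phi, compact (closure [set z | phi z != 0]) &
    closure [set z | phi z != 0] `<=` U `*` [set: 'M[R]_n]].

Definition Dx (j : 'I_n) (phi : 'rV[R]_n * 'M[R]_n -> R)
    (z : 'rV[R]_n * 'M[R]_n) : R :=
  'D_((delta_mx 0 j : 'rV[R]_n, 0 : 'M[R]_n)) phi z.

Definition DP (j k : 'I_n) (phi : 'rV[R]_n * 'M[R]_n -> R)
    (z : 'rV[R]_n * 'M[R]_n) : R :=
  'D_((0 : 'rV[R]_n, delta_mx j k : 'M[R]_n)) phi z.

(* [curvature_varifold m U V dV]: [V] is an m-varifold in [U] that is a
   curvature varifold with boundary, the boundary being the vector of signed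
   Radon measures [dV]. *)
Definition curvature_varifold (m : nat) (U : set 'rV[R]_n)
    (V : set X -> \bar R) (dV : 'I_n -> set X -> R) : Prop :=
  exists mu : {measure set X -> \bar R},
  [/\ radon m U mu,
      forall B : set X, measurable B -> V B = mu B &
      exists A : 'I_n -> 'I_n -> 'I_n -> X -> R,
      (forall i j k (K : set X), compact (K : set ('rV[R]_n * 'M[R]_n)) ->
         K `<=` Gm m U -> mu.-integrable K (EFin \o A i j k)) /\
      forall i, exists p q : {measure set X -> \bar R},
        signed_radon_decomp m U (dV i) p q /\
        forall phi, test_function U phi ->
          \int[mu]_(z in Gm m U)
            (\sum_j z.2 i j * Dx j phi z
             + \sum_j \sum_k DP j k phi z * A i j k z
             + \sum_j phi z * A j i j z)
          = - (\int[p]_(z in Gm m U) phi z - \int[q]_(z in Gm m U) phi z)].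

Definition nonzero_boundary (m : nat) (U : set 'rV[R]_n)
    (dV : 'I_n -> set X -> R) : Prop :=
  exists i (B : set X),
    [/\ measurable B, relatively_compact m U B & dV i B != 0].

End Euclidean.

Section Construction.
Variable R : realType.

Definition vec3 (a b c : R) : 'rV[R]_3 := \row_j nth 0 [:: a; b; c] j.

Definition oriented_integral (a b : R) (f : R -> R) : R :=
  if a <= b then \int[lebesgue_measure]_(t in `[a, b]) f t
  else - \int[lebesgue_measure]_(t in `[b, a]) f t.

Definition height (Phi : R -> R) (x1 x2 : R) : R :=
  (Num.sqrt 3)^-1 * oriented_integral (- x2) x2 (fun t => Phi (t / x1)).

Definition reflr (x : 'rV[R]_3) : 'rV[R]_3 :=
  vec3 (x 0 0) (- x 0 1) (x 0 2).

Definition rotR (x : 'rV[R]_3) : 'rV[R]_3 :=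
  vec3 (- (1 / 2) * x 0 0 - Num.sqrt 3 / 2 * x 0 2)
       (x 0 1)
       (Num.sqrt 3 / 2 * x 0 0 - 1 / 2 * x 0 2).

Definition Sigma1 (Phi : R -> R) : set 'rV[R]_3 :=
  [set y | exists x1 x2, 0 < x1 /\ y = vec3 x1 x2 (height Phi x1 x2)].

Fixpoint Sigma (Phi : R -> R) (i : nat) : set 'rV[R]_3 :=
  match i with
  | 0 => set0
  | 1 => Sigma1 Phi
  | 2 => reflr @` Sigma1 Phi
  | k.+2 => rotR @` Sigma Phi k
  end.

Definition W (Phi : R -> R) (i : nat) :
    set (borel ('rV[R]_3 * 'M[R]_3)%type) -> \bar R :=
  upsilon 2 (Sigma Phi i).

(* Below, a boolean [s] encodes the sign of L^+ ([true]) and L^- ([false]). *)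
Definition L (s : bool) : set 'rV[R]_3 :=
  [set x | [/\ x 0 0 = 0, x 0 2 = 0 & if s then 0 < x 0 1 else x 0 1 < 0]].

Definition half (s : bool) : R := if s then 1 / 2 else - (1 / 2).

Fixpoint nu (s : bool) (i : nat) : 'rV[R]_3 :=
  match i with
  | 0 => 0
  | 1 => vec3 (Num.sqrt 3 / 2) 0 (half s)
  | 2 => vec3 (Num.sqrt 3 / 2) 0 (half (~~ s))
  | k.+2 => rotR (nu s k)
  end.

Definition plane (s : bool) (i : nat) : set 'rV[R]_3 :=
  [set v | exists lam mu : R, v = lam *: nu s i + mu *: vec3 0 1 0].

(* Only the values at points of L^+ and L^- matter. *)
Definition TanW (i : nat) (x : borel 'rV[R]_3) :
    borel ('rV[R]_3 * 'M[R]_3)%type :=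
  (x, proj_onto (plane (0 < x 0 1) i)).

Definition bdryW (i : nat) (j : 'I_3)
    (B : set (borel ('rV[R]_3 * 'M[R]_3)%type)) : R :=
  \sum_(s : bool) nu s i 0 j *
    fine (pushforward (restriction (hausdorff 1) (L s)) (TanW i) B).

End Construction.

(* Main.v *)
From HB Require Import structures.
Require Import Defs.
From mathcomp Require Import all_boot all_order all_algebra.
From mathcomp Require Import all_classical all_reals all_analysis.
From mathcomp Require Import measurable_realfun.
From mathcomp Require Import ring lra.

Set Implicit Arguments.
Unset Strict Implicit.
Unset Printing Implicit Defensive.

Import Order.TTheory GRing.Theory Num.Theory.
Import numFieldNormedType.Exports.

Local Open Scope classical_set_scope.
Local Open Scope ring_scope.


Section Cells.
Context d (T : measurableType d) (R : realType) (D : countType).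
Variables (lab : nat -> T -> D) (k0 : nat).
Hypothesis lab_refines : forall k p q, lab k.+1 p = lab k.+1 q -> lab k p = lab k q.

Definition cell (k : nat) (i : D) : set T := [set p | lab k p = i].

Hypothesis measurable_cell : forall k i, measurable (cell k i).

Definition cell_open (U : set T) : Prop :=
  forall p, U p -> exists2 k, (k0 <= k)%N & cell k (lab k p) `<=` U.

Lemma lab_le k l p q : (k <= l)%N -> lab l p = lab l q -> lab k p = lab k q.
Proof.
move=> /subnK <-; elim: (l - k)%N => [//|n IH] /=.
by rewrite addSn => /lab_refines.
Qed.

Lemma cell_le k l p : (k <= l)%N -> cell l (lab l p) `<=` cell k (lab k p).
Proof. by move=> kl q /=; exact: lab_le. Qed.

Lemma cell_openI U V : cell_open U -> cell_open V -> cell_open (U `&` V).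
Proof.
move=> oU oV p [/oU[k k0k kU] /oV[l k0l lV]]; exists (maxn k l).
  by rewrite leq_max k0k.
by move=> q pq; split; [apply: kU|apply: lV]; apply: cell_le pq;
  rewrite leq_max leqnn ?orbT.
Qed.

Lemma cell_open_bigcup I (A : set I) (F : I -> set T) :
  (forall i, A i -> cell_open (F i)) -> cell_open (\bigcup_(i in A) F i).
Proof.
move=> oF p [i Ai Fip]; have [k k0k kF] := oF i Ai p Fip.
by exists k => // q /kF Fq; exists i.
Qed.

Lemma cell_open_cell k i : (k0 <= k)%N -> cell_open (cell k i).
Proof. by move=> k0k p <-; exists k. Qed.

Lemma cell_openC_cell k i : (k0 <= k)%N -> cell_open (~` cell k i).
Proof.
by move=> k0k p /= pi; exists k => // q /= pq qi; apply: pi; rewrite -qi pq.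
Qed.

(** The cells of a cell-open set that are maximal among the cells contained in
    it. *)
Definition maximal_cell (U : set T) (ki : nat * D) : Prop :=
  [/\ (k0 <= ki.1)%N, cell ki.1 ki.2 `<=` U &
      forall p l, lab ki.1 p = ki.2 -> (k0 <= l < ki.1)%N ->
        ~ (cell l (lab l p) `<=` U)].

Definition cell_piece (U : set T) (n : nat) : set T :=
  if pickle_inv n is Some ki then
    if `[< maximal_cell U ki >] then cell ki.1 ki.2 else set0
  else set0.

Lemma cell_pieceP (U : set T) n : cell_piece U n = set0 \/
  exists2 ki, maximal_cell U ki & cell_piece U n = cell ki.1 ki.2.
Proof.
rewrite /cell_piece; case: pickle_inv => [ki|]; last by left.
by case: ifPn => [/asboolP|_]; [right; exists ki|left].
Qed.

Lemma trivIset_cell_piece U : trivIset setT (cell_piece U).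
Proof.
move=> m n _ _ [p []]; rewrite /cell_piece.
case Em : pickle_inv => [[k i]|//]; case: asboolP => // -[/= k0k kU kmax] pi.
case En : pickle_inv => [[l j]|//]; case: asboolP => // -[/= k0l lU lmax] pj.
have kl : k = l.
  have [kl|lk|//] := ltngtP k l.
    by exfalso; apply: (lmax p k pj); rewrite ?k0k// pi.
  by exfalso; apply: (kmax p l pi); rewrite ?k0l// pj.
have ij : i = j by rewrite -pj -pi kl.
have := @pickle_invK (nat * D)%type m; have := @pickle_invK (nat * D)%type n.
by rewrite Em En /= => <- <-; rewrite kl ij.
Qed.

Lemma bigcup_cell_piece U : cell_open U -> \bigcup_n cell_piece U n = U.
Proof.
move=> oU; apply/seteqP; split=> p.
  move=> [n _]; have [->//|[[k i] [_ kU _] ->]] := cell_pieceP U n.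
  exact: kU.
move=> Up; pose good k := `[< (k0 <= k)%N /\ cell k (lab k p) `<=` U >].
have ex_good : exists k, good k.
  by have [k k0k kU] := oU p Up; exists k; apply/asboolP.
have [k /asboolP[k0k kU] kmin] := ex_minnP ex_good.
exists (pickle (k, lab k p)) => //; rewrite /cell_piece pickleK_inv.
case: asboolP => // -[]; split => //= q l qp /andP[k0l lk] lU.
suff : (k <= l)%N by rewrite leqNgt lk.
by apply: kmin; apply/asboolP; split => //; rewrite -(lab_le (ltnW lk) qp).
Qed.

Lemma measurable_cell_piece U n : measurable (cell_piece U n).
Proof. by have [->//|[ki _ ->]] := cell_pieceP U n. Qed.

Lemma measurable_cell_open U : cell_open U -> measurable U.
Proof.
move=> oU; rewrite -(bigcup_cell_piece oU).
by apply: bigcupT_measurable => n; exact: measurable_cell_piece.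
Qed.

Variables (mu : {measure set T -> \bar R}) (nu : {outer_measure set T -> \bar R}).
Variable c : {nonneg R}.
Hypothesis nu_cell : forall k i, (k0 <= k)%N ->
  (nu (cell k i) <= c%:num%:E * mu (cell k i))%E.

Lemma outer_le_cell_open U : cell_open U -> (nu U <= c%:num%:E * mu U)%E.
Proof.
move=> oU; rewrite -{1}(bigcup_cell_piece oU).
apply: (le_trans (outer_measure_sigma_subadditive nu _)).
rewrite -[in leRHS](bigcup_cell_piece oU) measure_semi_bigcup; last 3 first.
- exact: measurable_cell_piece.
- exact: trivIset_cell_piece.
- rewrite bigcup_cell_piece//; exact: measurable_cell_open.
rewrite -nneseriesZl; last by move=> n _; exact: measure_ge0.
apply: lee_nneseries => n _; first by move=> _; exact: outer_measure_ge0.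
have [->|[ki [? _ _] ->]] := cell_pieceP U n; last exact: nu_cell.
by rewrite outer_measure0 measure0 mule0.
Qed.

Hypothesis mu_cell_fin : forall i, (mu (cell k0 i) < +oo)%E.
Hypothesis generated : forall C, sigma_algebra setT C ->
  cell_open `<=` C -> @measurable d T `<=` C.

(** A set is regular when it is squeezed, up to small measure in the cell [B],
    between a cell-open set and the complement of one. *)
Definition cell_regular (B E : set T) : Prop := forall e : R, 0 < e ->
  exists U V, [/\ cell_open U, cell_open V, E `<=` U, ~` E `<=` V &
    (mu (B `&` (U `&` V)) < e%:E)%E].

Lemma cell_regularC B E : cell_regular B E -> cell_regular B (~` E).
Proof.
move=> rE e e0; have [U [V [oU oV EU EV UV]]] := rE e e0.
by exists V, U; rewrite setCK (setIC V).
Qed.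

Lemma cell_regular_bigcup B (E : (set T)^nat) : measurable B ->
  (mu B < +oo)%E ->
  (forall n, cell_regular B (E n)) -> cell_regular B (\bigcup_n E n).
Proof.
move=> mB Bfin rE e e0.
have ex n : exists UV : set T * set T, [/\ cell_open UV.1, cell_open UV.2,
    E n `<=` UV.1, ~` E n `<=` UV.2 &
    (mu (B `&` (UV.1 `&` UV.2)) < (e / 2 / (2 ^ n.+1)%:R)%:E)%E].
  have [|U [V UV]] := rE n (e / 2 / (2 ^ n.+1)%:R).
    by rewrite !divr_gt0 ?ltr0n ?expn_gt0.
  by exists (U, V).
have {ex}/choice[UV /all_and5[oU oV EU EV small]] := ex.
pose U := \bigcup_n (UV n).1; pose V N := \bigcap_(n < N) (UV n).2.
have oUU : cell_open U by apply: cell_open_bigcup => n _; exact: oU.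
have oVN N : cell_open (V N).
  elim: N => [|N IH]; first by rewrite /V II0 bigcap_set0 => p _; exists k0.
  have -> : V N.+1 = V N `&` (UV N).2 by rewrite /V !bigcap_mkord big_ord_recr.
  exact: cell_openI.
have mV N := measurable_cell_open (oVN N).
have mU := measurable_cell_open oUU.
pose F N := B `&` (U `&` V N).
have mF N : measurable (F N) by apply: measurableI => //; apply: measurableI.
have F0 : (mu (F 0%N) < +oo)%E.
  by apply: le_lt_trans Bfin; apply: le_measure; rewrite ?inE//; exact: subIsetl.
have niF : {homo F : n m / (n <= m)%N >-> (m <= n)%O}.
  move=> n m nm; apply/subsetPset => p [Bp [Up Vp]]; split=> //; split=> //.
  by move=> i /= ni; apply: Vp => /=; exact: leq_trans nm.
have cF := nonincreasing_cvg_mu F0 mF (bigcapT_measurable mF) niF.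
have lim_small : (mu (\bigcap_n F n) < e%:E)%E.
  apply: (@le_lt_trans _ _ (e / 2)%:E); last by rewrite lte_fin ltr_pdivrMr//; lra.
  apply: (@le_trans _ _ (\sum_(n <oo) mu (B `&` ((UV n).1 `&` (UV n).2)))%E).
    apply: measure_sigma_subadditive.
    - move=> n; apply: measurableI => //.
      by apply: measurableI; apply: measurable_cell_open.
    - exact: bigcapT_measurable.
    - move=> p Fp; have [Bp [[n _ Un] _]] := Fp 0%N I.
      exists n => //; split=> //; split=> //.
      by have [_ [_]] := Fp n.+1 I; apply => /=.
  apply: le_trans (epsilon_trick0 xpredT _); last by rewrite divr_ge0 ?ltW.
  by apply: lee_nneseries => // n _; exact: ltW.
have [N _ /(_ N (leqnn N)) FN] := cF _ (open_ereal_lt' lim_small).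
exists U, (V N); split => //.
- by move=> p [n _ Ep]; exists n => //; exact: EU.
- by move=> p Ep n _; apply: EV => Enp; apply: Ep; exists n.
Qed.

Lemma cell_regular_measurable i E : measurable E -> cell_regular (cell k0 i) E.
Proof.
set B := cell k0 i; move: E.
have rB (F : nat -> set T) : (forall n, cell_regular B (F n)) -> cell_regular B (\bigcup_n F n).
  by move=> rF; apply: cell_regular_bigcup; [exact: measurable_cell|exact: mu_cell_fin|].
have r0 : cell_regular B set0.
  move=> e e0; exists set0, setT; split => //.
  - by move=> p _; exists k0 => //.
  - by rewrite set0I setI0 measure0 lte_fin.
apply: (generated (C := cell_regular B)).
  split=> // A rA; first by rewrite setTD; exact: cell_regularC.
move=> U oU; rewrite -(bigcup_cell_piece oU); apply: rB => n.
have [->//|[[k j] [/= k0k _ _] ->]] := cell_pieceP U n.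
move=> e e0; exists (cell k j), (~` cell k j); split => //.
- exact: cell_open_cell.
- exact: cell_openC_cell.
- by rewrite setICr setI0 measure0 lte_fin.
Qed.

Lemma outer_le_in_cell i E : measurable E ->
  (nu (E `&` cell k0 i) <= c%:num%:E * mu (E `&` cell k0 i))%E.
Proof.
move=> mE; set B := cell k0 i.
have mB : measurable B := measurable_cell k0 i.
have mEB : measurable (E `&` B) by exact: measurableI.
apply/lee_addgt0Pr => e e0.
have [|U [V [oU oV EU EV UV]]] := @cell_regular_measurable i E mE (e / (c%:num + 1)).
  by rewrite divr_gt0// ltr_wpDl.
have oUB : cell_open (U `&` B) by apply: cell_openI => //; exact: cell_open_cell.
have mUB := measurable_cell_open oUB.
have mUV : measurable (B `&` (U `&` V)).
  by apply: measurableI => //; apply: measurableI; exact: measurable_cell_open.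
apply: (@le_trans _ _ (nu (U `&` B))).
  by apply: le_outer_measure => p [/EU Up Bp].
apply: (le_trans (outer_le_cell_open oUB)).
apply: (@le_trans _ _ (c%:num%:E * (mu (E `&` B) + (e / (c%:num + 1))%:E))%E).
  apply: lee_wpmul2l; first by rewrite lee_fin.
  apply: (@le_trans _ _ (mu ((E `&` B) `|` (B `&` (U `&` V))))).
    apply: le_measure; rewrite ?inE//; first exact: measurableU.
    move=> p [Up Bp]; have [Ep|/EV Vp] := pselect (E p); [by left|by right].
  apply: (le_trans (measureU2 _ mEB mUV)).
  by apply: leeD2l; exact: ltW.
have c1 : 0 < c%:num + 1 by rewrite ltr_wpDl.
rewrite ge0_muleDr//; last by rewrite lee_fin divr_ge0 ?ltW.
apply: leeD2l; rewrite lee_fin mulrCA ger_pMr// ler_pdivrMr//.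
by rewrite mul1r lerDl.
Qed.

(** Cells being both open and complements of open sets, outer regularity with
    respect to cell-open sets is automatic; it transfers a bound on cells to
    all measurable sets. *)
Theorem outer_le_of_cells E : measurable E -> (nu E <= c%:num%:E * mu E)%E.
Proof.
move=> mE; pose F n := if pickle_inv n is Some i then E `&` cell k0 i else set0.
have mF n : measurable (F n) by rewrite /F; case: pickle_inv => // i; exact: measurableI.
have FE : \bigcup_n F n = E.
  apply/seteqP; split=> p.
    by move=> [n _]; rewrite /F; case: pickle_inv => // i [].
  by move=> Ep; exists (pickle (lab k0 p)) => //; rewrite /F pickleK_inv.
have tF : trivIset setT F.
  move=> m n _ _ [p []]; rewrite /F.
  case Em : pickle_inv => [i|//] [_ /= pi]; case En : pickle_inv => [j|//] [_ /= pj].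
  have := @pickle_invK D m; have := @pickle_invK D n.
  by rewrite Em En /= => <- <-; rewrite -pi -pj.
rewrite -{1}FE; apply: (le_trans (outer_measure_sigma_subadditive nu _)).
rewrite -[in leRHS]FE measure_semi_bigcup//; last by rewrite FE.
rewrite -nneseriesZl; last by move=> n _; exact: measure_ge0.
apply: lee_nneseries => n _; first by move=> _; exact: outer_measure_ge0.
rewrite /F; case: pickle_inv => [i|]; first exact: outer_le_in_cell.
by rewrite outer_measure0 measure0 mule0.
Qed.

End Cells.


Section Hausdorff.
Context {R : realType}.

Lemma alpha_ge0 m : 0 <= alpha R m.
Proof.
elim/ltn_ind: m => -[|[|m]] IH //=.
by rewrite mulr_ge0 ?IH// divr_ge0// mulr_ge0// pi_ge0.
Qed.

Definition diam_le n (d : R) (S : set 'rV[R]_n) : Prop :=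
  forall x y, S x -> S y -> enorm (x - y) <= d.

Lemma enorm0 n : enorm (0 : 'rV[R]_n) = 0.
Proof. by rewrite /enorm big1 ?sqrtr0// => j _; rewrite mxE expr0n. Qed.

Lemma enorm_ge0 n (x : 'rV[R]_n) : 0 <= enorm x.
Proof. exact: sqrtr_ge0. Qed.

Lemma ediam_leP n (S : set 'rV[R]_n) d : (ediam S <= d%:E)%E <-> diam_le d S.
Proof.
split=> [Sd x y Sx Sy|Sd].
  by rewrite -lee_fin; apply: le_trans Sd; apply: ereal_sup_ubound; exists (x, y).
by apply: ge_ereal_sup => _ [[x y] [/= Sx Sy] <-]; rewrite lee_fin; exact: Sd.
Qed.

Lemma ediam_fin n (S : set 'rV[R]_n) d : S !=set0 -> diam_le d S ->
  exists e, [/\ 0 <= e, e <= d, ediam S = e%:E & diam_le e S].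
Proof.
move=> [x Sx] /ediam_leP Sd.
have S0 : (0 <= ediam S)%E.
  by apply: ereal_sup_ubound; exists (x, x); rewrite //= subrr enorm0.
have Sfin : ediam S \is a fin_num by rewrite ge0_fin_numE// (le_lt_trans Sd)// ltry.
exists (fine (ediam S)); rewrite fine_ge0// fineK//; split => //.
  by rewrite -lee_fin fineK.
by apply/ediam_leP; rewrite fineK.
Qed.

Definition gauge_of m (d : R) : R := alpha R m / 2 ^+ m * d ^+ m.

Lemma gauge_of_ge0 m d : 0 <= d -> 0 <= gauge_of m d.
Proof. by move=> d0; rewrite mulr_ge0 ?exprn_ge0// divr_ge0 ?alpha_ge0 ?exprn_ge0. Qed.

Lemma hgaugeE n m (S : set 'rV[R]_n) e : S !=set0 -> ediam S = e%:E ->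
  hgauge m S = (gauge_of m e)%:E.
Proof.
move=> /set0P S0 Se; rewrite /hgauge (negbTE S0) Se /gauge_of.
by rewrite -EFin_expe -EFinM.
Qed.

Lemma hgauge0 n m : hgauge m (set0 : set 'rV[R]_n) = 0%E.
Proof. by rewrite /hgauge eqxx. Qed.

Lemma hgauge_le n m (S : set 'rV[R]_n) d : 0 <= d -> diam_le d S ->
  (hgauge m S <= (gauge_of m d)%:E)%E.
Proof.
move=> d0 Sd; have [->|S0] := eqVneq S set0.
  by rewrite hgauge0 lee_fin gauge_of_ge0.
have {}S0 : S !=set0 by apply/set0P.
have [e [e0 ed Se _]] := ediam_fin S0 Sd.
rewrite (hgaugeE _ S0 Se) lee_fin ler_wpM2l ?lerXn2r//.
by rewrite divr_ge0 ?alpha_ge0 ?exprn_ge0.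
Qed.

Lemma hgauge_ge0 n m (S : set 'rV[R]_n) : (0 <= hgauge m S)%E.
Proof.
rewrite /hgauge; case: ifPn => // /set0P[x Sx].
apply: mule_ge0; first by rewrite lee_fin divr_ge0 ?alpha_ge0 ?exprn_ge0.
apply: expe_ge0; apply: ereal_sup_ubound.
by exists (x, x); rewrite //= subrr enorm0.
Qed.

Lemma hausdorff_premeasure_le n m d (A : set 'rV[R]_n) (F : nat -> set 'rV[R]_n) :
  A `<=` \bigcup_k F k -> (forall k, diam_le d (F k)) ->
  (hausdorff_premeasure m d A <= \sum_(0 <= k <oo) hgauge m (F k))%E.
Proof.
move=> AF dF; apply: ereal_inf_lbound; exists F => //; split=> // k.
exact/ediam_leP.
Qed.

Lemma hausdorff_premeasure_ge0 n m d (A : set 'rV[R]_n) :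
  (0 <= hausdorff_premeasure m d A)%E.
Proof.
apply: le_ereal_inf_tmp => _ [F _ <-].
by apply: nneseries_ge0 => k _ _; exact: hgauge_ge0.
Qed.

Lemma hausdorff_premeasure0 n m d : hausdorff_premeasure m d (set0 : set 'rV[R]_n) = 0%E.
Proof.
apply/eqP; rewrite eq_le hausdorff_premeasure_ge0 andbT.
apply: (le_trans (@hausdorff_premeasure_le _ _ _ _ (fun=> set0) _ _)) => //.
  by move=> k x y.
by rewrite eseries0// => k _ _; rewrite hgauge0.
Qed.

Lemma hausdorff_premeasure_sigma_subadditive n m d (A : set 'rV[R]_n)
    (F : nat -> set 'rV[R]_n) : A `<=` \bigcup_k F k ->
  (hausdorff_premeasure m d A <=
   \sum_(0 <= k <oo) hausdorff_premeasure m d (F k))%E.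
Proof.
move=> AF; have [[i ioo]|nfin] := pselect (exists i, hausdorff_premeasure m d (F i) = +oo%E).
  rewrite (eseries_pinfty _ _ ioo) ?leey// => k _.
  by rewrite -ltNye (lt_le_trans _ (hausdorff_premeasure_ge0 _ _ _)).
apply/lee_addgt0Pr => e e0.
apply: (le_trans _ (epsilon_trick _ _ (ltW e0))); last first.
  by move=> k; exact: hausdorff_premeasure_ge0.
have ex k : exists G : nat -> set 'rV[R]_n, [/\ F k `<=` \bigcup_j G j,
    forall j, diam_le d (G j) &
    (\sum_(0 <= j <oo) hgauge m (G j) <=
      hausdorff_premeasure m d (F k) + (e / (2 ^ k.+1)%:R)%:E)%E].
  have ek : 0 < e / (2 ^ k.+1)%:R by rewrite divr_gt0// ltr0n expn_gt0.
  have fk : hausdorff_premeasure m d (F k) \is a fin_num.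
    rewrite ge0_fin_numE ?hausdorff_premeasure_ge0// ltey.
    by apply/eqP => fk; apply: nfin; exists k.
  have [_ [G [FG dG] <-] /ltW le] := lb_ereal_inf_adherent ek fk.
  by exists G; split => // j; exact/ediam_leP.
have {ex}/choice[G /all_and3[FG dG leG]] := ex.
have /card_esym/ppcard_eqP[f] := card_nat2.
apply: (@le_trans _ _ (\sum_(0 <= i <oo) hgauge m (G (f i).1 (f i).2))%E).
  apply: hausdorff_premeasure_le => [x /AF[k _ /FG[j _ Gx]]|k]; last exact: dG.
  by exists (f^-1%FUN (k, j)) => //=; rewrite invK ?inE.
rewrite nneseries_esumT; last by move=> k; exact: hgauge_ge0.
rewrite -(@reindex_esum _ _ _ setT setT f (fun z => hgauge m (G z.1 z.2))); last first.
  exact: 'bij_f.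
rewrite (_ : setT = setT `*`` (fun=> setT)); last first.
  by apply/seteqP; split=> -[a b].
rewrite -(@esum_esum _ _ _ setT (fun=> setT) (fun k j => hgauge m (G k j))); last first.
  by move=> *; exact: hgauge_ge0.
rewrite -nneseries_esumT; last by move=> k; apply: esum_ge0 => j _; exact: hgauge_ge0.
apply: lee_nneseries => k _.
  by move=> _; apply: esum_ge0 => j _; exact: hgauge_ge0.
rewrite -nneseries_esumT; first exact: leG.
by move=> j; exact: hgauge_ge0.
Qed.

Section Image.
Context (n m : nat) (T : Type) (f : T -> 'rV[R]_n).

Definition image_premeasure d (A : set T) : \bar R := hausdorff_premeasure m d (f @` A).

Lemma image_premeasure0 d : image_premeasure d set0 = 0%E.
Proof. by rewrite /image_premeasure image_set0 hausdorff_premeasure0. Qed.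

Lemma image_premeasure_ge0 d A : (0 <= image_premeasure d A)%E.
Proof. exact: hausdorff_premeasure_ge0. Qed.

Lemma image_premeasure_subadditive d A F :
  subset_sigma_subadditive (image_premeasure d) A F.
Proof.
move=> AF; apply: hausdorff_premeasure_sigma_subadditive.
by move=> _ [p /AF[k _ Fp] <-]; exists k => //; exists p.
Qed.

HB.instance Definition _ d := isSubsetOuterMeasure.Build R T (image_premeasure d)
  (image_premeasure0 d) (image_premeasure_ge0 d) (@image_premeasure_subadditive d).

Definition image_hausdorff (A : set T) : \bar R := hausdorff m (f @` A).

Lemma image_premeasure_le_hausdorff d A : 0 < d ->
  (image_premeasure d A <= image_hausdorff A)%E.
Proof. by move=> d0; apply: ereal_sup_ubound; exists d. Qed.

Lemma image_hausdorff_le A x :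
  (forall d, 0 < d -> (image_premeasure d A <= x)%E) -> (image_hausdorff A <= x)%E.
Proof. by move=> Ax; apply: ge_ereal_sup => _ [d d0 <-]; exact: Ax. Qed.

Lemma image_hausdorff_ge0 A : (0 <= image_hausdorff A)%E.
Proof.
apply: le_trans (image_premeasure_le_hausdorff A ltr01).
exact: image_premeasure_ge0.
Qed.

Lemma image_hausdorff0 : image_hausdorff set0 = 0%E.
Proof.
apply/eqP; rewrite eq_le image_hausdorff_ge0 andbT.
by apply: image_hausdorff_le => d _; rewrite image_premeasure0.
Qed.

Lemma image_hausdorff_subadditive A F : subset_sigma_subadditive image_hausdorff A F.
Proof.
move=> AF; apply: image_hausdorff_le => d d0.
apply: (le_trans (image_premeasure_subadditive d AF)).
apply: lee_nneseries => k _; first by move=> _; exact: image_premeasure_ge0.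
exact: image_premeasure_le_hausdorff.
Qed.

HB.instance Definition _ := isSubsetOuterMeasure.Build R T image_hausdorff
  image_hausdorff0 image_hausdorff_ge0 image_hausdorff_subadditive.

End Image.

Lemma hausdorff_lipschitz n k m (T : Type) (f : T -> 'rV[R]_n) (h : T -> 'rV[R]_k)
    (E : set T) (c : R) : 0 < c ->
  (forall p q, E p -> E q -> enorm (f p - f q) <= c * enorm (h p - h q)) ->
  (image_hausdorff m f E <= (c ^+ m)%:E * image_hausdorff m h E)%E.
Proof.
move=> c0 fh; apply: image_hausdorff_le => d d0.
have dc : 0 < d / c by rewrite divr_gt0.
have cm : 0 < c ^+ m by rewrite exprn_gt0.
apply: (@le_trans _ _ ((c ^+ m)%:E * image_premeasure m h (d / c) E)%E); last first.
  apply: lee_wpmul2l; first by rewrite lee_fin ltW.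
  exact: image_premeasure_le_hausdorff.
rewrite -lee_pdivrMl//; apply: le_ereal_inf_tmp => _ [F [EF dF] <-].
rewrite lee_pdivrMl//.
pose G i := f @` (E `&` h @^-1` F i).
have GF i e : diam_le e (F i) -> diam_le (c * e) (G i).
  move=> Fe _ _ [p [Ep Fp] <-] [q [Eq Fq] <-].
  by apply: (le_trans (fh p q Ep Eq)); rewrite ler_pM2l//; exact: Fe.
apply: (le_trans (@hausdorff_premeasure_le _ _ _ _ G _ _)).
- move=> _ [p Ep <-]; have [|i _ Fp] := EF (h p); first by exists p.
  by exists i => //; exists p.
- move=> i; rewrite -[X in diam_le X](divfK (lt0r_neq0 c0)) mulrC.
  by apply: GF; exact/ediam_leP.
rewrite -nneseriesZl; last by move=> i _; exact: hgauge_ge0.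
apply: lee_nneseries => i _; first by move=> _; exact: hgauge_ge0.
have [Fi|Fi] := eqVneq (F i) set0.
  by rewrite /G Fi preimage_set0 setI0 image_set0 !hgauge0 mule0.
have {}Fi : F i !=set0 by apply/set0P.
have /ediam_leP/(ediam_fin Fi)[e [e0 _ Fe Fie]] := dF i.
rewrite (hgaugeE _ Fi Fe) -EFinM.
apply: (le_trans (hgauge_le m _ (GF i e Fie))); first by rewrite mulr_ge0// ltW.
by rewrite lee_fin /gauge_of exprMn [leRHS]mulrCA.
Qed.

(** Lower bounds for Hausdorff measure: it suffices to bound a measure on the
    preimages of sets of small diameter. *)
Lemma measure_le_premeasure n m d (T : measurableType d)
    (mu : {measure set T -> \bar R}) (f : T -> 'rV[R]_n) (E : set T) (K delta : R) :
  measurable E -> 0 < K ->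
  (forall S e, 0 <= e -> e <= delta -> diam_le e S -> exists B,
     [/\ measurable B, E `&` f @^-1` S `<=` B & (mu B <= (K * gauge_of m e)%:E)%E]) ->
  (mu E <= K%:E * image_premeasure m f delta E)%E.
Proof.
move=> mE K0 HB; rewrite -lee_pdivrMl//; apply: le_ereal_inf_tmp => _ [F [EF dF] <-].
rewrite lee_pdivrMl//.
have ex i : exists B, [/\ measurable B, E `&` f @^-1` F i `<=` B &
    (mu B <= K%:E * hgauge m (F i))%E].
  have [Fi|Fi] := eqVneq (F i) set0.
    exists set0; rewrite Fi preimage_set0 setI0; split => //.
    by rewrite measure0 hgauge0 mule0.
  have {}Fi : F i !=set0 by apply/set0P.
  have /ediam_leP/(ediam_fin Fi)[e [e0 ed Fe Fie]] := dF i.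
  have [B [mB EB muB]] := HB (F i) e e0 ed Fie.
  by exists B; split => //; rewrite (hgaugeE _ Fi Fe) -EFinM.
have {ex}/choice[B /all_and3[mB EB muB]] := ex.
apply: (@le_trans _ _ (\sum_(0 <= i <oo) mu (B i))%E).
  apply: measure_sigma_subadditive => // p Ep.
  have [|i _ Fp] := EF (f p); first by exists p.
  by exists i => //; apply: EB.
rewrite -nneseriesZl; last by move=> i _; exact: hgauge_ge0.
by apply: lee_nneseries => i _; [move=> _; exact: measure_ge0|exact: muB].
Qed.

End Hausdorff.


Notation line R := (measurableTypeR R).
Notation coord_plane R := (measurableTypeR R * measurableTypeR R)%type.

Section Dyadic.
Context {R : realType}.

Definition leb : {measure set (line R) -> \bar R} := @lebesgue_measure R.

Definition area : {measure set (coord_plane R) -> \bar R} :=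
  (@lebesgue_measure R \x @lebesgue_measure R)%E.

Lemma areaX (A B : set (line R)) : measurable A -> measurable B ->
  area (A `*` B) = (leb A * leb B)%E.
Proof. exact: product_measure1E. Qed.

Lemma exists_pow2_lt (k0 : nat) (e : R) : 0 < e ->
  exists2 k, (k0 <= k)%N & (2 ^+ k)^-1 < e.
Proof.
move=> e0; have [n _ ne] : exists2 n : nat, True & e^-1 < n%:R.
  by exists (Num.bound e^-1) => //; rewrite archi_boundP// invr_ge0 ltW.
exists (maxn k0 n); first by rewrite leq_maxl.
rewrite -[ltRHS]invrK ltf_pV2 ?posrE ?invr_gt0 ?exprn_gt0//.
apply: (lt_le_trans ne); rewrite -natrX ler_nat.
by apply: (leq_trans (ltnW (ltn_expl n (ltnSn 1)))); rewrite leq_exp2l// leq_maxr.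
Qed.

Definition dyadic (k : nat) (x : line R) : int := Num.floor (2 ^+ k * (x : R)).

Lemma dyadicP k (x : R) (i : int) :
  (dyadic k x = i) <-> (i%:~R / 2 ^+ k <= x < (i + 1)%:~R / 2 ^+ k).
Proof.
have k0 : 0 < (2 : R) ^+ k by rewrite exprn_gt0.
rewrite ler_pdivrMr// ltr_pdivlMr// mulrC -floor_eq /dyadic.
by split=> /eqP.
Qed.

Lemma dyadic_close k (x y : R) : dyadic k x = dyadic k y -> `|x - y| < (2 ^+ k)^-1.
Proof.
move=> xy; have /dyadicP/andP[] := erefl (dyadic k x).
have /dyadicP/andP[] := erefl (dyadic k y); rewrite -xy.
set i := dyadic k x; rewrite intrD mulrDl mul1r ltr_norml => *.
by apply/andP; split; lra.
Qed.

Lemma dyadic_refines k (x y : line R) : dyadic k.+1 x = dyadic k.+1 y ->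
  dyadic k x = dyadic k y.
Proof.
have aux (a b : R) : dyadic k.+1 a = dyadic k.+1 b -> dyadic k a <= dyadic k b.
  rewrite /dyadic exprS -!mulrA => ab; rewrite leNgt; apply/negP => ba.
  have : (Num.floor (2 * (2 ^+ k * b)) < 2 * Num.floor (2 ^+ k * a))%R.
    rewrite floor_lt_int intrM ltr_pM2l//.
    by rewrite (lt_le_trans (floorD1_gt _))// ler_int lezD1.
  rewrite -ab floor_lt_int intrM ltr_pM2l// ltNge.
  by rewrite floor_le.
by move=> xy; apply/eqP; rewrite eq_le !aux.
Qed.

Lemma dyadic_cellE k i :
  cell dyadic k i = [set` `[(i%:~R / 2 ^+ k : R), (i + 1)%:~R / 2 ^+ k[].
Proof.
apply/seteqP; split=> x /=; rewrite in_itv /=; first by move=> /dyadicP.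
by move=> xi; apply/dyadicP.
Qed.

Lemma measurable_dyadic_cell k i : measurable (cell dyadic k i : set (line R)).
Proof. by rewrite dyadic_cellE; exact: measurable_itv. Qed.

Lemma leb_dyadic_cell k i : leb (cell dyadic k i) = ((2 ^+ k)^-1 : R)%:E.
Proof.
rewrite dyadic_cellE; apply: (etrans (lebesgue_measure_itv _)) => /=.
rewrite lte_fin ltr_pM2r ?invr_gt0 ?exprn_gt0//.
by rewrite ltr_int ltrDl ltr01 -EFinB intrD mulrDl mul1r addrC addKr.
Qed.

Lemma cell_open_dyadic_ray k0 (x : R) : cell_open dyadic k0 (`]-oo, x[%classic : set (line R)).
Proof.
move=> y /=; rewrite in_itv/= => yx.
have [|k k0k kxy] := @exists_pow2_lt k0 (x - y); first by rewrite subr_gt0.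
exists k => // z /= /dyadic_close zy; rewrite in_itv/=.
by move: zy; rewrite ltr_norml => /andP[_]; lra.
Qed.

Lemma dyadic_generated k0 C : sigma_algebra setT C ->
  cell_open dyadic k0 `<=` C -> (measurable : set (set (line R))) `<=` C.
Proof.
move=> sC oC.
have -> : (measurable : set (set (line R))) = <<s @measurable_realfun.RGenInftyO.G R >>.
  exact: measurable_realfun.RGenInftyO.measurableE.
apply: smallest_sub => // _ [x ->]; apply: oC; exact: cell_open_dyadic_ray.
Qed.

Definition dyadic2 (k : nat) (p : coord_plane R) : int * int := (dyadic k p.1, dyadic k p.2).

Lemma dyadic2_refines k (p q : coord_plane R) : dyadic2 k.+1 p = dyadic2 k.+1 q ->
  dyadic2 k p = dyadic2 k q.
Proof.
by rewrite /dyadic2 => -[/dyadic_refines -> /dyadic_refines ->].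
Qed.

Lemma dyadic2_cellE k i :
  cell dyadic2 k i = cell dyadic k i.1 `*` cell dyadic k i.2.
Proof.
apply/seteqP; split=> p; rewrite /cell /dyadic2 /=.
  by move=> <-.
by case: i => a b /= [-> ->].
Qed.

Lemma measurable_dyadic2_cell k i : measurable (cell dyadic2 k i).
Proof. by rewrite dyadic2_cellE; apply: measurableX; exact: measurable_dyadic_cell. Qed.

Lemma area_dyadic2_cell k i : area (cell dyadic2 k i) = ((2 ^+ k)^-1 * (2 ^+ k)^-1)%:E.
Proof.
rewrite dyadic2_cellE areaX; try exact: measurable_dyadic_cell.
by rewrite !leb_dyadic_cell -EFinM.
Qed.

Lemma dyadic2_generated k0 C : sigma_algebra setT C ->
  cell_open dyadic2 k0 `<=` C -> (measurable : set (set (coord_plane R))) `<=` C.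
Proof.
move=> sC oC; apply: smallest_sub => // A.
have [C0 CC CU] := sC.
case=> -[B mB <-]; rewrite setTI; move: B mB.
  apply: (@dyadic_generated k0 [set B | C (fst @^-1` B)]).
    split=> /=; first by rewrite preimage_set0.
      by move=> B CB; rewrite setTD -preimage_setC -setTD; exact: CC.
    by move=> B CB; rewrite preimage_bigcup; exact: CU.
  move=> B oB /=; apply: oC => p /= /oB[k k0k kB].
  by exists k => // q [q1 _]; exact: kB.
apply: (@dyadic_generated k0 [set B | C (snd @^-1` B)]).
  split=> /=; first by rewrite preimage_set0.
    by move=> B CB; rewrite setTD -preimage_setC -setTD; exact: CC.
  by move=> B CB; rewrite preimage_bigcup; exact: CU.
move=> B oB /=; apply: oC => p /= /oB[k k0k kB].
by exists k => // q [_ q2]; exact: kB.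
Qed.

Lemma outer_le_leb (nu : {outer_measure set (line R) -> \bar R}) k0 (c : {nonneg R}) :
  (forall k i, (k0 <= k)%N -> (nu (cell dyadic k i) <= (c%:num / 2 ^+ k)%:E)%E) ->
  forall E : set (line R), measurable E -> (nu E <= c%:num%:E * leb E)%E.
Proof.
move=> nuc; apply: (@outer_le_of_cells _ _ _ _ dyadic k0).
- exact: dyadic_refines.
- exact: measurable_dyadic_cell.
- by move=> k i k0k; rewrite leb_dyadic_cell -EFinM; exact: nuc.
- by move=> i; rewrite leb_dyadic_cell ltry.
- exact: dyadic_generated.
Qed.

Lemma outer_le_area (nu : {outer_measure set (coord_plane R) -> \bar R}) k0 (c : {nonneg R}) :
  (forall k i, (k0 <= k)%N ->
    (nu (cell dyadic2 k i) <= (c%:num * ((2 ^+ k)^-1 * (2 ^+ k)^-1))%:E)%E) ->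
  forall E : set (coord_plane R), measurable E -> (nu E <= c%:num%:E * area E)%E.
Proof.
move=> nuc; apply: (@outer_le_of_cells _ _ _ _ dyadic2 k0).
- exact: dyadic2_refines.
- exact: measurable_dyadic2_cell.
- by move=> k i k0k; rewrite area_dyadic2_cell -EFinM; exact: nuc.
- by move=> i; rewrite area_dyadic2_cell ltry.
- exact: dyadic2_generated.
Qed.

End Dyadic.


Section Isodiametric.
Context {R : realType}.
Implicit Types A : set (coord_plane R).

Definition slice A (x : line R) : set (line R) := [set y | A (x, y)].
Definition pswap (p : coord_plane R) : coord_plane R := (p.2, p.1).

Lemma sliceE A x : slice A x = xsection A x.
Proof. by apply/seteqP; split=> y; rewrite /slice /xsection /= inE. Qed.

Lemma slice_pswapE A y : slice (pswap @^-1` A) y = ysection A y.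
Proof. by apply/seteqP; split=> x; rewrite /slice /ysection /pswap /= inE. Qed.

Lemma measurable_slice A x : measurable A -> measurable (slice A x).
Proof. by rewrite sliceE; exact: measurable_xsection. Qed.

Lemma measurable_leb_slice A : measurable A ->
  measurable_fun setT (fun x : line R => leb (slice A x) : \bar R).
Proof.
move=> mA; rewrite (_ : (fun _ => _) = leb \o xsection A); last first.
  by apply/funext => x; rewrite /= sliceE.
exact: (measurable_fun_xsection (@lebesgue_measure R)).
Qed.

Lemma areaE A : area A = (\int[leb]_x leb (slice A x))%E.
Proof. by apply: eq_integral => x _; rewrite /= sliceE. Qed.

Lemma measurable_preimage_pswap A : measurable A -> measurable (pswap @^-1` A).
Proof.
move=> mA; rewrite -[X in measurable X]setTI.
by apply: (measurable_fun_pair measurable_snd measurable_fst).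
Qed.

Lemma area_pswap A : measurable A -> area (pswap @^-1` A) = area A.
Proof.
move=> mA; rewrite !areaE.
have := @indic_fubini_tonelli _ _ _ _ R (@lebesgue_measure R) (@lebesgue_measure R) A mA.
rewrite indic_fubini_tonelli_FE// indic_fubini_tonelli_GE// => FG.
transitivity (\int[lebesgue_measure]_y (lebesgue_measure \o ysection A) y)%E.
  by apply: eq_integral => x _; rewrite /= slice_pswapE.
by rewrite -FG; apply: eq_integral => x _; rewrite /= sliceE.
Qed.

(** Steiner symmetrization: each vertical slice is replaced by the open interval
    of the same length centred at the origin. *)
Definition steiner A : set (coord_plane R) :=
  [set p | ((2 * `|p.2|)%:E < leb (slice A p.1))%E].

Lemma measurable_steiner A : measurable A -> measurable (steiner A).
Proof.
move=> mA; rewrite -[steiner A]setTI; apply: measurable_lte => //.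
  apply/measurable_EFinP; apply: measurable_funM => //.
  by apply: measurableT_comp => //; exact: measurable_snd.
by apply: (measurableT_comp (measurable_leb_slice mA)); exact: measurable_fst.
Qed.

Lemma lebT : leb [set: line R] = +oo%E.
Proof. by have := lebesgue_measure_itv (Interval -oo%O +oo%O : interval R);
  rewrite set_itvNyy. Qed.

Lemma leb_slice_steiner A x : leb (slice (steiner A) x) = leb (slice A x).
Proof.
have : (0 <= leb (slice A x))%E by exact: measure_ge0.
rewrite /slice /steiner /=; set l := leb [set y | A (x, y)].
case: l => [l| |]//=.
  rewrite lee_fin => l0.
  rewrite (_ : mkset _ = [set` `](- (l / 2)), (l / 2)[ ]); last first.
    apply/seteqP; split=> y /=; rewrite in_itv/= lte_fin -ltr_norml; lra.
  apply: (etrans (lebesgue_measure_itv _)) => /=; rewrite lte_fin.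
  case: ifPn => h; first by rewrite -EFinB; congr EFin; lra.
  by congr EFin; move: h; rewrite -leNgt; lra.
move=> _; rewrite (_ : mkset _ = setT) ?lebT//.
by apply/seteqP; split=> y //=; rewrite ltry.
Qed.

Lemma area_steiner A : area (steiner A) = area A.
Proof. by rewrite !areaE; apply: eq_integral => x _; exact: leb_slice_steiner. Qed.

Lemma leb_le_width (B : set (line R)) (a b : R) : measurable B ->
  (forall y : R, B y -> a <= y <= b) -> (0 <= b - a) -> (leb B <= (b - a)%:E)%E.
Proof.
move=> mB Bab ab; apply: (@le_trans _ _ (leb [set` `[a, b]])).
  by apply: le_measure; rewrite ?inE//= => y /Bab.
rewrite [leLHS]lebesgue_measure_itv/= lte_fin.
by case: ifPn => _; rewrite ?lee_fin// -EFinB.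
Qed.

Lemma lt_leb_spread (B C : set (line R)) (a c : R) : measurable B -> measurable C ->
  0 <= a -> 0 <= c ->
  ((2 * a)%:E < leb B)%E -> ((2 * c)%:E < leb C)%E ->
  exists u v : R, [/\ B u, C v & a + c < `|u - v|].
Proof.
move=> mB mC a0 c0 aB cC; apply: contrapT => noex.
have close (u v : R) : B u -> C v -> `|u - v| <= a + c.
  move=> Bu Cv; rewrite leNgt; apply/negP => uv.
  by apply: noex; exists u, v.
have nonempty (D : set (line R)) (e : R) : 0 <= e -> ((2 * e)%:E < leb D)%E ->
    exists u : R, D u.
  move=> e0 eD; have [D0|/set0P[u Du]] := eqVneq D set0; last by exists u.
  move: eD; rewrite D0 measure0 lte_fin ltNge => /negP[]; lra.
have [u0 Bu0] := nonempty B a a0 aB; have [v0 Cv0] := nonempty C c c0 cC.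
have hB : has_sup (B : set R) /\ has_inf (B : set R).
  split; split; try (by exists u0).
    exists (v0 + (a + c)) => u Bu.
    by have := close u v0 Bu Cv0; rewrite ler_norml => /andP[]; lra.
  exists (v0 - (a + c)) => u Bu.
  by have := close u v0 Bu Cv0; rewrite ler_norml => /andP[]; lra.
have hC : has_sup (C : set R) /\ has_inf (C : set R).
  split; split; try (by exists v0).
    exists (u0 + (a + c)) => v Cv.
    by have := close u0 v Bu0 Cv; rewrite ler_norml => /andP[]; lra.
  exists (u0 - (a + c)) => v Cv.
  by have := close u0 v Bu0 Cv; rewrite ler_norml => /andP[]; lra.
have width (D : set (line R)) : measurable D -> has_sup (D : set R) -> has_inf (D : set R) ->
    (leb D <= (sup (D : set R) - inf (D : set R))%:E)%E.
  move=> mD sD iD.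
  have bound (y : R) : D y -> inf (D : set R) <= y <= sup (D : set R).
    move=> Dy; rewrite ge_inf//=; last by case: iD.
    by apply: ub_le_sup => //; case: sD.
  apply: leb_le_width => //.
  by case: sD => -[y /bound/andP[? ?]] _; lra.
have supBinfC : sup (B : set R) <= inf (C : set R) + (a + c).
  apply: ge_sup; first by exists u0.
  move=> u Bu; rewrite -lerBlDr; apply: lb_le_inf; first by exists v0.
  by move=> v Cv; have := close u v Bu Cv; rewrite ler_norml => /andP[]; lra.
have supCinfB : sup (C : set R) <= inf (B : set R) + (a + c).
  apply: ge_sup; first by exists v0.
  move=> v Cv; rewrite -lerBlDr; apply: lb_le_inf; first by exists u0.
  by move=> u Bu; have := close u v Bu Cv; rewrite ler_norml => /andP[]; lra.
have := lt_le_trans aB (width B mB hB.1 hB.2).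
have := lt_le_trans cC (width C mC hC.1 hC.2).
by rewrite !lte_fin; lra.
Qed.

Definition diam2_le (d : R) A : Prop :=
  forall p q, A p -> A q -> (p.1 - q.1) ^+ 2 + (p.2 - q.2) ^+ 2 <= d ^+ 2.

Lemma diam2_le_steiner d A : measurable A -> diam2_le d A -> diam2_le d (steiner A).
Proof.
move=> mA Ad [x y] [x' y']; rewrite /steiner /= => xy xy'.
have [u [v [Bu Cv]]] := lt_leb_spread (measurable_slice x mA) (measurable_slice x' mA)
  (normr_ge0 (y : R)) (normr_ge0 (y' : R)) xy xy'.
have := Ad _ _ Bu Cv => /= le1 uv; apply: le_trans le1; rewrite lerD2l.
rewrite -[leLHS]real_normK ?num_real// -[leRHS]real_normK ?num_real//.
rewrite lerXn2r ?nnegrE//; apply: le_trans (ltW uv).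
exact: ler_normB.
Qed.

Definition disk (r : R) : set (coord_plane R) := [set p | p.1 ^+ 2 + p.2 ^+ 2 <= r ^+ 2].

Lemma measurable_disk r : measurable (disk r).
Proof.
rewrite (_ : disk r = (fun p : coord_plane R => (p.1 : R) ^+ 2 + (p.2 : R) ^+ 2) @^-1` `]-oo, r ^+ 2]).
  rewrite -[X in measurable X]setTI.
  apply: measurable_funD => //; apply: measurable_funX; [exact: measurable_fst|exact: measurable_snd].
by apply/seteqP; split=> p; rewrite /disk /= in_itv.
Qed.

(** Two Steiner symmetrizations along orthogonal axes yield a centrally
    symmetric set of no larger diameter, hence contained in a disk. *)
Lemma isodiametric_disk d A : measurable A -> diam2_le d A ->
  (area A <= area (disk (d / 2)))%E.
Proof.
move=> mA Ad; pose A1 := steiner A; pose A2 := steiner (pswap @^-1` A1).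
have mA1 : measurable A1 := measurable_steiner mA.
have mS : measurable (pswap @^-1` A1) := measurable_preimage_pswap mA1.
have dA2 : diam2_le d A2.
  apply: diam2_le_steiner => // p q Sp Sq; rewrite addrC.
  exact: (diam2_le_steiner mA Ad Sp Sq).
have sym p : A2 p -> A2 (- p.1, - p.2)%R.
  rewrite /A2 /steiner /= normrN (_ : slice _ (- p.1)%R = slice (pswap @^-1` A1) p.1)//.
  by apply/seteqP; split=> x; rewrite /slice /= /A1 /steiner /= normrN.
rewrite -(area_steiner A) -(area_pswap mA1) -(area_steiner (pswap @^-1` A1)).
apply: le_measure; rewrite ?inE; [exact: measurable_steiner|exact: measurable_disk|].
move=> p A2p; have := dA2 _ _ A2p (sym _ A2p); rewrite /disk /=.
by move: (p.1 : R) (p.2 : R) => x y; rewrite !opprK; nra.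
Qed.

End Isodiametric.


Section DiskArea.
Context {R : realType}.
Local Notation mu := (@lebesgue_measure R).

Lemma is_derive_continuous (F f : R -> R) : (forall x : R, is_derive x 1 F (f x)) ->
  continuous F.
Proof.
move=> dF x; apply: differentiable_continuous; apply/derivable1_diffP.
by have [] := dF x.
Qed.

Lemma is_derive_oo_LRcontinuous (F f : R -> R) a b :
  (forall x : R, is_derive x 1 F (f x)) -> derivable_oo_LRcontinuous F a b.
Proof.
move=> dF; have cF := is_derive_continuous dF; split.
- by move=> x _; have [] := dF x.
- by apply: cvg_at_right_filter; exact: cF.
- by apply: cvg_at_left_filter; exact: cF.
Qed.

Lemma integral_is_derive (F f : R -> R) a b : a <= b ->
  (forall x : R, is_derive x 1 F (f x)) -> continuous f ->
  (\int[mu]_(x in `[a, b]) (f x)%:E = (F b - F a)%:E)%E.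
Proof.
rewrite le_eqVlt => /predU1P[<- _ _|ab dF cf].
  by rewrite set_itv1 integral_set1 subrr.
rewrite (continuous_FTC2 (F := F))//.
- exact: continuous_subspaceT.
- exact: is_derive_oo_LRcontinuous dF.
- by move=> x _; rewrite derive1E; have [_] := dF x.
Qed.

Lemma leb_slice_disk (r : R) (x : line R) : 0 < r ->
  leb (slice (disk r) x) = (2 * Num.sqrt (r ^+ 2 - (x : R) ^+ 2))%:E.
Proof.
move=> r0; set s := Num.sqrt _.
have s0 : 0 <= s := sqrtr_ge0 _.
have [xr|xr] := leP ((x : R) ^+ 2) (r ^+ 2).
  have s2 : s ^+ 2 = r ^+ 2 - (x : R) ^+ 2 by rewrite sqr_sqrtr// subr_ge0.
  rewrite (_ : slice _ _ = [set` `[- s, s]]).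
    apply: (etrans (lebesgue_measure_itv _)) => /=; rewrite lte_fin.
    case: ifPn => h; first by rewrite -EFinB; congr EFin; lra.
    by congr EFin; move: h; rewrite -leNgt; lra.
  apply/seteqP; split=> y; rewrite /slice /disk /= in_itv/= -ler_norml.
    move=> h; rewrite -(ler_pXn2r (_ : 0 < 2)%N) ?nnegrE// real_normK ?num_real//.
    by rewrite s2; lra.
  rewrite -(ler_pXn2r (_ : 0 < 2)%N) ?nnegrE// real_normK ?num_real//.
  by rewrite s2; lra.
rewrite /s ltr0_sqrtr ?subr_lt0// mulr0 (_ : slice _ _ = set0) ?measure0//.
apply/seteqP; split=> y //=; rewrite /slice /disk /= => h.
by have := sqr_ge0 (y : R); lra.
Qed.

Lemma area_disk (r : R) : 0 < r -> area (disk r) = (pi * r ^+ 2)%:E.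
Proof.
move=> r0; rewrite areaE.
pose G (x : R) := 2 * Num.sqrt (r ^+ 2 - x ^+ 2) : R.
have Gout (x : R) : `|x| > r -> G x = 0.
  move=> xr; rewrite /G ler0_sqrtr ?mulr0// subr_le0.
  by rewrite -[leRHS]real_normK ?num_real// lerXn2r ?nnegrE// ltW.
transitivity (\int[mu]_(x in `[(- r)%R, r]) (G x)%:E)%E.
  rewrite [RHS]integral_mkcond; apply: eq_integral => x _.
  rewrite leb_slice_disk// patchE; case: ifPn => //.
  rewrite notin_setE/= in_itv/= -ler_norml => /negP; rewrite -ltNge => xr.
  by congr EFin; rewrite -/(G x) Gout.
pose S (t : R) := r * sin t.
have dS (t : R) : is_derive t 1 S (r * cos t) by rewrite /S; apply: is_deriveZ.
have S'E : (S^`()%classic : R -> R) = (fun t => r * cos t).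
  by apply/funext => t; rewrite derive1E; have [_] := dS t.
have cS' : continuous (fun t : R => r * cos t).
  by move=> t; apply: cvgM; [exact: cvg_cst|exact: continuous_cos].
have pi2 : 0 < pi / 2 :> R by rewrite divr_gt0 ?pi_gt0.
have := @integration_by_substitution_increasing R S G (- (pi / 2)) (pi / 2).
rewrite /S sinN sin_pihalf mulrN1 mulr1 => ->; last first.
- apply: continuous_subspaceT => x; rewrite /G; apply: cvgM; first exact: cvg_cst.
  apply: (@continuous_comp _ _ _ (fun x : R => r ^+ 2 - x ^+ 2)); last exact: sqrt_continuous.
  by apply: cvgB; [exact: cvg_cst|apply: cvgM].
- exact: is_derive_oo_LRcontinuous dS.
- by rewrite S'E; apply/cvg_ex; exists (r * cos (pi / 2)); apply: cvg_at_left_filter; exact: cS'.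
- by rewrite S'E; apply/cvg_ex; exists (r * cos (- (pi / 2))); apply: cvg_at_right_filter; exact: cS'.
- by rewrite S'E => x _; exact: cS'.
- by move=> x y xI yI xy; rewrite ltr_pM2l// ltr_sin.
- lra.
transitivity (\int[mu]_(t in `[(- (pi / 2))%R, (pi / 2)%R]) (2 * r ^+ 2 * cos t ^+ 2)%:E)%E.
  apply: eq_integral => t; rewrite inE/= in_itv/= => tI; rewrite S'E; congr EFin.
  change (2 * Num.sqrt (r ^+ 2 - (r * sin t) ^+ 2) * (r * cos t) = 2 * r ^+ 2 * cos t ^+ 2).
  rewrite (_ : r ^+ 2 - (r * sin t) ^+ 2 = (r * cos t) ^+ 2); last first.
    by rewrite !exprMn sin2cos2; ring.
  by rewrite sqrtr_sqr ger0_norm ?mulr_ge0 ?cos_ge0_pihalf// ?ltW//; ring.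
have dF (x : R) : is_derive x 1 (fun t => r ^+ 2 * (t + sin t * cos t)) (2 * r ^+ 2 * cos x ^+ 2).
  apply: is_derive_eq; rewrite /GRing.scale /=.
  by have := cos2Dsin2 x; rewrite /=; nra.
have cf : continuous (fun x : R => 2 * r ^+ 2 * cos x ^+ 2).
  by move=> x; apply: cvgM; [exact: cvg_cst|apply: cvgM; exact: continuous_cos].
have ab : - (pi / 2) <= pi / 2 :> R by lra.
rewrite (integral_is_derive ab dF cf).
by rewrite cos_pihalf cosN cos_pihalf !mulr0 !addr0; congr EFin; field.
Qed.

(** The isodiametric inequality in the plane. *)
Lemma isodiametric d (A : set (coord_plane R)) : measurable A -> 0 <= d -> diam2_le d A ->
  (area A <= (pi / 4 * d ^+ 2)%:E)%E.
Proof.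
move=> mA d0 Ad; apply/lee_addgt0Pr => e e0.
have [t [t0 te]] : exists t, 0 < t /\ pi / 4 * (d + t) ^+ 2 <= pi / 4 * d ^+ 2 + e.
  have p0 : 0 < pi :> R := pi_gt0 R.
  exists (Num.min 1 (e / (pi / 4 * (2 * d + 1)))); split.
    by rewrite lt_min ltr01 divr_gt0// mulr_gt0//; lra.
  set t := Num.min _ _.
  have t1 : t <= 1 by rewrite ge_min lexx.
  have te : t * (pi / 4 * (2 * d + 1)) <= e.
    rewrite -ler_pdivlMr; first by rewrite ge_min lexx orbT.
    by rewrite mulr_gt0//; lra.
  have t0 : 0 < t by rewrite lt_min ltr01 divr_gt0// mulr_gt0//; lra.
  nra.
apply: (@le_trans _ _ (pi / 4 * (d + t) ^+ 2)%:E); last by rewrite -EFinD lee_fin.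
have -> : pi / 4 * (d + t) ^+ 2 = pi * ((d + t) / 2) ^+ 2 :> R by field.
rewrite -area_disk; last by rewrite divr_gt0// ltr_wpDl.
apply: isodiametric_disk => // p q Ap Aq; apply: le_trans (Ad p q Ap Aq) _.
by rewrite lerXn2r ?nnegrE// ?addr_ge0 ?lerDl// ltW.
Qed.

End DiskArea.


Section PushMeasure.
Context d1 d2 (X : measurableType d1) (Y : measurableType d2) (R : realType).
Variables (phi : X -> Y) (mphi : measurable_fun setT phi).
Variable mu : {measure set X -> \bar R}.

Definition push_measure : {measure set Y -> \bar R} :=
  ltac:(refine (pushforward mu phi : {measure set Y -> \bar R}); exact: mphi).

Lemma push_measureE A : push_measure A = mu (phi @^-1` A).
Proof. by []. Qed.

End PushMeasure.

Section Affine.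
Context {R : realType}.

Definition affine (t a : R) (y : line R) : line R := ((y : R) - t) / a.

Lemma measurable_affine (t a : R) : measurable_fun setT (affine t a).
Proof.
by apply: measurable_funM => //; apply: measurable_funB.
Qed.

Lemma leb_affine (t a : R) (B : set (line R)) : 0 < a -> measurable B ->
  leb (affine t a @^-1` B) = (a%:E * leb B)%E.
Proof.
move=> a0 mB.
have ai0 : 0 <= a^-1 by rewrite invr_ge0 ltW.
pose m : {measure set (line R) -> \bar R} := mscale (NngNum ai0) (push_measure (measurable_affine t a) leb).
have E : leb B = (a^-1%:E * leb (affine t a @^-1` B))%E.
  apply: (lebesgue_measure_unique (mu := m)) => //= _ [[x y] _ <-].
  rewrite /m /mscale /= push_measureE.
  have -> : affine t a @^-1` `]x, y]%classic =
      [set` `](x * a + t), (y * a + t)]].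
    apply/seteqP; split=> z; rewrite /affine /= !in_itv/= ltr_pdivlMr// ler_pdivrMr//;
    by move=> /andP[? ?]; apply/andP; split; lra.
  rewrite [X in (_ * X)%E](lebesgue_measure_itv _) lebesgue_measure_itv/= !lte_fin.
  rewrite ltrD2r ltr_pM2r//; case: ifPn => _; last by rewrite mule0.
  by rewrite -!EFinB -EFinM; congr EFin; field; rewrite gt_eqF.
  exact: measurable_affine.
by rewrite E muleA -EFinM divff ?mul1e// gt_eqF.
Qed.

(** The area of a linear image: upper triangular maps of positive diagonal
    suffice, every Gram matrix having a Cholesky factor of this form. *)
Lemma area_triangular (a b c u v : R) (A : set (coord_plane R)) : 0 < a -> 0 < c ->
  measurable A ->
  area ((fun p : coord_plane R =>
    (((p.1 : R) - b * (p.2 : R) - u) / a, ((p.2 : R) - v) / c)) @^-1` A) = ((a * c)%:E * area A)%E.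
Proof.
move=> a0 c0 mA; set T := (X in X @^-1` A).
have mT : measurable_fun setT T.
  apply: measurable_fun_pair.
    apply: (measurableT_comp (measurable_affine u a)).
    apply: measurable_funB; first exact: measurable_fst.
    by apply: measurable_funM => //; exact: measurable_snd.
  by apply: (measurableT_comp (measurable_affine v c)); exact: measurable_snd.
have mTA : measurable (T @^-1` A) by rewrite -[X in measurable X]setTI; exact: mT.
rewrite -(area_pswap mTA) -(area_pswap mA) !areaE.
pose f (y : line R) : \bar R := leb (slice (pswap @^-1` A) y).
have mSA : measurable (pswap @^-1` A) by exact: measurable_preimage_pswap.
have mf : measurable_fun setT f by exact: measurable_leb_slice.
have f0 y : (0 <= f y)%E by exact: measure_ge0.
transitivity (\int[leb]_y (a%:E * (f \o affine v c) y))%E.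
  apply: eq_integral => y _ /=; rewrite -(leb_affine (b * (y : R) + u) a0); last exact: measurable_slice.
  congr (leb _); apply/seteqP; split=> x; rewrite /slice /= /pswap /= /T /affine /=.
    by rewrite opprD addrA.
  by rewrite opprD addrA.
rewrite ge0_integralZl//; last 2 first.
- by apply: measurableT_comp => //; exact: measurable_affine.
- by rewrite lee_fin ltW.
rewrite EFinM -muleA; congr (_ * _)%E.
have c0' : 0 <= c by exact: ltW.
transitivity (\int[push_measure (measurable_affine v c) leb]_y f y)%E.
  by rewrite ge0_integral_pushforward//; exact: measurable_affine.
transitivity (\int[mscale (NngNum c0') leb]_y f y)%E; last by rewrite ge0_integral_mscale.
by apply: eq_measure_integral => B mB _; rewrite push_measureE leb_affine.
Qed.

End Affine.


Section Enorm.
Context {R : realType}.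

Lemma sqr_enorm n (x : 'rV[R]_n) : enorm x ^+ 2 = \sum_j x 0 j ^+ 2.
Proof. by rewrite sqr_sqrtr// sumr_ge0// => j _; exact: sqr_ge0. Qed.

Lemma enormN n (x : 'rV[R]_n) : enorm (- x) = enorm x.
Proof. by congr Num.sqrt; apply: eq_bigr => j _; rewrite mxE sqrrN. Qed.

Lemma enormB n (x y : 'rV[R]_n) : enorm (x - y) = enorm (y - x).
Proof. by rewrite -enormN opprB. Qed.

Lemma enorm_coord n (x : 'rV[R]_n) j : `|x 0 j| <= enorm x.
Proof.
rewrite -(ler_pXn2r (_ : 0 < 2)%N) ?nnegrE ?enorm_ge0// sqr_enorm real_normK ?num_real//.
by rewrite (bigD1 j)//= lerDl sumr_ge0// => k _; exact: sqr_ge0.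
Qed.

Lemma enorm_eq0 n (x : 'rV[R]_n) : enorm x = 0 -> x = 0.
Proof.
move=> x0; apply/rowP => j; rewrite mxE; apply/eqP; rewrite -normr_le0 -x0.
exact: enorm_coord.
Qed.

Lemma enormZ n (a : R) (x : 'rV[R]_n) : enorm (a *: x) = `|a| * enorm x.
Proof.
rewrite /enorm -sqrtr_sqr -sqrtrM ?sqr_ge0// mulr_sumr.
by congr Num.sqrt; apply: eq_bigr => j _; rewrite mxE exprMn.
Qed.

Lemma dot_le_enorm n (x y : 'rV[R]_n) :
  \sum_j x 0 j * y 0 j <= enorm x * enorm y.
Proof.
have [a0|a0] := eqVneq (enorm x) 0.
  by rewrite a0 mul0r (enorm_eq0 a0) big1// => j _; rewrite mxE mul0r.
have [b0|b0] := eqVneq (enorm y) 0.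
  by rewrite b0 mulr0 (enorm_eq0 b0) big1// => j _; rewrite mxE mulr0.
set a := enorm x in a0 *; set b := enorm y in b0 *.
have ab : 0 < 2 * (a * b) by rewrite !mulr_gt0// lt0r ?a0 ?b0 enorm_ge0.
rewrite -subr_ge0 -(pmulr_lge0 _ ab).
have : 0 <= \sum_j (b * x 0 j - a * y 0 j) ^+ 2.
  by rewrite sumr_ge0// => j _; exact: sqr_ge0.
have -> : \sum_j (b * x 0 j - a * y 0 j) ^+ 2 =
    b ^+ 2 * (\sum_j x 0 j ^+ 2) + a ^+ 2 * (\sum_j y 0 j ^+ 2)
    - 2 * (a * b) * \sum_j x 0 j * y 0 j.
  rewrite !mulr_sumr -sumrN -!big_split /=.
  by apply: eq_bigr => j _; ring.
by rewrite -!sqr_enorm -/a -/b; lra.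
Qed.

Lemma enormD n (x y : 'rV[R]_n) : enorm (x + y) <= enorm x + enorm y.
Proof.
rewrite -(ler_pXn2r (_ : 0 < 2)%N) ?nnegrE ?enorm_ge0 ?addr_ge0 ?enorm_ge0//.
rewrite sqrrD !sqr_enorm.
have -> : \sum_j (x + y) 0 j ^+ 2 = \sum_j x 0 j ^+ 2 +
    (\sum_j x 0 j * y 0 j) *+ 2 + \sum_j y 0 j ^+ 2.
  rewrite -sumrMnl -!big_split/=; apply: eq_bigr => j _.
  by rewrite mxE; ring.
by rewrite lerD2r lerD2l lerMn2r dot_le_enorm orbT.
Qed.

Lemma sum3 (V : nmodType) (f : 'I_3 -> V) : \sum_j f j = f 0 + f 1 + f 2.
Proof.
rewrite !big_ord_recl big_ord0 addr0 addrA.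
by congr (_ + _ + _); congr f; apply/val_inj.
Qed.

Lemma vec3E0 (a b c : R) : vec3 a b c 0 0 = a. Proof. by rewrite mxE. Qed.
Lemma vec3E1 (a b c : R) : vec3 a b c 0 1 = b. Proof. by rewrite mxE. Qed.
Lemma vec3E2 (a b c : R) : vec3 a b c 0 2 = c. Proof. by rewrite mxE. Qed.
Definition vec3E := (vec3E0, vec3E1, vec3E2).

Lemma rv3P (x y : 'rV[R]_3) : x 0 0 = y 0 0 -> x 0 1 = y 0 1 -> x 0 2 = y 0 2 -> x = y.
Proof.
move=> e0 e1 e2; apply/rowP => -[[|[|[|//]]] h].
- by rewrite (_ : Ordinal h = 0)//; apply: val_inj.
- by rewrite (_ : Ordinal h = 1)//; apply: val_inj.
- by rewrite (_ : Ordinal h = 2)//; apply: val_inj.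
Qed.

Lemma vec3B (a b c a' b' c' : R) :
  vec3 a b c - vec3 a' b' c' = vec3 (a - a') (b - b') (c - c').
Proof. by apply: rv3P; rewrite !mxE. Qed.

Lemma vec3D (a b c a' b' c' : R) :
  vec3 a b c + vec3 a' b' c' = vec3 (a + a') (b + b') (c + c').
Proof. by apply: rv3P; rewrite !mxE. Qed.

Lemma vec3Z (t a b c : R) : t *: vec3 a b c = vec3 (t * a) (t * b) (t * c).
Proof. by apply: rv3P; rewrite !mxE. Qed.

Lemma enorm_vec3 (a b c : R) : enorm (vec3 a b c) = Num.sqrt (a ^+ 2 + b ^+ 2 + c ^+ 2).
Proof. by rewrite /enorm sum3 !vec3E. Qed.

Lemma enorm_le_sqr n (x : 'rV[R]_n) (d : R) : 0 <= d ->
  (enorm x <= d) = (enorm x ^+ 2 <= d ^+ 2).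
Proof. by move=> d0; rewrite ler_pXn2r ?nnegrE ?enorm_ge0. Qed.

End Enorm.

Section PlaneHausdorff.
Context {R : realType}.

Definition embed2 (p : coord_plane R) : 'rV[R]_3 := vec3 p.1 p.2 0.

Lemma enorm_embed2 (p q : coord_plane R) :
  enorm (embed2 p - embed2 q) ^+ 2 = (p.1 - q.1) ^+ 2 + (p.2 - q.2) ^+ 2.
Proof. by rewrite /embed2 vec3B sqr_enorm sum3 !vec3E; ring. Qed.

Lemma gauge_of2 (d : R) : gauge_of 2 d = pi / 4 * d ^+ 2.
Proof. by rewrite /gauge_of /=; field. Qed.

Lemma diam_embed2 (A : set (coord_plane R)) (d : R) : 0 <= d ->
  diam2_le d A -> diam_le d (embed2 @` A).
Proof.
move=> d0 Ad _ _ [p Ap <-] [q Aq <-].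
by rewrite enorm_le_sqr// enorm_embed2; exact: Ad.
Qed.

Lemma image_premeasure_le_gauge n m (T : Type) (f : T -> 'rV[R]_n) (A : set T) (d delta : R) :
  0 <= d -> d <= delta -> diam_le d (f @` A) -> (0 < m)%N ->
  (image_premeasure m f delta A <= (gauge_of m d)%:E)%E.
Proof.
move=> d0 dd Ad m0; pose F k := if k is 0%N then f @` A else set0 : set 'rV[R]_n.
apply: (le_trans (@hausdorff_premeasure_le _ _ m delta _ F _ _)).
- by move=> x Ax; exists 0%N.
- move=> [|k] x y // Ax Ay; exact: le_trans (Ad _ _ Ax Ay) dd.
rewrite nneseries_recl//; last by move=> *; exact: hgauge_ge0.
rewrite eseries_cond eseries0; last first.
  by move=> [|k]//= _ _; rewrite hgauge0.
by rewrite adde0 /F; exact: hgauge_le.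
Qed.

Lemma dyadic2_cell_coords k i (p : coord_plane R) : cell dyadic2 k i p ->
  i.1%:~R / 2 ^+ k <= p.1 < (i.1 + 1)%:~R / 2 ^+ k /\
  i.2%:~R / 2 ^+ k <= p.2 < (i.2 + 1)%:~R / 2 ^+ k.
Proof. by rewrite dyadic2_cellE => -[/= /dyadicP ? /dyadicP ?]. Qed.

Lemma sqr_sub_in_itv (x y a b : R) : a <= x < b -> a <= y < b ->
  (x - y) ^+ 2 <= (b - a) ^+ 2.
Proof.
move=> /andP[? ?] /andP[? ?]; rewrite -[leLHS]real_normK ?num_real//.
rewrite lerXn2r ?nnegrE//; first by rewrite subr_ge0; lra.
by rewrite ler_norml; apply/andP; split; lra.
Qed.

Lemma dyadic_width k (i : int) : (i + 1)%:~R / 2 ^+ k - i%:~R / 2 ^+ k = (2 ^+ k)^-1 :> R.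
Proof. by rewrite intrD mulrDl mul1r addrC addKr. Qed.

Lemma diam_dyadic2_cell k i : diam2_le (2 / 2 ^+ k) (cell dyadic2 k i : set (coord_plane R)).
Proof.
move=> p q /dyadic2_cell_coords[p1 p2] /dyadic2_cell_coords[q1 q2].
have := sqr_sub_in_itv p1 q1; have := sqr_sub_in_itv p2 q2.
rewrite !dyadic_width exprMn; have := sqr_ge0 (2 ^+ k : R)^-1; lra.
Qed.

Lemma image_premeasure_cell_trivial k delta i : 2 / 2 ^+ k <= delta ->
  (image_premeasure 2 embed2 delta (cell dyadic2 k i) <=
   (5 * ((2 ^+ k)^-1 * (2 ^+ k)^-1))%:E)%E.
Proof.
move=> kd; have k0 : 0 <= 2 / 2 ^+ k :> R by rewrite divr_ge0// exprn_ge0.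
apply: (le_trans (image_premeasure_le_gauge k0 kd (diam_embed2 k0 (@diam_dyadic2_cell k i)) _)) => //.
rewrite lee_fin gauge_of2 exprMn expr2.
have := pihalf_lt2 R; have := sqr_ge0 (2 ^+ k : R)^-1; rewrite !expr2; nra.
Qed.

(** A bound on cells improves: the inscribed disk has the optimal ratio of gauge
    to area, and the bound applies to the remainder of the cell. *)
Lemma image_premeasure_cell_improve k0 delta (c : R) : 0 <= c -> 2 / 2 ^+ k0 <= delta ->
  (forall k i, (k0 <= k)%N -> (image_premeasure 2 embed2 delta (cell dyadic2 k i) <=
     (c * ((2 ^+ k)^-1 * (2 ^+ k)^-1))%:E)%E) ->
  forall k i, (k0 <= k)%N -> (image_premeasure 2 embed2 delta (cell dyadic2 k i) <=
     ((pi / 4 + c * (1 - pi / 4)) * ((2 ^+ k)^-1 * (2 ^+ k)^-1))%:E)%E.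
Proof.
move=> c0 k0d cellc k i k0k; set s : R := (2 ^+ k)^-1.
have s0 : 0 < s by rewrite invr_gt0 exprn_gt0.
have le_c := @outer_le_area R (image_premeasure 2 embed2 delta) k0 (NngNum c0) cellc.
pose a : R := i.1%:~R / 2 ^+ k; pose b : R := i.2%:~R / 2 ^+ k.
have a_s : (i.1 + 1)%:~R / 2 ^+ k = a + s by have := @dyadic_width k i.1; rewrite -/a -/s; lra.
have b_s : (i.2 + 1)%:~R / 2 ^+ k = b + s by have := @dyadic_width k i.2; rewrite -/b -/s; lra.
pose T (p : coord_plane R) : coord_plane R :=
  (((p.1 : R) - 0 * (p.2 : R) - (a + s / 2)) / 1, ((p.2 : R) - (b + s / 2)) / 1).
pose D := T @^-1` disk (s / 2).
pose Q : set (coord_plane R) := [set` `[a, a + s]] `*` [set` `[b, b + s]].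
have mD : measurable D.
  have : measurable_fun setT T.
    apply: measurable_fun_pair.
      apply: (measurableT_comp (measurable_affine (a + s / 2) 1)).
      apply: measurable_funB; first exact: measurable_fst.
      by apply: measurable_funM => //; exact: measurable_snd.
    by apply: (measurableT_comp (measurable_affine (b + s / 2) 1)); exact: measurable_snd.
  by move=> mT; rewrite -[X in measurable X]setTI; apply: mT => //; exact: measurable_disk.
have aD : area D = (pi / 4 * s ^+ 2)%:E.
  rewrite /D area_triangular//; last exact: measurable_disk.
  by rewrite area_disk ?divr_gt0// mulr1 mul1e; congr EFin; field.
have mQ : measurable Q by apply: measurableX; exact: measurable_itv.
have itvs (x : R) : leb [set` `[x, x + s]] = s%:E.
  apply: (etrans (lebesgue_measure_itv _)) => /=; rewrite lte_fin ltrDl s0.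
  by rewrite -EFinD; congr EFin; ring.
have aQ : area Q = (s ^+ 2)%:E.
  by rewrite /Q areaX; [rewrite !itvs -EFinM|exact: measurable_itv|exact: measurable_itv].
have in_bounds (t u : R) : (t - (u + s / 2)) ^+ 2 <= (s / 2) ^+ 2 -> u <= t <= u + s.
  move=> h; have : `|t - (u + s / 2)| <= s / 2.
    rewrite -(ler_pXn2r (_ : 0 < 2)%N) ?nnegrE// ?real_normK ?num_real//; lra.
  by rewrite ler_norml => /andP[? ?]; apply/andP; split; lra.
have DQ : D `<=` Q.
  move=> p; rewrite /D /disk /= /T /= !divr1 mul0r subr0 => h; split; rewrite /= in_itv /=.
    apply: in_bounds; apply: le_trans h.
    by rewrite lerDl; exact: sqr_ge0.
  apply: in_bounds; apply: le_trans h.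
  by rewrite lerDr; exact: sqr_ge0.
have aQD : area (Q `\` D) = ((1 - pi / 4) * s ^+ 2)%:E.
  have Qfin : (area Q < +oo)%E by rewrite aQ ltry.
  have -> : area (Q `\` D) = (area Q - area (Q `&` D))%E by exact: measureD.
  by rewrite (setIidr DQ) aD aQ -EFinB; congr EFin; ring.
have cellQ : cell dyadic2 k i `<=` Q.
  move=> p /dyadic2_cell_coords[]; rewrite a_s b_s -/a -/b => /andP[? ?] /andP[? ?].
  by split; rewrite /= in_itv/=; apply/andP; split => //; exact: ltW.
apply: (@le_trans _ _ (image_premeasure 2 embed2 delta (D `|` (Q `\` D)))).
  by apply: le_outer_measure => p /cellQ Qp; have [Dp|Dp] := pselect (D p); [left|right].
apply: (le_trans (outer_measureU2 _ _ _)).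
rewrite mulrDl EFinD; apply: leeD.
  have ds : s <= delta.
    apply: le_trans k0d; rewrite ler_pdivlMr ?exprn_gt0//.
    rewrite /s mulrC ler_pdivrMr ?exprn_gt0//.
    have : (2 : R) ^+ k0 <= 2 ^+ k by rewrite ler_weXn2l// ler1n.
    by have := exprn_gt0 k0 (ltr0Sn R 1); rewrite /=; lra.
  rewrite -expr2 -gauge_of2; apply: image_premeasure_le_gauge => //; first exact: ltW.
  apply: diam_embed2; first exact: ltW.
  move=> p q; rewrite /D /disk /= /T /= !divr1 !mul0r !subr0.
  move: (p.1 : R) (p.2 : R) (q.1 : R) (q.2 : R) => p1 p2 q1 q2.
  set x := p1 - _; set y := p2 - _; set z := q1 - _; set w := q2 - _ => h1 h2.
  have -> : p1 - q1 = x - z by rewrite /x /z; ring.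
  have -> : p2 - q2 = y - w by rewrite /y /w; ring.
  have := sqr_ge0 (x + z); have := sqr_ge0 (y + w); nra.
apply: (le_trans (le_c _ (measurableD mQ mD))).
by rewrite aQD -EFinM lee_fin -mulrA -expr2.
Qed.

Lemma image_premeasure_plane delta (E : set (coord_plane R)) : 0 < delta -> measurable E ->
  (image_premeasure 2 embed2 delta E <= area E)%E.
Proof.
move=> d0 mE; have [k0 _ /ltW kd] := exists_pow2_lt 0 (divr_gt0 d0 (ltr0Sn R 1)).
have {}kd : 2 / 2 ^+ k0 <= delta by lra.
have p4 : 0 < pi / 4 :> R by rewrite divr_gt0// pi_gt0.
have p41 : pi / 4 < 1 :> R by have := pihalf_lt2 R; lra.
pose c n : R := 1 + 4 * (1 - pi / 4) ^+ n.
have c0 n : 0 <= c n by rewrite addr_ge0// mulr_ge0// exprn_ge0//; lra.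
have step n k i : (k0 <= k)%N -> (image_premeasure 2 embed2 delta (cell dyadic2 k i) <=
     (c n * ((2 ^+ k)^-1 * (2 ^+ k)^-1))%:E)%E.
  elim: n k i => [|n IH] k i k0k.
    rewrite /c expr0 mulr1 (_ : 1 + 4 = 5 :> R); last by ring.
    apply: image_premeasure_cell_trivial; apply: le_trans kd.
    by rewrite ler_pM2l// lef_pV2 ?posrE ?exprn_gt0// ler_weXn2l// ler1n.
  rewrite (_ : c n.+1 = pi / 4 + c n * (1 - pi / 4)); last by rewrite /c exprS; ring.
  exact: (image_premeasure_cell_improve (c0 n) kd).
rewrite -[leRHS]mul1e; apply: (@outer_le_area R _ k0 (NngNum ler01)) => // k i k0k.
apply/lee_addgt0Pr => e e0; rewrite mul1r; set s := _ * _.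
have s0 : 0 < s by rewrite mulr_gt0// invr_gt0 exprn_gt0.
have lt1 : `|1 - pi / 4 : R| < 1 by rewrite ltr_norml; lra.
have es : 0 < e / (4 * s) by rewrite divr_gt0// mulr_gt0.
have [n _ /(_ n (leqnn n)) /= ne] := (cvgr_dist_lt _ _ (cvg_expr lt1)) _ es.
apply: (le_trans (step n k i k0k)); rewrite -EFinD lee_fin /c mulrDl mul1r lerD2l.
rewrite sub0r normrN in ne.
have {}ne := le_lt_trans (ler_norm _) ne.
by move: ne; rewrite ltr_pdivlMr ?mulr_gt0// => /ltW; rewrite mulrCA mulrA [4 * _]mulrC.
Qed.

Lemma image_hausdorff_plane (E : set (coord_plane R)) : measurable E ->
  (image_hausdorff 2 embed2 E <= area E)%E.
Proof.
by move=> mE; apply: image_hausdorff_le => d d0; exact: image_premeasure_plane.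
Qed.

Definition embed1 (t : line R) : 'rV[R]_3 := vec3 0 t 0.

Lemma enorm_embed1 (s t : line R) : enorm (embed1 s - embed1 t) = `|(s : R) - t|.
Proof.
rewrite /embed1 vec3B enorm_vec3 -sqrtr_sqr; congr Num.sqrt.
by rewrite subr0 expr0n /= add0r addr0.
Qed.

Lemma gauge_of1 (d : R) : gauge_of 1 d = d.
Proof. by rewrite /gauge_of /= !expr1 divff// mul1r. Qed.

Lemma image_hausdorff_line (E : set (line R)) : measurable E ->
  image_hausdorff 1 embed1 E = leb E.
Proof.
move=> mE; apply/eqP; rewrite eq_le; apply/andP; split.
  apply: image_hausdorff_le => d d0; rewrite -[leRHS]mul1e.
  have [k0 _ /ltW kd] := exists_pow2_lt 0 d0.
  apply: (@outer_le_leb R (image_premeasure 1 embed1 d) k0 (NngNum ler01)) => // k i k0k.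
  rewrite mul1r; have k1 : 0 <= (2 ^+ k)^-1 :> R by rewrite invr_ge0 exprn_ge0.
  have kd' : (2 ^+ k)^-1 <= d.
    by apply: le_trans kd; rewrite lef_pV2 ?posrE ?exprn_gt0// ler_weXn2l// ler1n.
  have diam : diam_le (2 ^+ k)^-1 (embed1 @` cell dyadic k i).
    move=> _ _ [x xi <-] [y yi <-]; rewrite enorm_embed1; apply/ltW/dyadic_close.
    by move: xi yi; rewrite /cell /= => -> ->.
  by apply: (le_trans (image_premeasure_le_gauge k1 kd' diam (ltn0Sn 0))); rewrite gauge_of1.
apply: le_trans (image_premeasure_le_hausdorff 1 embed1 E ltr01).
rewrite -[leRHS]mul1e; apply: measure_le_premeasure => // S e e0 _ Se.
have [D0|/set0P[t0 [Et0 St0]]] := eqVneq (E `&` embed1 @^-1` S) set0.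
  by exists set0; rewrite D0; split => //; rewrite measure0 lee_fin gauge_of1 mul1r.
pose D : set R := E `&` embed1 @^-1` S.
have close (s t : R) : D s -> D t -> `|s - t| <= e.
  by move=> [_ Ss] [_ St]; rewrite -enorm_embed1; exact: Se.
have sD : has_ubound D.
  exists (t0 + e) => s Ds; have := close s t0 Ds (conj Et0 St0).
  by rewrite ler_norml => /andP[]; lra.
have iD : has_lbound D.
  exists (t0 - e) => s Ds; have := close s t0 Ds (conj Et0 St0).
  by rewrite ler_norml => /andP[]; lra.
exists [set` `[inf D, sup D]]; split; first exact: measurable_itv.
  by move=> t Dt /=; rewrite in_itv/= ge_inf// ub_le_sup.
rewrite [leLHS](lebesgue_measure_itv _) /= lte_fin gauge_of1 mul1r.
case: ifPn => _; last by rewrite lee_fin.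
rewrite -EFinB lee_fin lerBlDr; apply: ge_sup; first by exists t0.
move=> s Ds; rewrite addrC -lerBlDr; apply: lb_le_inf; first by exists t0.
by move=> t Dt; have := close s t Ds Dt; rewrite ler_norml => /andP[]; lra.
Qed.

End PlaneHausdorff.


Section Density.
Context d (T : measurableType d) (R : realType).
Variables (mu : {measure set T -> \bar R}) (w : T -> R).
Hypotheses (mw : measurable_fun setT w) (w_ge0 : forall x, 0 <= w x).

Definition density (A : set T) : \bar R := (\int[mu]_(x in A) (w x)%:E)%E.

Let mwE : measurable_fun setT (EFin \o w).
Proof. exact/measurable_EFinP. Qed.

Let density0 : density set0 = 0%E.
Proof. by rewrite /density integral_set0. Qed.

Let density_ge0 A : (0 <= density A)%E.
Proof. by apply: integral_ge0 => x _; rewrite lee_fin. Qed.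

Let density_sigma_additive : semi_sigma_additive density.
Proof.
move=> A mA tA mUA; rewrite /density ge0_integral_bigcup//; last 2 first.
- exact: measurable_funTS.
- by move=> x _; rewrite lee_fin.
by apply: is_cvg_ereal_nneg_natsum_cond => n _ _; exact: density_ge0.
Qed.

HB.instance Definition _ := isMeasure.Build _ _ _ density
  density0 density_ge0 density_sigma_additive.

Definition density_measure : {measure set T -> \bar R} := density.

Lemma density_measureE A : density_measure A = (\int[mu]_(x in A) (w x)%:E)%E.
Proof. by []. Qed.

Import HBNNSimple.

Let integral_density_indic A (r : R) : measurable A -> 0 <= r ->
  (\int[density_measure]_x (r * \1_A x)%:E = \int[mu]_x ((r * \1_A x)%:E * (w x)%:E))%E.
Proof.
move=> mA r0; under eq_integral do rewrite EFinM.
rewrite ge0_integralZl//; last by apply/measurable_EFinP; exact: measurable_indic.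
rewrite integral_indic// setIT density_measureE integral_mkcond.
rewrite -ge0_integralZl//; last 2 first.
- by apply/(measurable_restrictT _ _).1; [|exact: measurable_funTS].
- by move=> x _; rewrite patchE; case: ifPn; rewrite // lee_fin.
apply: eq_integral => x _; rewrite patchE indicE.
by case: ifPn => xA; rewrite ?mulr1 ?mulr0 ?mul0e ?mule0.
Qed.

Lemma ge0_integral_density (h : T -> \bar R) : measurable_fun setT h ->
  (forall x, 0 <= h x)%E ->
  (\int[density_measure]_x h x = \int[mu]_x (h x * (w x)%:E))%E.
Proof.
move=> mh h0; pose h_ := nnsfun_approx measurableT mh.
have cvgh x : (h_ n x)%:E @[n --> \oo] --> h x.
  by apply: cvg_nnsfun_approx.
transitivity (limn (fun n => \int[density_measure]_x (h_ n x)%:E)%E).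
  rewrite -monotone_convergence//.
  - by apply: eq_integral => y _; apply/esym/cvg_lim => //; exact: cvgh.
  - by move=> n; exact/measurable_EFinP/measurable_funP.
  - by move=> n y _; rewrite lee_fin.
  - by move=> y _ m n mn; rewrite lee_fin; exact/lefP/nd_nnsfun_approx.
rewrite [X in limn X](_ : _ = (fun n => \int[mu]_x ((h_ n x)%:E * (w x)%:E))%E).
  rewrite -monotone_convergence//; last 3 first.
  - move=> n; apply: emeasurable_funM => //.
    exact/measurable_EFinP/measurable_funP.
  - by move=> n x _; rewrite mule_ge0// lee_fin.
  - move=> x _ m n mn; rewrite lee_wpmul2r// lee_fin//.
    exact/lefP/nd_nnsfun_approx.
  apply: eq_integral => x _; apply/cvg_lim => //.
  by apply: cvgeZr => //; exact: cvgh.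
apply/funext => n.
have mA r : measurable (h_ n @^-1` [set r]) by [].
under eq_integral do rewrite fimfunE -fsumEFin//.
rewrite ge0_integral_fsum//; last 2 first.
- by move=> y; exact/measurable_EFinP/measurable_funM.
- by move=> y x _; rewrite nnfun_muleindic_ge0.
transitivity (\int[mu]_x (\sum_(r \in range (h_ n)) ((r * \1_(h_ n @^-1` [set r]) x)%:E * (w x)%:E)))%E.
  rewrite ge0_integral_fsum//; last 2 first.
  - move=> y; apply: emeasurable_funM => //.
    exact/measurable_EFinP/measurable_funM.
  - by move=> y x _; apply: mule_ge0; [exact: nnfun_muleindic_ge0|rewrite lee_fin].
  apply: eq_fsbigr => r; rewrite inE => -[x _ <-].
  by rewrite integral_density_indic.
apply: eq_integral => x _; rewrite fimfunE -fsumEFin//.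
rewrite ge0_mule_fsuml// => r; exact: nnfun_muleindic_ge0.
Qed.

Lemma integral_density (h : T -> R) : measurable_fun setT h ->
  (\int[density_measure]_x (h x)%:E = \int[mu]_x (h x * w x)%:E)%E.
Proof.
move=> mh; rewrite integralE [RHS]integralE.
have mhE : measurable_fun setT (EFin \o h) by exact/measurable_EFinP.
congr (_ - _)%E.
  rewrite ge0_integral_density//; last exact: measurable_funepos.
  apply: eq_integral => x _; rewrite !funeposE/= -!EFin_max -EFinM.
  by rewrite maxr_pMl// mul0r.
rewrite ge0_integral_density//; last exact: measurable_funeneg.
apply: eq_integral => x _; rewrite !funenegE/= -!EFin_max -EFinM.
by rewrite maxr_pMl// mul0r mulNr.
Qed.

Lemma integrable_density (h : T -> R) D : measurable D -> measurable_fun setT h ->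
  mu.-integrable D (fun x => (h x * w x)%:E) -> density_measure.-integrable D (EFin \o h).
Proof.
move=> mD mh /integrableP[_ fin]; apply/integrableP; split.
  by apply/measurable_EFinP; exact: measurable_funTS.
rewrite (_ : integral _ _ _ = \int[mu]_(x in D) `|(h x * w x)%:E|)%E//.
rewrite integral_mkcond [RHS]integral_mkcond ge0_integral_density.
- apply: eq_integral => x _; rewrite !patchE; case: ifPn => _; last by rewrite mul0e.
  by rewrite /= normrM (ger0_norm (w_ge0 x)) EFinM.
- apply/(measurable_restrictT _ _).1 => //; apply: measurableT_comp => //.
  by apply/measurable_EFinP; exact: measurable_funTS.
- by move=> x; rewrite patchE; case: ifPn.
Qed.

End Density.


Section Quadratic.
Context {R : realType}.

Lemma sqr_norm (x : R) : `|x| ^+ 2 = x ^+ 2.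
Proof. by rewrite real_normK ?num_real. Qed.

Lemma norm_le_of_sqr (x y : R) : 0 <= y -> x ^+ 2 <= y ^+ 2 -> `|x| <= y.
Proof. by move=> y0 xy; rewrite -(ler_pXn2r (_ : 0 < 2)%N) ?nnegrE// sqr_norm. Qed.

Lemma lee_of_factor (x y : \bar R) : (0 <= y)%E ->
  (forall e : R, 0 < e -> (x <= (1 + e)%:E * y)%E) -> (x <= y)%E.
Proof.
case: y => [y| |]//=; last by move=> *; rewrite leey.
rewrite lee_fin => y0 H; apply/lee_addgt0Pr => e e0.
have e1 : 0 < e / (y + 1) by rewrite divr_gt0//; lra.
apply: (le_trans (H _ e1)); rewrite -EFinM -EFinD lee_fin mulrDl mul1r lerD2l.
rewrite -mulrA ger_pMr// mulrC ler_pdivrMr ?mul1r; lra.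
Qed.

Lemma cube_small (C e : R) : 0 <= C -> 0 < e ->
  exists2 r, 0 < r & (1 + 4 * C * r) ^+ 3 <= 1 + e.
Proof.
move=> C0 e0; pose t := Num.min 1 (e / 7).
have t0 : 0 < t by rewrite lt_min ltr01 divr_gt0.
have t1 : t <= 1 by rewrite ge_min lexx.
have te : 7 * t <= e by rewrite mulrC -ler_pdivlMr// ge_min lexx orbT.
have C4 : 0 < 4 * C + 1 by lra.
exists (t / (4 * C + 1)); first by rewrite divr_gt0.
set u := 4 * C * _.
have u0 : 0 <= u by apply: mulr_ge0; [rewrite mulr_ge0|rewrite divr_ge0// ltW].
have ut : u <= t.
  rewrite /u mulrCA ger_pMr// ler_pdivrMr// mul1r; lra.
rewrite !exprS expr0 mulr1; nra.
Qed.

(** The metric induced on the plane by the linear map of slopes [a], [b]. *)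
Definition graph_form (a b : R) (p q : coord_plane R) : R :=
  ((p.1 : R) - q.1) ^+ 2 + ((p.2 : R) - q.2) ^+ 2
    + (a * ((p.1 : R) - q.1) + b * ((p.2 : R) - q.2)) ^+ 2.

Definition jac (a b : R) : R := Num.sqrt (1 + a ^+ 2 + b ^+ 2).

Lemma sqr_jac a b : jac a b ^+ 2 = 1 + a ^+ 2 + b ^+ 2.
Proof. by rewrite sqr_sqrtr// !addr_ge0// sqr_ge0. Qed.

Lemma jac_ge1 a b : 1 <= jac a b.
Proof.
rewrite -[leLHS]sqrtr1 ler_sqrt; last by rewrite !addr_ge0// sqr_ge0.
by rewrite -addrA lerDl addr_ge0// sqr_ge0.
Qed.

Lemma jac_gt0 a b : 0 < jac a b.
Proof. exact: lt_le_trans ltr01 (jac_ge1 a b). Qed.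

Lemma jac_lip a b a' b' : jac a b <= jac a' b' + (`|a - a'| + `|b - b'|).
Proof.
have j0 := jac_gt0 a' b'; set u := `|a - a'|; set v := `|b - b'|.
have u0 : 0 <= u := normr_ge0 _; have v0 : 0 <= v := normr_ge0 _.
rewrite -(ler_pXn2r (_ : 0 < 2)%N) ?nnegrE ?addr_ge0 ?(ltW (jac_gt0 _ _))//.
have ja : `|a'| <= jac a' b'.
  by apply: norm_le_of_sqr (ltW j0) _; rewrite sqr_jac; have := sqr_ge0 b'; lra.
have jb : `|b'| <= jac a' b'.
  by apply: norm_le_of_sqr (ltW j0) _; rewrite sqr_jac; have := sqr_ge0 a'; lra.
have ha : a ^+ 2 <= a' ^+ 2 + 2 * jac a' b' * u + u ^+ 2.
  have -> : a = a' + (a - a') by ring.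
  rewrite sqrrD sqr_norm lerD2r lerD2l -mulr_natl -mulrA ler_pM2l//.
  apply: (le_trans (ler_norm _)); rewrite normrM.
  by rewrite ler_wpM2r.
have hb : b ^+ 2 <= b' ^+ 2 + 2 * jac a' b' * v + v ^+ 2.
  have -> : b = b' + (b - b') by ring.
  rewrite sqrrD sqr_norm lerD2r lerD2l -mulr_natl -mulrA ler_pM2l//.
  apply: (le_trans (ler_norm _)); rewrite normrM.
  by rewrite ler_wpM2r.
have E := sqr_jac a' b'.
rewrite sqr_jac sqrrD E; have := mulr_ge0 u0 v0; nra.
Qed.

Lemma quad_perturb (x y l l' rho : R) : 0 <= rho ->
  `|l' - l| <= rho * (`|x| + `|y|) ->
  x ^+ 2 + y ^+ 2 + l' ^+ 2 <= (1 + 2 * rho) ^+ 2 * (x ^+ 2 + y ^+ 2 + l ^+ 2).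
Proof.
move=> rho0 ll; pose N := Num.sqrt (x ^+ 2 + y ^+ 2 + l ^+ 2).
have N0 : 0 <= N := sqrtr_ge0 _.
have NE : N ^+ 2 = x ^+ 2 + y ^+ 2 + l ^+ 2 by rewrite sqr_sqrtr// !addr_ge0// sqr_ge0.
have bnd (z : R) : z ^+ 2 <= N ^+ 2 -> `|z| <= N by exact: norm_le_of_sqr.
have xN : `|x| <= N by apply: bnd; rewrite NE -addrA lerDl addr_ge0// sqr_ge0.
have yN : `|y| <= N by apply: bnd; rewrite NE; have := sqr_ge0 x; have := sqr_ge0 l; lra.
have lN : `|l| <= N by apply: bnd; rewrite NE lerDr addr_ge0// sqr_ge0.
have eN : `|l' - l| <= 2 * rho * N by nra.
rewrite -NE; have -> : l' = l + (l' - l) by ring.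
rewrite [X in _ + X <= _]sqrrD.
have : l * (l' - l) <= N * (2 * rho * N).
  apply: (le_trans (ler_norm _)); rewrite normrM; exact: ler_pM.
have : (l' - l) ^+ 2 <= (2 * rho * N) ^+ 2.
  by rewrite -sqr_norm lerXn2r ?nnegrE// !mulr_ge0.
rewrite -mulr_natl; nra.
Qed.

Section Cholesky.
Variables a b : R.

Let al := Num.sqrt (1 + a ^+ 2).
Let ga := jac a b / al.
Let be := a * b / al.

Let al0 : 0 < al.
Proof. by rewrite sqrtr_gt0 ltr_pwDl// sqr_ge0. Qed.

Let al2 : al ^+ 2 = 1 + a ^+ 2.
Proof. by rewrite sqr_sqrtr// addr_ge0// sqr_ge0. Qed.

Let ga0 : 0 < ga.
Proof. by rewrite divr_gt0// jac_gt0. Qed.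

Definition cholesky (p : coord_plane R) : coord_plane R :=
  (al * (p.1 : R) + be * (p.2 : R), ga * (p.2 : R)).

Let T (p : coord_plane R) : coord_plane R :=
  (((p.1 : R) - be / ga * (p.2 : R) - 0) / al, ((p.2 : R) - 0) / ga).

Let choleskyK : cancel cholesky T.
Proof.
move=> [x y]; rewrite /T /cholesky /= !subr0; congr (_, _).
  by field; rewrite !gt_eqF.
by field; rewrite gt_eqF.
Qed.

Let TK : cancel T cholesky.
Proof.
move=> [x y]; rewrite /T /cholesky /= !subr0; congr (_, _).
  by field; rewrite !gt_eqF.
by field; rewrite gt_eqF.
Qed.

Lemma cholesky_form p q :
  ((cholesky p).1 - (cholesky q).1) ^+ 2 + ((cholesky p).2 - (cholesky q).2) ^+ 2 =
  graph_form a b p q :> R.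
Proof.
rewrite /cholesky /graph_form /=; move: (p.1 : R) (p.2 : R) (q.1 : R) (q.2 : R) => x y z t.
have al_neq0 : al != 0 by rewrite gt_eqF.
have -> : (al * x + be * y - (al * z + be * t)) ^+ 2 + (ga * y - ga * t) ^+ 2 =
   al ^+ 2 * (x - z) ^+ 2 + 2 * (a * b) * (x - z) * (y - t) +
   ((a * b) ^+ 2 + jac a b ^+ 2) / al ^+ 2 * (y - t) ^+ 2.
  by rewrite /be /ga; field.
have -> : ((a * b) ^+ 2 + jac a b ^+ 2) / al ^+ 2 = 1 + b ^+ 2.
  have h : 1 + a ^+ 2 != 0 by rewrite -al2 expf_neq0.
  by rewrite sqr_jac al2; field.
by rewrite al2; ring.
Qed.

Lemma cholesky_imageE (B : set (coord_plane R)) : cholesky @` B = T @^-1` B.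
Proof.
apply/seteqP; split=> p; first by move=> [q Bq <-]; rewrite /preimage /= choleskyK.
by move=> Bp; exists (T p); rewrite ?TK.
Qed.

Lemma measurable_cholesky_image (B : set (coord_plane R)) : measurable B ->
  measurable (cholesky @` B).
Proof.
move=> mB; rewrite cholesky_imageE -[X in measurable X]setTI.
have : measurable_fun setT T.
  apply: measurable_fun_pair.
    apply: (measurableT_comp (measurable_affine 0 al)).
    apply: measurable_funB; first exact: measurable_fst.
    by apply: measurable_funM => //; exact: measurable_snd.
  by apply: (measurableT_comp (measurable_affine 0 ga)); exact: measurable_snd.
by apply.
Qed.

Lemma area_cholesky_image (B : set (coord_plane R)) : measurable B ->
  area (cholesky @` B) = ((jac a b)%:E * area B)%E.
Proof.
move=> mB; rewrite cholesky_imageE area_triangular//; congr (_%:E * _)%E.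
by rewrite /ga mulrC divfK// gt_eqF.
Qed.

Lemma isodiametric_form (B : set (coord_plane R)) (d : R) : measurable B -> 0 <= d ->
  (forall p q, B p -> B q -> graph_form a b p q <= d ^+ 2) ->
  ((jac a b)%:E * area B <= (pi / 4 * d ^+ 2)%:E)%E.
Proof.
move=> mB d0 Bd; rewrite -area_cholesky_image//; apply: isodiametric => //.
  exact: measurable_cholesky_image.
by move=> _ _ [p Bp <-] [q Bq <-]; rewrite cholesky_form; exact: Bd.
Qed.

Lemma image_hausdorff_form n (f : coord_plane R -> 'rV[R]_n) (B : set (coord_plane R)) (c : R) :
  measurable B -> 0 < c ->
  (forall p q, B p -> B q -> enorm (f p - f q) ^+ 2 <= c ^+ 2 * graph_form a b p q) ->
  (image_hausdorff 2 f B <= (c ^+ 2 * jac a b)%:E * area B)%E.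
Proof.
move=> mB c0 fB.
apply: (le_trans (@hausdorff_lipschitz R n 3 2 _ f (embed2 \o cholesky) B c c0 _)).
  move=> p q Bp Bq; rewrite enorm_le_sqr; last by rewrite mulr_ge0 ?enorm_ge0// ltW.
  rewrite exprMn.
  have -> : enorm ((embed2 \o cholesky) p - (embed2 \o cholesky) q) ^+ 2 = graph_form a b p q.
    by rewrite /= enorm_embed2 cholesky_form.
  exact: fB.
rewrite [(c ^+ 2 * jac a b)%:E]EFinM -muleA -area_cholesky_image//; apply: lee_wpmul2l.
  by rewrite lee_fin exprn_ge0// ltW.
rewrite (_ : image_hausdorff _ _ _ = image_hausdorff 2 embed2 (cholesky @` B)).
  by apply: image_hausdorff_plane; exact: measurable_cholesky_image.
by rewrite /image_hausdorff image_comp.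
Qed.

End Cholesky.
End Quadratic.


Lemma mvt_between (R : realType) (u u' : R -> R) (lo hi s t : R) :
  (forall x : R, lo <= x <= hi -> is_derive x 1 u (u' x)) ->
  lo <= s <= hi -> lo <= t <= hi ->
  exists2 x, lo <= x <= hi & u s - u t = u' x * (s - t).
Proof.
move=> du.
have aux a b : a < b -> lo <= a <= hi -> lo <= b <= hi ->
    exists2 x, lo <= x <= hi & u b - u a = u' x * (b - a).
  move=> ab /andP[loa ahi] /andP[lob bhi].
  have inlohi x : a <= x <= b -> lo <= x <= hi.
    by move=> /andP[ax xb]; rewrite (le_trans loa)//= (le_trans xb).
  have [||] := @MVT R u u' a b ab.
  - by move=> x; rewrite in_itv/= => /andP[/ltW ax /ltW xb]; apply/du/inlohi; rewrite ax.
  - apply: derivable_within_continuous => x; rewrite in_itv/= => xab.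
    by have [] := du x (inlohi x xab).
  move=> x; rewrite in_itv/= => /andP[/ltW ax /ltW xb] E.
  by exists x => //; apply: inlohi; rewrite ax.
move=> slo tlo; have [st|ts|->] := ltgtP s t; last by exists t; rewrite // !subrr mulr0.
  have [x xlo E] := aux _ _ st slo tlo; exists x => //.
  by rewrite -opprB E -mulrN opprB.
exact: aux.
Qed.

Section AreaFormula.
Context {R : realType} (n : nat).
Variables (g gx gy : R -> R -> R) (G : R) (f : coord_plane R -> 'rV[R]_n).

Hypothesis f_graph : forall p q : coord_plane R, enorm (f p - f q) ^+ 2 =
  ((p.1 : R) - q.1) ^+ 2 + ((p.2 : R) - q.2) ^+ 2 + (g p.1 p.2 - g q.1 q.2) ^+ 2.
Hypothesis dgx : forall x y : R, 0 < x -> is_derive x 1 (g^~ y) (gx x y).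
Hypothesis dgy : forall x y : R, 0 < x -> is_derive y 1 (g x) (gy x y).
Hypothesis gx_bound : forall x y, 0 < x -> `|gx x y| <= G.
Hypothesis gy_bound : forall x y, 0 < x -> `|gy x y| <= G.
Hypothesis grad_lip : forall a, 0 < a -> exists2 C, 0 <= C &
  forall x y x' y', a <= x -> a <= x' ->
    `|gx x y - gx x' y'| <= C * (`|x - x'| + `|y - y'|) /\
    `|gy x y - gy x' y'| <= C * (`|x - x'| + `|y - y'|).
Hypothesis measurable_gx : measurable_fun setT (fun p : coord_plane R => gx p.1 p.2 : line R).
Hypothesis measurable_gy : measurable_fun setT (fun p : coord_plane R => gy p.1 p.2 : line R).

Let G0 : 0 <= G.
Proof. by have := gx_bound 0 ltr01; apply: le_trans. Qed.

Definition half_plane (a : R) : set (coord_plane R) := [set p | a <= p.1].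
Definition open_half_plane : set (coord_plane R) := [set p | 0 < p.1].

Lemma measurable_half_plane a : measurable (half_plane a).
Proof.
rewrite (_ : half_plane a = fst @^-1` `[a, +oo[); last first.
  by apply/seteqP; split=> p; rewrite /half_plane /= in_itv/= andbT.
by rewrite -[X in measurable X]setTI; apply: measurable_fst => //; exact: measurable_itv.
Qed.

Lemma measurable_open_half_plane : measurable open_half_plane.
Proof.
rewrite (_ : open_half_plane = fst @^-1` `]0, +oo[); last first.
  by apply/seteqP; split=> p; rewrite /open_half_plane /= in_itv/= andbT.
by rewrite -[X in measurable X]setTI; apply: measurable_fst => //; exact: measurable_itv.
Qed.

Lemma graph_taylor a C x0 y0 x y x' y' r : 0 < a -> 0 <= C ->
  (forall x y x' y', a <= x -> a <= x' ->
    `|gx x y - gx x' y'| <= C * (`|x - x'| + `|y - y'|) /\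
    `|gy x y - gy x' y'| <= C * (`|x - x'| + `|y - y'|)) ->
  a <= x0 -> a <= x -> a <= x' ->
  `|x - x0| <= r -> `|y - y0| <= r -> `|x' - x0| <= r -> `|y' - y0| <= r ->
  `|g x y - g x' y' - (gx x0 y0 * (x - x') + gy x0 y0 * (y - y'))| <=
    2 * C * r * (`|x - x'| + `|y - y'|).
Proof.
move=> a0 C0 lip ax0 ax ax' xr yr x'r y'r.
pose lo := Num.max a (x0 - r); pose hi := x0 + r.
have lohi t : a <= t -> `|t - x0| <= r -> lo <= t <= hi.
  move=> at_; rewrite ler_norml => /andP[? ?]; rewrite ge_max at_ /=.
  by apply/andP; split; rewrite /hi; lra.
have lohiV t : lo <= t <= hi -> a <= t /\ `|t - x0| <= r.
  rewrite ge_max /hi => /andP[/andP[? ?] ?]; split => //.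
  by rewrite ler_norml; apply/andP; split; lra.
have [xi /lohiV[axi xir] Ex] := @mvt_between R (g^~ y) (gx^~ y) lo hi x x'
  (fun t tl => dgx y (lt_le_trans a0 (lohiV t tl).1)) (lohi x ax xr) (lohi x' ax' x'r).
have yr' t : `|t - y0| <= r -> y0 - r <= t <= y0 + r.
  by rewrite ler_norml => /andP[? ?]; apply/andP; split; lra.
have [eta etar Ey] := @mvt_between R (g x') (gy x') (y0 - r) (y0 + r) y y'
  (fun t _ => dgy t (lt_le_trans a0 ax')) (yr' y yr) (yr' y' y'r).
have {}etar : `|eta - y0| <= r.
  by move: etar => /andP[? ?]; rewrite ler_norml; apply/andP; split; lra.
have -> : g x y - g x' y' - (gx x0 y0 * (x - x') + gy x0 y0 * (y - y')) =
    (gx xi y - gx x0 y0) * (x - x') + (gy x' eta - gy x0 y0) * (y - y').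
  rewrite [_ * (x - x') in RHS]mulrBl [_ * (y - y') in RHS]mulrBl -Ex -Ey; ring.
have [Lx _] := lip xi y x0 y0 axi ax0.
have [_ Ly] := lip x' eta x0 y0 ax' ax0.
have {}Lx : `|gx xi y - gx x0 y0| <= 2 * C * r.
  by apply: (le_trans Lx); rewrite -mulrA mulrCA ler_wpM2l//; lra.
have {}Ly : `|gy x' eta - gy x0 y0| <= 2 * C * r.
  by apply: (le_trans Ly); rewrite -mulrA mulrCA ler_wpM2l//; lra.
apply: (le_trans (ler_normD _ _)); rewrite !normrM mulrDr.
by apply: lerD; apply: ler_wpM2r.
Qed.

Lemma graph_lip (p q : coord_plane R) : 0 < (p.1 : R) -> 0 < (q.1 : R) ->
  enorm (f p - f q) <= (1 + G) * (`|(p.1 : R) - q.1| + `|(p.2 : R) - q.2|).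
Proof.
move=> p0 q0; set X := `|_|; set Y := `|(p.2 : R) - _|.
have X0 : 0 <= X := normr_ge0 _; have Y0 : 0 <= Y := normr_ge0 _.
have hg : `|g p.1 p.2 - g q.1 q.2| <= G * (X + Y).
  have min_max_l (u v : R) : Num.min u v <= u <= Num.max u v.
    by rewrite ge_min lexx le_max lexx.
  have min_max_r (u v : R) : Num.min u v <= v <= Num.max u v.
    by rewrite ge_min lexx le_max lexx !orbT.
  pose lo := Num.min (p.1 : R) (q.1 : R); pose hi := Num.max (p.1 : R) (q.1 : R).
  have lo0 : 0 < lo by rewrite lt_min p0.
  have [xi /andP[xilo _] Ex] := @mvt_between R (g^~ p.2) (gx^~ p.2) lo hi p.1 q.1
    (fun t tl => dgx p.2 (lt_le_trans lo0 (proj1 (andP tl)))) (min_max_l _ _) (min_max_r _ _).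
  pose lo' := Num.min (p.2 : R) (q.2 : R); pose hi' := Num.max (p.2 : R) (q.2 : R).
  have [eta _ Ey] := @mvt_between R (g q.1) (gy q.1) lo' hi' p.2 q.2
    (fun t _ => dgy t q0) (min_max_l _ _) (min_max_r _ _).
  have -> : g p.1 p.2 - g q.1 q.2 = (g p.1 p.2 - g q.1 p.2) + (g q.1 p.2 - g q.1 q.2) by ring.
  rewrite Ex Ey; apply: (le_trans (ler_normD _ _)); rewrite !normrM mulrDr.
  by apply: lerD; apply: ler_wpM2r => //; [apply: gx_bound; exact: lt_le_trans xilo|exact: gy_bound].
rewrite enorm_le_sqr; last by rewrite mulr_ge0 ?addr_ge0.
rewrite f_graph -(sqr_norm (g _ _ - _)) -(sqr_norm ((p.1 : R) - _)) -(sqr_norm ((p.2 : R) - _)).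
rewrite -/X -/Y; set Z := `|g _ _ - _| in hg *.
have Z0 : 0 <= Z := normr_ge0 _.
have : Z ^+ 2 <= (G * (X + Y)) ^+ 2 by rewrite lerXn2r ?nnegrE// mulr_ge0// addr_ge0.
have := mulr_ge0 X0 Y0; have := mulr_ge0 G0 (sqr_ge0 (X + Y)); rewrite exprMn; nra.
Qed.

Definition jac_fun (p : coord_plane R) : R :=
  if 0 < (p.1 : R) then jac (gx p.1 p.2) (gy p.1 p.2) else 0.

Lemma jac_fun_ge0 p : 0 <= jac_fun p.
Proof. by rewrite /jac_fun; case: ifP => // _; exact: sqrtr_ge0. Qed.

Lemma measurable_jac_fun : measurable_fun setT (jac_fun : coord_plane R -> line R).
Proof.
apply: measurable_fun_ifT.
- apply: measurable_fun_ltr; first exact: measurable_cst.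
  exact: measurable_fst.
- apply: (measurableT_comp (measurable_funTS (continuous_measurable_fun (@sqrt_continuous R)))).
  apply: measurable_funD; last exact: measurable_funX.
  by apply: measurable_funD => //; exact: measurable_funX.
- exact: measurable_cst.
Qed.

Definition graph_measure : {measure set (coord_plane R) -> \bar R} :=
  density_measure area measurable_jac_fun jac_fun_ge0.

Lemma jac_fun_lip a C p q : 0 < a ->
  (forall x y x' y', a <= x -> a <= x' ->
    `|gx x y - gx x' y'| <= C * (`|x - x'| + `|y - y'|) /\
    `|gy x y - gy x' y'| <= C * (`|x - x'| + `|y - y'|)) ->
  half_plane a p -> half_plane a q ->
  jac_fun p <= jac_fun q + 2 * C * (`|(p.1 : R) - q.1| + `|(p.2 : R) - q.2|).
Proof.
move=> a0 lip ap aq; rewrite /jac_fun !ifT; [|exact: lt_le_trans aq|exact: lt_le_trans ap].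
have [h1 h2] := lip _ p.2 _ q.2 ap aq.
apply: (le_trans (jac_lip _ _ (gx q.1 q.2) (gy q.1 q.2))); rewrite lerD2l; lra.
Qed.

Lemma jac_fun_ge1 p : 0 < (p.1 : R) -> 1 <= jac_fun p.
Proof. by move=> p0; rewrite /jac_fun p0; exact: jac_ge1. Qed.

Lemma jac_funE p : 0 < (p.1 : R) -> jac_fun p = jac (gx p.1 p.2) (gy p.1 p.2).
Proof. by move=> p0; rewrite /jac_fun p0. Qed.

(** Comparing the integral of the Jacobian over a small set with a value. *)
Lemma graph_measure_le (B : set (coord_plane R)) (c : R) : measurable B -> 0 <= c ->
  (forall p, B p -> jac_fun p <= c) -> (graph_measure B <= c%:E * area B)%E.
Proof.
move=> mB c0 Bc; rewrite density_measureE -integral_cst//.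
apply: ge0_le_integral => //.
- by move=> p _; rewrite lee_fin jac_fun_ge0.
- by apply/measurable_EFinP; apply: measurable_funTS; exact: measurable_jac_fun.
Qed.

Lemma graph_measure_ge (B : set (coord_plane R)) (c : R) : measurable B -> 0 <= c ->
  (forall p, B p -> c <= jac_fun p) -> (c%:E * area B <= graph_measure B)%E.
Proof.
move=> mB c0 Bc; rewrite density_measureE -integral_cst//.
apply: ge0_le_integral => //.
- by apply/measurable_EFinP; apply: measurable_funTS; exact: measurable_jac_fun.
Qed.

Lemma image_hausdorff_graph_small a C r (B : set (coord_plane R)) : 0 < a -> 0 <= C -> 0 <= r ->
  (forall x y x' y', a <= x -> a <= x' ->
    `|gx x y - gx x' y'| <= C * (`|x - x'| + `|y - y'|) /\
    `|gy x y - gy x' y'| <= C * (`|x - x'| + `|y - y'|)) ->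
  measurable B -> B `<=` half_plane a ->
  (forall p q, B p -> B q -> `|(p.1 : R) - q.1| <= r /\ `|(p.2 : R) - q.2| <= r) ->
  (image_hausdorff 2 f B <= ((1 + 4 * C * r) ^+ 3)%:E * graph_measure B)%E.
Proof.
move=> a0 C0 r0 lip mB Ba Br; have [->|/set0P[p0 Bp0]] := eqVneq B set0.
  by rewrite image_hausdorff0 measure0 mule0.
have p00 : 0 < (p0.1 : R) := lt_le_trans a0 (Ba _ Bp0).
set c := 1 + 4 * C * r; have Cr : 0 <= C * r by rewrite mulr_ge0.
have c1 : 1 <= c by rewrite /c; lra.
have c0 : 0 < c by lra.
apply: (le_trans (@image_hausdorff_form R (gx p0.1 p0.2) (gy p0.1 p0.2) n f B c mB c0 _)).
  move=> p q Bp Bq; rewrite f_graph /graph_form (_ : c = 1 + 2 * (2 * C * r)); last first.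
    by rewrite /c; ring.
  apply: quad_perturb; first by rewrite -mulrA mulr_ge0.
  have [? ?] := Br _ _ Bp Bp0; have [? ?] := Br _ _ Bq Bp0.
  by apply: (graph_taylor a0 C0 lip) => //; exact: Ba.
have jp0 p : B p -> jac (gx p0.1 p0.2) (gy p0.1 p0.2) <= c * jac_fun p.
  move=> Bp; rewrite -jac_funE//.
  apply: (le_trans (jac_fun_lip a0 lip (Ba _ Bp0) (Ba _ Bp))).
  have [h1 h2] := Br _ _ Bp0 Bp.
  have := jac_fun_ge1 (lt_le_trans a0 (Ba _ Bp)); set J := jac_fun p => J1.
  have : C * (`|(p0.1 : R) - p.1| + `|(p0.2 : R) - p.2|) <= C * (2 * r).
    by rewrite ler_wpM2l//; lra.
  have : C * r <= C * r * J by rewrite ler_peMr.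
  rewrite /c; lra.
apply: (@le_trans _ _ ((c ^+ 2)%:E * (c%:E * graph_measure B))%E); last first.
  by rewrite muleA -EFinM -exprSr.
rewrite [(c ^+ 2 * _)%:E]EFinM -muleA; apply: lee_wpmul2l.
  by rewrite lee_fin exprn_ge0// ltW.
rewrite -lee_pdivrMl// muleA -EFinM; apply: graph_measure_ge => //.
  by rewrite mulr_ge0 ?invr_ge0 ?(ltW c0)// ltW// jac_gt0.
by move=> p Bp; rewrite ler_pdivrMl//; exact: jp0.
Qed.

Lemma image_hausdorff_graph_le_half_plane a (E : set (coord_plane R)) : 0 < a -> measurable E ->
  E `<=` half_plane a -> (image_hausdorff 2 f E <= graph_measure E)%E.
Proof.
move=> a0 mE Ea; have [C C0 lip] := grad_lip a0.
apply: lee_of_factor => [|e e0]; first exact: measure_ge0.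
have [r r0 re] := cube_small C0 e0.
have [k _ /ltW kr] := exists_pow2_lt 0 r0.
pose P m := if pickle_inv m is Some i then E `&` cell dyadic2 k i else set0 : set (coord_plane R).
have mP m : measurable (P m).
  by rewrite /P; case: pickle_inv => // i; apply: measurableI => //; exact: measurable_dyadic2_cell.
have PE : E = \bigcup_m P m.
  apply/seteqP; split=> p.
    move=> Ep; set i := dyadic2 k p; exists (pickle i); first exact: I.
    by rewrite /P pickleK_inv; split; [exact: Ep|rewrite /i].
  by move=> [m _]; rewrite /P; case: pickle_inv => // i [].
have tP : trivIset setT P.
  move=> m l _ _ [p []]; rewrite /P.
  case Em : pickle_inv => [i|//] [_ /= pi]; case En : pickle_inv => [j|//] [_ /= pj].
  have := @pickle_invK (int * int)%type m; have := @pickle_invK (int * int)%type l.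
  by rewrite Em En /= => <- <-; rewrite -pi -pj.
rewrite {1}PE; apply: (le_trans (outer_measure_sigma_subadditive (image_hausdorff 2 f) _)).
rewrite [in leRHS]PE measure_semi_bigcup//; last by rewrite -PE.
rewrite -nneseriesZl; last by move=> m _; exact: measure_ge0.
apply: lee_nneseries => m _; first by move=> _; exact: outer_measure_ge0.
have k0 : 0 <= (2 ^+ k)^-1 :> R by rewrite invr_ge0 exprn_ge0.
apply: (@le_trans _ _ (((1 + 4 * C * (2 ^+ k)^-1) ^+ 3)%:E * graph_measure (P m))%E).
  apply: (image_hausdorff_graph_small a0 C0 k0 lip) => //.
  - by rewrite /P; case: pickle_inv => // i p [/Ea].
  - rewrite /P; case: pickle_inv => // i p q [_ pi] [_ qi].
    move: pi qi; rewrite dyadic2_cellE => -[p1 p2] [q1 q2].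
    by split; apply/ltW/dyadic_close; [move: p1 q1|move: p2 q2]; rewrite /cell /= => -> ->.
apply: lee_wpmul2r; first exact: measure_ge0.
rewrite lee_fin; apply: le_trans re.
rewrite lerXn2r ?nnegrE ?lerD2l ?ler_wpM2l ?mulr_ge0// ?addr_ge0 ?mulr_ge0//; exact: ltW.
Qed.

Lemma image_hausdorff_graph_le (E : set (coord_plane R)) : measurable E ->
  E `<=` open_half_plane -> (image_hausdorff 2 f E <= graph_measure E)%E.
Proof.
move=> mE E0; pose F k := E `&` half_plane (2 ^+ k)^-1.
have mF k : measurable (F k) by apply: measurableI => //; exact: measurable_half_plane.
have FE : \bigcup_k F k = E.
  apply/seteqP; split=> [p [k _ []]//|p Ep].
  by have [k _ /ltW kp] := exists_pow2_lt 0 (E0 p Ep); exists k.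
have mD k : measurable (seqDU F k) by exact: seqDU_measurable.
have DE : \bigcup_k seqDU F k = E by rewrite -seqDU_bigcup_eq.
rewrite -{1}DE; apply: (le_trans (outer_measure_sigma_subadditive (image_hausdorff 2 f) _)).
rewrite -[in leRHS]DE measure_semi_bigcup//; last by rewrite DE.
apply: lee_nneseries => k _; first by move=> _; exact: outer_measure_ge0.
apply: (@image_hausdorff_graph_le_half_plane (2 ^+ k)^-1) => //.
by move=> p /(@subset_seqDU _ F) [].
Qed.

(** Sets of small diameter on the graph are contained in Borel ones: take the
    points at distance at most [e] of all points that are at distance at most
    [e] of the set. *)
Lemma measurable_hull a e (D : set (coord_plane R)) : 0 < a -> D `<=` half_plane a ->
  (forall p q, D p -> D q -> enorm (f p - f q) <= e) ->
  exists B, [/\ measurable B, D `<=` B, B `<=` half_plane a &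
    forall p q, B p -> B q -> enorm (f p - f q) <= e].
Proof.
move=> a0 Da De.
pose C := [set q | half_plane a q /\ forall q', D q' -> enorm (f q - f q') <= e].
pose U := [set p | open_half_plane p /\ exists2 q, C q & e < enorm (f p - f q)].
have oU : cell_open dyadic2 0 U.
  move=> p [p0 [q Cq pq]].
  pose s := (enorm (f p - f q) - e) / (2 * (1 + G)).
  have s0 : 0 < s by rewrite divr_gt0 ?subr_gt0// mulr_gt0// ltr_pwDl.
  have sp0 : 0 < Num.min s (p.1 : R) by rewrite lt_min s0.
  have [k _ kps] := exists_pow2_lt 0 sp0.
  move: kps; rewrite lt_min => /andP[ks kp]; exists k => // p'.
  rewrite /cell /= => -[/dyadic_close p1 /dyadic_close p2].
  have p'0 : 0 < (p'.1 : R).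
    by move: p1; rewrite ltr_norml => /andP[? ?]; lra.
  split=> //; exists q => //.
  have lip := graph_lip p0 p'0; rewrite -![`|(p.1 : R) - _|]distrC -![`|(p.2 : R) - _|]distrC in lip.
  have tri : enorm (f p - f q) <= enorm (f p - f p') + enorm (f p' - f q).
    by apply: le_trans (enormD _ _); rewrite addrA subrK.
  have : enorm (f p - f p') < enorm (f p - f q) - e.
    apply: (le_lt_trans lip).
    have -> : enorm (f p - f q) - e = (1 + G) * (2 * s).
      by rewrite /s; field; rewrite gt_eqF// ltr_pwDl.
    rewrite ltr_pM2l ?ltr_pwDl//; lra.
  lra.
exists (half_plane a `\` U); split.
- apply: measurableD; first exact: measurable_half_plane.
  by apply: (measurable_cell_open _ _ oU); [exact: dyadic2_refines|exact: measurable_dyadic2_cell].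
- move=> p Dp; split; first exact: Da.
  move=> [_ [q [_ Cq]]]; rewrite enormB ltNge => /negP; apply.
  exact: Cq.
- by move=> p [].
move=> p q [pa nUp] [qa nUq]; rewrite leNgt; apply/negP => pq.
apply: nUp; split; first exact: lt_le_trans pa.
exists q => //; split=> // q' Dq'; rewrite leNgt; apply/negP => qq'.
apply: nUq; split; first exact: lt_le_trans qa.
by exists q' => //; split; [exact: Da|move=> q'' Dq''; exact: De].
Qed.

Lemma graph_measure_le_half_plane a (E : set (coord_plane R)) : 0 < a -> measurable E ->
  E `<=` half_plane a -> (graph_measure E <= image_hausdorff 2 f E)%E.
Proof.
move=> a0 mE Ea; have [C C0 lip] := grad_lip a0.
apply: lee_of_factor => [|e e0]; first exact: outer_measure_ge0.
have [r r0 re] := cube_small C0 e0.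
set K := (1 + 4 * C * r) ^+ 3; have Cr : 0 <= C * r by rewrite mulr_ge0// ltW.
have K0 : 0 < K by rewrite exprn_gt0//; lra.
apply: (@le_trans _ _ (K%:E * image_premeasure 2 f r E)%E); last first.
  apply: (@le_trans _ _ (K%:E * image_hausdorff 2 f E)%E).
    apply: lee_wpmul2l; first by rewrite lee_fin ltW.
    exact: image_premeasure_le_hausdorff.
  by apply: lee_wpmul2r; [exact: outer_measure_ge0|rewrite lee_fin].
apply: measure_le_premeasure => // S d d0 dr Sd.
have [||B [mB DB Ba Bd]] := @measurable_hull a d (E `&` f @^-1` S) a0.
- by move=> p [/Ea].
- by move=> p q [_ Sp] [_ Sq]; exact: Sd.
exists B; split => //.
have [B0|/set0P[p0 Bp0]] := eqVneq B set0.
  by rewrite B0 measure0 lee_fin mulr_ge0 ?gauge_of_ge0// ltW.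
have p00 : 0 < (p0.1 : R) := lt_le_trans a0 (Ba _ Bp0).
have Bc p q : B p -> B q -> `|(p.1 : R) - q.1| <= d /\ `|(p.2 : R) - q.2| <= d.
  move=> Bp Bq; have := Bd _ _ Bp Bq; rewrite enorm_le_sqr// f_graph => h.
  have := sqr_ge0 ((p.1 : R) - q.1); have := sqr_ge0 ((p.2 : R) - q.2).
  have := sqr_ge0 (g p.1 p.2 - g q.1 q.2) => *.
  by split; apply: norm_le_of_sqr => //; lra.
set J := jac (gx p0.1 p0.2) (gy p0.1 p0.2).
have J1 : 1 <= J := jac_ge1 _ _.
set c := 1 + 4 * C * r; have c0 : 0 < c by rewrite /c; lra.
have Cdr : C * d <= C * r by rewrite ler_wpM2l.
have iso : (J%:E * area B <= (pi / 4 * (c * d) ^+ 2)%:E)%E.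
  apply: isodiametric_form => //; first by rewrite mulr_ge0// ltW.
  move=> p q Bp Bq; rewrite /graph_form.
  apply: (@le_trans _ _ ((1 + 2 * (2 * C * d)) ^+ 2 * (((p.1 : R) - q.1) ^+ 2 +
     ((p.2 : R) - q.2) ^+ 2 + (g p.1 p.2 - g q.1 q.2) ^+ 2))).
    apply: quad_perturb; first by rewrite mulr_ge0// mulr_ge0.
    have [? ?] := Bc _ _ Bp Bp0; have [? ?] := Bc _ _ Bq Bp0.
    by rewrite distrC; apply: (graph_taylor a0 C0 lip) => //; exact: Ba.
  rewrite -f_graph exprMn; apply: ler_pM; rewrite ?exprn_ge0 ?enorm_ge0//.
    by rewrite addr_ge0// !mulr_ge0.
  - rewrite lerXn2r ?nnegrE//; [by rewrite addr_ge0// !mulr_ge0|exact: ltW|rewrite /c; lra].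
  - by rewrite lerXn2r ?nnegrE ?enorm_ge0//; exact: Bd.
apply: (@le_trans _ _ ((c * J)%:E * area B)%E).
  apply: graph_measure_le => //; first by rewrite mulr_ge0 ?ltW// (lt_le_trans _ J1).
  move=> p Bp; apply: (le_trans (jac_fun_lip a0 lip (Ba _ Bp) (Ba _ Bp0))).
  rewrite jac_funE// -/J; have [h1 h2] := Bc _ _ Bp Bp0.
  have : C * (`|(p.1 : R) - p0.1| + `|(p.2 : R) - p0.2|) <= C * (2 * d).
    by rewrite ler_wpM2l//; lra.
  have : C * r <= C * r * J by rewrite ler_peMr.
  rewrite /c; lra.
rewrite EFinM -muleA; apply: (@le_trans _ _ (c%:E * (pi / 4 * (c * d) ^+ 2)%:E)%E).
  by apply: lee_wpmul2l; [rewrite lee_fin ltW|exact: iso].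
rewrite -EFinM lee_fin gauge_of2 /K -/c le_eqVlt; apply/orP; left; apply/eqP; ring.
Qed.

(** The area formula for the graph of a function on the open half-plane. *)
Theorem image_hausdorff_graph (E : set (coord_plane R)) : measurable E ->
  E `<=` open_half_plane -> image_hausdorff 2 f E = graph_measure E.
Proof.
move=> mE E0; apply/eqP; rewrite eq_le image_hausdorff_graph_le//=.
pose F k := E `&` half_plane (2 ^+ k)^-1.
have mF k : measurable (F k) by apply: measurableI => //; exact: measurable_half_plane.
have FE : \bigcup_k F k = E.
  apply/seteqP; split=> [p [k _ []]//|p Ep].
  by have [k _ /ltW kp] := exists_pow2_lt 0 (E0 p Ep); exists k.
have ndF : {homo F : k l / (k <= l)%N >-> (k <= l)%O}.
  move=> k l kl; apply/subsetPset => p [Ep pk]; split=> //.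
  apply: le_trans pk; rewrite lef_pV2 ?posrE ?exprn_gt0// ler_weXn2l// ler1n//.
have cF : graph_measure (F k) @[k --> \oo] --> graph_measure E.
  rewrite -[X in _ --> graph_measure X]FE; apply: nondecreasing_cvg_mu => //.
  by rewrite FE.
rewrite -(cvg_lim _ cF)//; apply: lime_le; first by apply/cvg_ex; exists (graph_measure E).
apply: nearW => k; apply: (@le_trans _ _ (image_hausdorff 2 f (F k))).
  apply: (@graph_measure_le_half_plane (2 ^+ k)^-1) => //; last by move=> p [].
by apply: le_outer_measure => p [].
Qed.

End AreaFormula.


(** The antiderivative [Psi] of [Phi] that is odd; its values beyond [1] are
    those of half of the integral of [Phi]. *)
Record profile (R : realType) (Phi Phi' Psi : R -> R) : Prop := Profile {
  is_derive_Phi : forall s : R, is_derive s 1 Phi (Phi' s);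
  is_derive_Psi : forall s : R, is_derive s 1 Psi (Phi s);
  continuous_Phi' : continuous Phi';
  Phi_ge0_le1 : forall s, 0 <= Phi s <= 1;
  Phi'_le4 : forall s, `|Phi' s| <= 4;
  Phi_outside : forall s, 1 <= `|s| -> Phi s = 0;
  Phi'_outside : forall s, 1 <= `|s| -> Phi' s = 0;
  Psi_odd : forall s, Psi (- s) = - Psi s;
  Psi_outside : forall s, 1 <= s -> Psi s = 1 / 2;
  Psi_bound : forall s, `|Psi s| <= 1 / 2 }.

Section ProfileExists.
Variables (R : realType) (Phi : R -> R).
Hypotheses
    (Phi_smooth : forall (k : nat) (t : R), derivable (derive1n k Phi) t 1)
    (Phi_bounds : forall t : R, 0 <= Phi t <= 1)
    (Phi_supp : closure [set t : R | Phi t != 0] `<=` `]-1, 1[)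
    (Phi_even : forall t : R, Phi (- t) = Phi t)
    (Phi_slope : forall t : R, `|derive1 Phi t| <= 4)
    (Phi_int : \int[lebesgue_measure]_t Phi t = 1).

Let dPhi (s : R) : is_derive s 1 Phi (derive1 Phi s).
Proof. by rewrite derive1E; apply: derivableP; exact: (@Phi_smooth 0%N s). Qed.

Let cPhi : continuous Phi.
Proof. exact: is_derive_continuous dPhi. Qed.

Let not_closure s : 1 <= `|s| -> ~ closure [set t : R | Phi t != 0] s.
Proof.
move=> s1 /Phi_supp /=; rewrite in_itv/= -ltr_norml ltNge s1; done.
Qed.

Let near0 s : 1 <= `|s| -> \forall t \near s, Phi t = 0.
Proof.
move=> /not_closure ncl.
have : nbhs s (~` closure [set t : R | Phi t != 0]).
  by apply: open_nbhs_nbhs; split => //; apply: closed_openC; exact: closed_closure.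
apply: filterS => t nt; apply/eqP; apply: contrapT => /negP Pt.
by apply: nt; exact: subset_closure.
Qed.

Let Phi_out s : 1 <= `|s| -> Phi s = 0.
Proof. by move=> /near0 /nbhs_singleton. Qed.

Let Phi'_out s : 1 <= `|s| -> derive1 Phi s = 0.
Proof.
move=> /near0 s0; rewrite derive1E (near_eq_derive (g := cst 0)) ?derive_cst//.
Qed.

Let Phi_integrable : (@lebesgue_measure R).-integrable setT (EFin \o Phi).
Proof.
have mPhi : measurable_fun setT Phi by exact: continuous_measurable_fun.
apply/integrableP; split; first exact/measurable_EFinP.
rewrite (_ : integral _ _ _ = (\int[lebesgue_measure]_t (Phi t)%:E)%E); last first.
  by apply: eq_integral => t _ /=; rewrite ger0_norm//; case/andP: (Phi_bounds t).
move: Phi_int; rewrite /Rintegral.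
have : (0 <= \int[lebesgue_measure]_t (Phi t)%:E)%E.
  by apply: integral_ge0 => t _; rewrite lee_fin; case/andP: (Phi_bounds t).
case: (\int[lebesgue_measure]_t (Phi t)%:E)%E => [r| |]//=; first by rewrite ltry.
by move=> _ /eqP; rewrite eq_sym oner_eq0.
Qed.

Let F (s : R) : R := \int[lebesgue_measure]_(t in `]-oo, s]) Phi t.

Let dF (s : R) : is_derive s 1 (fun s => F s - 1 / 2) (Phi s).
Proof.
have ss : s < s + 1 by rewrite ltrDl.
have iPhi : (@lebesgue_measure R).-integrable [set` Interval -oo%O (BRight (s + 1))] (EFin \o Phi).
  by apply: integrableS Phi_integrable => //; exact: measurable_itv.
have [dF F'] : derivable F s 1 /\ (derive1 F) s = Phi s.
  by apply: (continuous_FTC1 ss iPhi); [rewrite /= ltNyr|exact: cPhi].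
have dFs : is_derive s 1 F (Phi s).
  by constructor; [exact: dF|rewrite -derive1E; exact: F'].
by apply: is_derive_eq; rewrite subr0.
Qed.

Let F_out s : 1 <= s -> F s - 1 / 2 = 1 / 2.
Proof.
move=> s1; rewrite /F Rintegral_mkcond -[X in X - _](_ : 1 = _).
  by field.
rewrite -Phi_int; apply: eq_Rintegral => t _; rewrite patchE.
case: ifPn => //; rewrite notin_setE/= in_itv/= => /negP; rewrite -ltNge => st.
by rewrite Phi_out// (le_trans s1)// (le_trans (ltW st)) ?ler_norm.
Qed.

Lemma profile_exists : exists Psi, profile Phi (derive1 Phi) Psi.
Proof.
pose Psi s := F s - 1 / 2; exists Psi.
have odd s : Psi (- s) = - Psi s.
  apply/eqP; rewrite -subr_eq0 opprK.
  have dsum (t : R) : is_derive t 1 (fun t => Psi (- t) + Psi t) 0.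
    have h1 : is_derive t 1 (Psi \o -%R) (Phi (- t) * -1).
      by apply: is_derive1_comp; exact: dF.
    have h2 : is_derive t 1 Psi (Phi t) := dF t.
    have -> : (fun t => Psi (- t) + Psi t) = (Psi \o -%R) + Psi by [].
    by apply: is_derive_eq; rewrite Phi_even mulrN1 addNr.
  have -> := is_derive_0_is_cst s 1 dsum.
  rewrite /= /Psi (@F_out 1 (lexx 1)).
  suff -> : F (-1) = 0 by rewrite sub0r addNr.
  rewrite /F Rintegral_mkcond.
  rewrite (@eq_Rintegral _ _ _ _ _ (cst 0)).
    by rewrite Rintegral_cst// mul0r.
  move=> t _; rewrite patchE; case: ifPn => //; rewrite inE/= in_itv/= => t1.
  by rewrite Phi_out// ler_normr; apply/orP; right; lra.
have nd (s t : R) : s <= t -> Psi s <= Psi t.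
  move=> st; have Phi0 (u : R) : 0 <= Phi u by case/andP: (Phi_bounds u).
  have [x _ E] := @mvt_between R Psi Phi s t t s (fun u _ => dF u)
    (introT andP (conj st (lexx t))) (introT andP (conj (lexx s) st)).
  by rewrite -subr_ge0 E mulr_ge0// subr_ge0.
split => //.
- move=> s; apply: differentiable_continuous; apply/derivable1_diffP.
  exact: (@Phi_smooth 1%N s).
- move=> s; set M := Num.max 1 `|s|.
  have M1 : 1 <= M by rewrite le_max lexx.
  have sM : `|s| <= M by rewrite le_max lexx orbT.
  move: sM; rewrite ler_norml => /andP[/nd h1 /nd h2].
  have PM : Psi M = 1 / 2 by exact: F_out.
  by move: h1 h2; rewrite odd PM ler_norml => -> ->.
Qed.

End ProfileExists.

Section Slopes.
Context {R : realType} (Phi Phi' Psi : R -> R) (H : profile Phi Phi' Psi).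

Definition csl : R := 2 / Num.sqrt 3.

Lemma sqr_sqrt3 : Num.sqrt 3 ^+ 2 = 3 :> R.
Proof. by rewrite sqr_sqrtr. Qed.

Lemma sqrt3_gt0 : 0 < Num.sqrt 3 :> R.
Proof. by rewrite sqrtr_gt0. Qed.

Lemma sqr_csl : csl ^+ 2 = 4 / 3.
Proof. by rewrite expr_div_n sqr_sqrt3; congr (_ / _); ring. Qed.

Lemma csl_gt0 : 0 < csl.
Proof. by rewrite divr_gt0// sqrt3_gt0. Qed.

Lemma csl_le : csl <= 4 / 3.
Proof.
apply: le_trans (ler_norm _) _; apply: norm_le_of_sqr; first by lra.
by rewrite sqr_csl; lra.
Qed.

(** The slopes of the surface in the directions [x] and [y] depend on [s = y / x] only,
    the height being positively homogeneous of degree one. *)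
Definition slope_y (s : R) : R := csl * Phi s.
Definition slope_x (s : R) : R := csl * (Psi s - s * Phi s).
Definition slope_y' (s : R) : R := csl * Phi' s.

Definition surface (x y : R) : R := csl * (x * Psi (y / x)).
Definition surface_x (x y : R) : R := slope_x (y / x).
Definition surface_y (x y : R) : R := slope_y (y / x).

Lemma is_derive_slope_y (s : R) : is_derive s 1 slope_y (slope_y' s).
Proof.
have h := is_derive_Phi H s.
have -> : slope_y = csl *: Phi by [].
by apply: is_deriveZ.
Qed.

Lemma is_derive_slope_x (s : R) : is_derive s 1 slope_x (- s * slope_y' s).
Proof.
have h1 := is_derive_Phi H s; have h2 := is_derive_Psi H s.
have -> : slope_x = csl *: (Psi - id * Phi) by [].
apply: is_derive_eq; rewrite /GRing.scale /= /slope_y'; ring.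
Qed.

Lemma is_derive_quot_x (x y : R) : x != 0 -> is_derive x 1 (fun x => y / x) (- (y / x) / x).
Proof.
move=> x0.
have h : is_derive x 1 (fun z : R => z^-1) (- x ^- 2 *: 1) by apply: is_deriveV.
have -> : (fun x => y / x) = y *: (fun z : R => z^-1) by [].
by apply: is_derive_eq; rewrite /GRing.scale /= mulr1 -exprVn; ring.
Qed.

Lemma is_derive_quot_y (x y : R) : is_derive y 1 (fun y => y / x) x^-1.
Proof.
have -> : (fun y => y / x) = x^-1 *: (id : R -> R) by apply/funext => z; rewrite /= mulrC.
by apply: is_derive_eq; rewrite /GRing.scale /= mulr1.
Qed.

Lemma is_derive_quot_x_comp (u u' : R -> R) (x y : R) :
  (forall s : R, is_derive s 1 u (u' s)) ->
  x != 0 -> is_derive x 1 (fun x => u (y / x)) (u' (y / x) * (- (y / x) / x)).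
Proof.
move=> du x0; have h := is_derive_quot_x y x0; have h' := du (y / x).
exact: (@is_derive1_comp R u (fun x => y / x)).
Qed.

Lemma is_derive_quot_y_comp (u u' : R -> R) (x y : R) :
  (forall s : R, is_derive s 1 u (u' s)) ->
  is_derive y 1 (fun y => u (y / x)) (u' (y / x) / x).
Proof.
move=> du; have h := is_derive_quot_y x y; have h' := du (y / x).
exact: (@is_derive1_comp R u (fun y => y / x)).
Qed.

Lemma is_derive_surface_x (x y : R) : 0 < x ->
  is_derive x 1 (surface^~ y) (surface_x x y).
Proof.
move=> x0; have x_neq0 : x != 0 by rewrite gt_eqF.
have h := is_derive_quot_x_comp y (is_derive_Psi H) x_neq0.
have -> : surface^~ y = csl *: (id * (fun x => Psi (y / x))) by [].
apply: is_derive_eq; rewrite /GRing.scale /= /surface_x /slope_x; field.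
by rewrite x_neq0.
Qed.

Lemma is_derive_surface_y (x y : R) : 0 < x ->
  is_derive y 1 (surface x) (surface_y x y).
Proof.
move=> x0; have x_neq0 : x != 0 by rewrite gt_eqF.
have h := is_derive_quot_y_comp x y (is_derive_Psi H).
have -> : surface x = (csl * x) *: (fun y => Psi (y / x)).
  by apply/funext => z; rewrite /surface /= /GRing.scale /= mulrA.
apply: is_derive_eq; rewrite /GRing.scale /= /surface_y /slope_y; field.
by rewrite x_neq0.
Qed.

Lemma slope_y_le2 s : `|slope_y s| <= 2.
Proof.
have /andP[h0 h1] := Phi_ge0_le1 H s; have := csl_gt0; have := csl_le => c1 c0.
rewrite ger0_norm ?mulr_ge0// ?(ltW c0)// /slope_y; nra.
Qed.

Lemma slope_x_le2 s : `|slope_x s| <= 2.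
Proof.
have := csl_gt0; have := csl_le => c1 c0.
rewrite /slope_x normrM gtr0_norm//.
have : `|Psi s - s * Phi s| <= 3 / 2.
  apply: (le_trans (ler_normB _ _)).
  have := Psi_bound H s; suff : `|s * Phi s| <= 1 by lra.
  have [s1|/ltW s1] := leP 1 `|s|; first by rewrite (Phi_outside H s1) mulr0 normr0.
  have /andP[h0 h1] := Phi_ge0_le1 H s.
  rewrite normrM (ger0_norm h0); have := normr_ge0 s; nra.
move: `|_| => t; nra.
Qed.

Lemma slope_y'_le6 s : `|slope_y' s| <= 6.
Proof.
have := csl_gt0; have := csl_le => c1 c0.
rewrite /slope_y' normrM gtr0_norm//; have := Phi'_le4 H s; have := normr_ge0 (Phi' s).
move: `|_| => t; nra.
Qed.

Lemma slope_y'_outside s : 1 <= `|s| -> slope_y' s = 0.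
Proof. by move=> s1; rewrite /slope_y' (Phi'_outside H s1) mulr0. Qed.

Lemma slope_y'_mul_le6 s t : (`|s| < 1 -> `|t| <= 1) -> `|t * slope_y' s| <= 6.
Proof.
move=> st; have [s1|s1] := leP 1 `|s|; first by rewrite slope_y'_outside// mulr0 normr0.
rewrite normrM; have := slope_y'_le6 s; have := st s1.
have := normr_ge0 t; have := normr_ge0 (slope_y' s).
move: `|t| `|slope_y' s| => u v; nra.
Qed.

Lemma lip_quot (u u' : R -> R) a : 0 < a -> (forall s : R, is_derive s 1 u (u' s)) ->
  (forall s, `|u' s| <= 6) -> (forall s, `|u' s * s| <= 6) ->
  forall x y x' y', a <= x -> a <= x' ->
  `|u (y / x) - u (y' / x')| <= 6 / a * (`|x - x'| + `|y - y'|).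
Proof.
move=> a0 du b1 b2 x y x' y' ax ax'.
have pos t : a <= t -> 0 < t by exact: lt_le_trans.
have aM : a <= Num.max x x' by rewrite le_max ax.
have [xi /andP[axi _] Ex] : exists2 xi, a <= xi <= Num.max x x' &
    u (y / x) - u (y / x') = u' (y / xi) * (- (y / xi) / xi) * (x - x').
  apply: (@mvt_between R (fun x => u (y / x)) (fun x => u' (y / x) * (- (y / x) / x)) a (Num.max x x')).
  - by move=> t /andP[t_a _]; apply: is_derive_quot_x_comp => //; rewrite gt_eqF// pos.
  - by rewrite ax le_max lexx.
  - by rewrite ax' le_max lexx orbT.
have [eta _ Ey] : exists2 eta, Num.min y y' <= eta <= Num.max y y' &
    u (y / x') - u (y' / x') = u' (eta / x') / x' * (y - y').
  apply: (@mvt_between R (fun y => u (y / x')) (fun y => u' (y / x') / x')).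
  - by move=> t _; exact: is_derive_quot_y_comp.
  - by rewrite ge_min lexx le_max lexx.
  - by rewrite ge_min lexx le_max lexx !orbT.
have -> : u (y / x) - u (y' / x') = (u (y / x) - u (y / x')) + (u (y / x') - u (y' / x')) by ring.
rewrite Ex Ey; apply: (le_trans (ler_normD _ _)); rewrite [leRHS]mulrDr.
have inv t : a <= t -> 0 <= t^-1 <= a^-1.
  by move=> h; rewrite invr_ge0 (ltW (pos _ h)) lef_pV2 ?posrE ?pos.
apply: lerD; rewrite normrM ler_wpM2r// normrM.
  rewrite normrM normrN mulrA -normrM; have /andP[i0 ia] := inv xi axi.
  by rewrite (ger0_norm i0) ler_pM.
have /andP[i0 ia] := inv x' ax'.
by rewrite (ger0_norm i0) ler_pM.
Qed.

Lemma surface_grad_lip a : 0 < a -> exists2 C, 0 <= C &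
  forall x y x' y', a <= x -> a <= x' ->
    `|surface_x x y - surface_x x' y'| <= C * (`|x - x'| + `|y - y'|) /\
    `|surface_y x y - surface_y x' y'| <= C * (`|x - x'| + `|y - y'|).
Proof.
move=> a0; exists (6 / a); first by rewrite divr_ge0// ltW.
move=> x y x' y' ax ax'; split.
  apply: (lip_quot a0 is_derive_slope_x) => // s.
    by apply: slope_y'_mul_le6; rewrite normrN => /ltW.
  rewrite (_ : - s * slope_y' s * s = - (s * s) * slope_y' s); last by ring.
  apply: slope_y'_mul_le6; rewrite normrN normrM => s1.
  by have := normr_ge0 s; nra.
apply: (lip_quot a0 is_derive_slope_y) => // s; first exact: slope_y'_le6.
by rewrite mulrC; apply: slope_y'_mul_le6 => /ltW.
Qed.

Lemma continuous_slope_x : continuous slope_x.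
Proof. exact: is_derive_continuous is_derive_slope_x. Qed.

Lemma continuous_slope_y : continuous slope_y.
Proof. exact: is_derive_continuous is_derive_slope_y. Qed.

Lemma continuous_slope_y' : continuous slope_y'.
Proof. by move=> s; apply: cvgM; [exact: cvg_cst|exact: (continuous_Phi' H)]. Qed.

Lemma slope_outside (s : R) : 1 <= `|s| -> slope_y s = 0 /\ slope_x s = (if 0 < s then csl / 2 else - (csl / 2)).
Proof.
move=> s1; rewrite /slope_y /slope_x (Phi_outside H s1) !mulr0 subr0; split => //.
have [s0|s0] := ltP 0 s.
  by rewrite (Psi_outside H) ?mul1r// -(gtr0_norm s0).
rewrite -[s]opprK (Psi_odd H) (Psi_outside H); first by rewrite mul1r mulrN.
by rewrite -(ler0_norm s0).
Qed.

(** The height function of the construction is the homogeneous surface. *)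
Lemma height_surface (x y : R) : 0 < x -> height Phi x y = surface x y.
Proof.
move=> x0; have x_neq0 : x != 0 by rewrite gt_eqF.
pose K (t : R) := x * Psi (t / x).
have dK (t : R) : is_derive t 1 K (Phi (t / x)).
  have h := is_derive_quot_y_comp x t (is_derive_Psi H).
  have -> : K = x *: (fun t => Psi (t / x)) by [].
  by apply: is_derive_eq; rewrite /GRing.scale /= mulrCA divff ?mulr1.
have cPhi : continuous Phi := is_derive_continuous (is_derive_Phi H).
have cK : continuous (fun t : R => Phi (t / x)).
  move=> t; apply: continuous_comp; last exact: cPhi.
  by apply: cvgM; [exact: cvg_id|exact: cvg_cst].
have KN t : K (- t) = - K t by rewrite /K mulNr (Psi_odd H) mulrN.
rewrite /height /oriented_integral /surface -/(K y).
have -> : csl = (Num.sqrt 3)^-1 * 2 by rewrite /csl mulrC.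
rewrite -[RHS]mulrA; congr (_ * _); case: ifPn => yy.
  rewrite /Rintegral (integral_is_derive yy dK cK) /= KN; ring.
rewrite -ltNge in yy.
rewrite /Rintegral (integral_is_derive (ltW yy) dK cK) /= KN; ring.
Qed.

End Slopes.


Section OrthogonalProjection.
Context {R : realType}.

Lemma proj_onto_unique n (S : set 'rV[R]_n) (P : 'M[R]_n) : orth_projection P ->
  [set v | v *m P = v] = S -> proj_onto S = P.
Proof.
move=> [PT PP] PS; apply: xget_unique; first by split.
move=> P' [[P'T P'P'] P'S].
have fix1 : P *m P' = P.
  apply/row_matrixP => i; rewrite row_mul.
  suff : [set v | v *m P' = v] (row i P) by [].
  by rewrite P'S -PS /= -row_mul PP.
have fix2 : P' *m P = P'.
  apply/row_matrixP => i; rewrite row_mul.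
  suff : [set v | v *m P = v] (row i P') by [].
  by rewrite PS -P'S /= -row_mul P'P'.
have E : P = P' *m P by rewrite -[LHS]PT -[in LHS]fix1 trmx_mul PT P'T.
by rewrite E fix2.
Qed.

Definition isometry_mx n (Q : 'M[R]_n) : Prop := Q *m Q^T = 1%:M.

Lemma isometry_mxV n (Q : 'M[R]_n) : isometry_mx Q -> Q^T *m Q = 1%:M.
Proof. exact: mulmx1C. Qed.

Lemma sqr_enorm_mul n (x : 'rV[R]_n) : (enorm x ^+ 2)%:M = x *m x^T.
Proof.
apply/matrixP => i j; rewrite !ord1 !mxE eqxx mulr1n sqr_enorm.
by apply: eq_bigr => k _; rewrite mxE expr2.
Qed.

Lemma enorm_isometry n (Q : 'M[R]_n) (x : 'rV[R]_n) : isometry_mx Q ->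
  enorm (x *m Q) = enorm x.
Proof.
move=> QQ; apply/eqP; rewrite -(eqrXn2 (_ : 0 < 2)%N) ?enorm_ge0//; apply/eqP.
have := sqr_enorm_mul (x *m Q); rewrite trmx_mul mulmxA -(mulmxA x) QQ mulmx1.
by rewrite -sqr_enorm_mul => /matrixP/(_ 0 0); rewrite !mxE eqxx !mulr1n.
Qed.

(** The orthogonal projection onto the hyperplane normal to [v]. *)
Definition proj_normal n (v : 'rV[R]_n) : 'M[R]_n :=
  1%:M - (enorm v ^+ 2)^-1 *: (v^T *m v).

Lemma proj_normal_isometry n (v : 'rV[R]_n) (Q : 'M[R]_n) : isometry_mx Q ->
  proj_normal (v *m Q) = Q^T *m proj_normal v *m Q.
Proof.
move=> QQ; rewrite /proj_normal enorm_isometry// mulmxBr mulmx1 mulmxBl (isometry_mxV QQ).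
by rewrite trmx_mul -scalemxAr -scalemxAl !mulmxA.
Qed.

Lemma proj_normal_fix n (v w : 'rV[R]_n) : v != 0 ->
  (w *m proj_normal v = w) <-> w *m v^T = 0.
Proof.
move=> v0; have ev : enorm v ^+ 2 != 0.
  by rewrite expf_neq0//; apply: contra_neq v0; exact: enorm_eq0.
rewrite /proj_normal mulmxBr mulmx1 -scalemxAr mulmxA; split.
  move=> /(canRL (subrK _))/esym/eqP; rewrite addrC -subr_eq0 addrK scaler_eq0 invr_eq0.
  rewrite (negbTE ev)/= => /eqP wv; apply/eqP.
  have : w *m v^T *m v *m v^T = 0 by rewrite wv mul0mx.
  rewrite -mulmxA -sqr_enorm_mul mul_mx_scalar => /eqP.
  by rewrite scaler_eq0 (negbTE ev).
by move=> ->; rewrite mul0mx scaler0 subr0.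
Qed.

Lemma orth_projection_normal n (v : 'rV[R]_n) : v != 0 -> orth_projection (proj_normal v).
Proof.
move=> v0; have ev : enorm v ^+ 2 != 0.
  by rewrite expf_neq0//; apply: contra_neq v0; exact: enorm_eq0.
split.
  by rewrite /proj_normal linearB /= trmx1 linearZ /= trmx_mul trmxK.
apply/row_matrixP => i; rewrite row_mul; apply/(proj_normal_fix _ v0).
rewrite -row_mul; apply/rowP => j; rewrite /proj_normal mulmxBl mul1mx -scalemxAl.
rewrite -mulmxA -sqr_enorm_mul mul_mx_scalar scalerA mulVf// scale1r subrr.
by rewrite !mxE.
Qed.

Lemma proj_onto_normal n (v : 'rV[R]_n) : v != 0 ->
  proj_onto [set w | w *m v^T = 0] = proj_normal v.
Proof.
move=> v0; apply: proj_onto_unique; first exact: orth_projection_normal.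
by apply/seteqP; split=> w /=; [move/(proj_normal_fix w v0)|move=> ?; apply/(proj_normal_fix w v0)].
Qed.

Lemma rank_proj_normal (v : 'rV[R]_3) : v != 0 -> \rank (proj_normal v) = 2%N.
Proof.
move=> v0; have ev : enorm v ^+ 2 != 0.
  by rewrite expf_neq0//; apply: contra_neq v0; exact: enorm_eq0.
have rle : (\rank ((enorm v ^+ 2)^-1 *: (v^T *m v)) <= 1)%N.
  rewrite scalemxAl; apply: leq_trans (mxrankM_maxr _ _) _.
  exact: rank_leq_row.
apply/eqP; rewrite eqn_leq; apply/andP; split.
  rewrite -ltnS ltn_neqAle rank_leq_row andbT; apply/negP => full.
  have : v *m proj_normal v = 0.
    rewrite /proj_normal mulmxBr mulmx1 -scalemxAr mulmxA -sqr_enorm_mul.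
    by rewrite mul_scalar_mx scalerA mulVf// scale1r subrr.
  have inj : row_free (proj_normal v) by [].
  by move/(congr1 (mulmx^~ (pinvmx (proj_normal v)))); rewrite mulmxKp// mul0mx; apply/eqP.
have := mxrank_add (proj_normal v) ((enorm v ^+ 2)^-1 *: (v^T *m v)).
rewrite /proj_normal subrK mxrank1 => h.
by have := leq_trans h (leq_add (leqnn _) rle); rewrite addn1.
Qed.

Lemma Grass_proj_normal (v : 'rV[R]_3) : v != 0 -> Grass 2 (proj_normal v).
Proof. by move=> v0; split; [exact: orth_projection_normal|exact: rank_proj_normal]. Qed.

End OrthogonalProjection.


Lemma le_hausdorff (R : realType) n m (A B : set 'rV[R]_n) : A `<=` B ->
  (hausdorff m A <= hausdorff m B)%E.
Proof.
move=> AB.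
have : (image_hausdorff m (@id 'rV[R]_n) A <= image_hausdorff m (@id 'rV[R]_n) B)%E.
  exact: le_outer_measure.
by rewrite /image_hausdorff !image_id.
Qed.

Section TangentCone.
Context {R : realType}.
Variables (g gx gy : R -> R -> R) (G : R) (Q : 'M[R]_3).

Hypothesis dgx : forall x y : R, 0 < x -> is_derive x 1 (g^~ y) (gx x y).
Hypothesis dgy : forall x y : R, 0 < x -> is_derive y 1 (g x) (gy x y).
Hypothesis gx_bound : forall x y, 0 < x -> `|gx x y| <= G.
Hypothesis gy_bound : forall x y, 0 < x -> `|gy x y| <= G.
Hypothesis grad_lip : forall a, 0 < a -> exists2 C, 0 <= C &
  forall x y x' y', a <= x -> a <= x' ->
    `|gx x y - gx x' y'| <= C * (`|x - x'| + `|y - y'|) /\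
    `|gy x y - gy x' y'| <= C * (`|x - x'| + `|y - y'|).
Hypothesis measurable_gx : measurable_fun setT (fun p : coord_plane R => gx p.1 p.2 : line R).
Hypothesis measurable_gy : measurable_fun setT (fun p : coord_plane R => gy p.1 p.2 : line R).
Hypothesis QQ : isometry_mx Q.

Definition graph_map (p : coord_plane R) : 'rV[R]_3 := vec3 p.1 p.2 (g p.1 p.2) *m Q.

Let f := graph_map.

Let Sigma := f @` (@open_half_plane R).

Lemma graph_mapB p q : f p - f q =
  vec3 ((p.1 : R) - q.1) ((p.2 : R) - q.2) (g p.1 p.2 - g q.1 q.2) *m Q.
Proof. by rewrite /f /graph_map -mulmxBl vec3B. Qed.

Lemma graph_map_graph p q : enorm (f p - f q) ^+ 2 =
  ((p.1 : R) - q.1) ^+ 2 + ((p.2 : R) - q.2) ^+ 2 + (g p.1 p.2 - g q.1 q.2) ^+ 2.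
Proof. by rewrite graph_mapB enorm_isometry// sqr_enorm sum3 !vec3E. Qed.

Definition tangent_vec (p : coord_plane R) (a b : R) : 'rV[R]_3 :=
  vec3 a b (gx p.1 p.2 * a + gy p.1 p.2 * b) *m Q.

Let G0 : 0 <= G.
Proof. by have := gx_bound 0 ltr01; apply: le_trans. Qed.

Lemma enorm_vec3_le (a b c : R) : enorm (vec3 a b c) <= `|a| + `|b| + `|c|.
Proof.
have : 0 <= `|a| + `|b| + `|c| by rewrite !addr_ge0.
move=> h; rewrite enorm_le_sqr// sqr_enorm sum3 !vec3E -(sqr_norm a) -(sqr_norm b) -(sqr_norm c).
have := normr_ge0 a; have := normr_ge0 b; have := normr_ge0 c.
by move: `|a| `|b| `|c| => x y z *; nra.
Qed.

(** Uniform differentiability of the graph at a point. *)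
Lemma graph_map_diff (p0 : coord_plane R) : 0 < (p0.1 : R) -> exists C r0, [/\ 0 <= C, 0 < r0 &
  forall (p : coord_plane R) r, r <= r0 -> `|(p.1 : R) - p0.1| <= r -> `|(p.2 : R) - p0.2| <= r ->
    0 < (p.1 : R) /\
    `|g p.1 p.2 - g p0.1 p0.2 - (gx p0.1 p0.2 * ((p.1 : R) - p0.1) + gy p0.1 p0.2 * ((p.2 : R) - p0.2))|
      <= C * r * (`|(p.1 : R) - p0.1| + `|(p.2 : R) - p0.2|)].
Proof.
move=> p00; have a0 : 0 < (p0.1 : R) / 2 by rewrite divr_gt0.
have [C C0 lip] := grad_lip a0; exists (2 * C), ((p0.1 : R) / 2).
split=> //; first by rewrite mulr_ge0.
move=> p r rr0 p1 p2; have r_ge0 : 0 <= r by exact: le_trans p1.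
have pa : (p0.1 : R) / 2 <= p.1.
  by move: p1; rewrite ler_norml => /andP[? ?]; lra.
split; first exact: lt_le_trans pa.
apply: (graph_taylor dgx dgy a0 C0 lip) => //; rewrite ?subrr ?normr0//; lra.
Qed.

Lemma tangent_cone_graph_sub p0 : 0 < (p0.1 : R) ->
  tangent_cone Sigma (f p0) `<=` [set v | exists a b, v = tangent_vec p0 a b].
Proof.
move=> p00 v tv; have [C [r0 [C0 r00 diff]]] := graph_map_diff p00.
have [w vw] : exists w, v = w *m Q.
  by exists (v *m Q^T); rewrite -mulmxA (isometry_mxV QQ) mulmx1.
exists (w 0 0), (w 0 1); rewrite vw; congr (_ *m Q).
apply: rv3P; rewrite ?vec3E//; apply/eqP; rewrite -subr_eq0; apply/eqP.
set A := gx p0.1 p0.2; set B := gy p0.1 p0.2.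
have ineq (e : R) : 0 < e -> e <= r0 -> e <= 1 ->
    `|w 0 2 - (A * w 0 0 + B * w 0 1)| <= e * (1 + 2 * G + C * (`|w 0 0| + `|w 0 1| + 2)).
  move=> e0 er0 e1; have [x [r [[p p0' <-] r0' xe rv]]] := tv e e0.
  have {}rv : enorm (r *: vec3 ((p.1 : R) - p0.1) ((p.2 : R) - p0.2) (g p.1 p.2 - g p0.1 p0.2) - w) < e.
    by move: rv; rewrite graph_mapB {1}vw scalemxAl -mulmxBl enorm_isometry.
  have {}xe : enorm (vec3 ((p.1 : R) - p0.1) ((p.2 : R) - p0.2) (g p.1 p.2 - g p0.1 p0.2)) < e.
    by move: xe; rewrite graph_mapB enorm_isometry.
  set dx := (p.1 : R) - p0.1 in rv xe *; set dy := (p.2 : R) - p0.2 in rv xe *.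
  set dg := g p.1 p.2 - _ in rv xe *.
  have c0 := le_lt_trans (enorm_coord _ 0) rv; have c1 := le_lt_trans (enorm_coord _ 1) rv.
  have c2 := le_lt_trans (enorm_coord _ 2) rv.
  move: c0 c1 c2; rewrite vec3Z !mxE /= => c0 c1 c2.
  have x0 := le_lt_trans (enorm_coord _ 0) xe; have x1 := le_lt_trans (enorm_coord _ 1) xe.
  move: x0 x1; rewrite !vec3E => x0 x1.
  have [_ T] := diff p e er0 (ltW x0) (ltW x1).
  have rT : `|r * dg - (A * (r * dx) + B * (r * dy))| <= C * e * (`|w 0 0| + `|w 0 1| + 2).
    have -> : r * dg - (A * (r * dx) + B * (r * dy)) = r * (dg - (A * dx + B * dy)) by ring.
    rewrite normrM (gtr0_norm r0').
    apply: (@le_trans _ _ (r * (C * e * (`|dx| + `|dy|)))).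
      by rewrite ler_pM2l//; exact: T.
    rewrite mulrCA; apply: ler_wpM2l; first by rewrite mulr_ge0// ltW.
    have n0 : `|r * dx| <= `|w 0 0| + 1.
      have -> : r * dx = w 0 0 + (r * dx - w 0 0) by ring.
      by apply: (le_trans (ler_normD _ _)); rewrite lerD2l (le_trans (ltW c0)).
    have n1 : `|r * dy| <= `|w 0 1| + 1.
      have -> : r * dy = w 0 1 + (r * dy - w 0 1) by ring.
      by apply: (le_trans (ler_normD _ _)); rewrite lerD2l (le_trans (ltW c1)).
    rewrite !normrM (gtr0_norm r0') in n0 n1; lra.
  have -> : w 0 2 - (A * w 0 0 + B * w 0 1) = - (r * dg - w 0 2) + A * (r * dx - w 0 0) +
     B * (r * dy - w 0 1) + (r * dg - (A * (r * dx) + B * (r * dy))) by ring.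
  apply: (le_trans (ler_normD _ _)).
  have hA : `|A * (r * dx - w 0 0)| <= G * e.
    by rewrite normrM ler_pM//; [exact: gx_bound|exact: ltW].
  have hB : `|B * (r * dy - w 0 1)| <= G * e.
    by rewrite normrM ler_pM//; [exact: gy_bound|exact: ltW].
  have h1 := ler_normD (- (r * dg - w 0 2) + A * (r * dx - w 0 0)) (B * (r * dy - w 0 1)).
  have h2 := ler_normD (- (r * dg - w 0 2)) (A * (r * dx - w 0 0)).
  rewrite normrN in h2.
  lra.
apply/eqP; rewrite -normr_le0; apply/ler_addgt0Pr => e e0; rewrite add0r.
set K := 1 + 2 * G + C * (`|w 0 0| + `|w 0 1| + 2).
have K1 : 1 <= K.
  rewrite /K -addrA lerDl addr_ge0// mulr_ge0// !addr_ge0//.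
pose d := Num.min (e / K) (Num.min r0 1).
have d0 : 0 < d by rewrite !lt_min r00 ltr01 !andbT divr_gt0// (lt_le_trans _ K1).
apply: (le_trans (ineq d d0 _ _)).
- by rewrite !ge_min lexx !orbT.
- by rewrite !ge_min lexx !orbT.
by rewrite -ler_pdivlMr ?(lt_le_trans _ K1)// ge_min lexx.
Qed.

(** If a set omitted the image of the squares [p0 + t (a, b) + t [- eta, eta]^2],
    its complement would not have density zero. *)
Lemma tangent_cone_graph_sup p0 S a b : 0 < (p0.1 : R) ->
  density_zero 2 (restriction (restriction (hausdorff 2) Sigma) (~` S)) (f p0) ->
  tangent_cone S (f p0) (tangent_vec p0 a b).
Proof.
move=> p00 dens e e0; apply: contrapT => no.
have [C [r0 [C0 r00 diff]]] := graph_map_diff p00.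
pose N := `|a| + `|b| + 1.
have N1 : 1 <= N by rewrite /N lerDr addr_ge0.
pose eta := Num.min 1 (e / (8 * (1 + G))).
have G1 : 0 < 1 + G by rewrite ltr_pwDl.
have eta0 : 0 < eta by rewrite lt_min ltr01 divr_gt0// mulr_gt0.
have eta1 : eta <= 1 by rewrite ge_min lexx.
have etaG : (1 + G) * (8 * eta) <= e.
  have : eta <= e / (8 * (1 + G)) by rewrite ge_min lexx orbT.
  by rewrite ler_pdivlMr ?mulr_gt0//; lra.
pose t0 := Num.min (r0 / N) (Num.min (e / (8 * C * N ^+ 2 + 1)) (e / (4 * (1 + G) * N))).
have CN : 0 < 8 * C * N ^+ 2 + 1 by rewrite ltr_wpDl// mulr_ge0 ?sqr_ge0// mulr_ge0.
have N0 : 0 < N by lra.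
have t00 : 0 < t0 by rewrite !lt_min !divr_gt0// !mulr_gt0.
pose Bt t : set (coord_plane R) := [set` `[(p0.1 : R) + t * a - eta * t, (p0.1 : R) + t * a + eta * t]] `*`
  [set` `[(p0.2 : R) + t * b - eta * t, (p0.2 : R) + t * b + eta * t]].
pose K := 4 * (1 + G) * N.
have K0 : 0 < K by rewrite !mulr_gt0.
have close t p : 0 < t -> t < t0 -> Bt t p ->
    [/\ 0 < (p.1 : R), enorm (f p - f p0) < e, enorm (f p - f p0) <= K * t &
        enorm (t^-1 *: (f p - f p0) - tangent_vec p0 a b) < e].
  move=> tt0 tlt [/= ]; rewrite !in_itv/= => /andP[x1 x2] /andP[y1 y2].
  move: tlt; rewrite !lt_min => /andP[tr /andP[te te2]].
  rewrite ltr_pdivlMr// in tr; rewrite ltr_pdivlMr// in te; rewrite ltr_pdivlMr// in te2.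
  set dx := (p.1 : R) - p0.1; set dy := (p.2 : R) - p0.2.
  have hx : `|dx - t * a| <= eta * t by rewrite /dx ler_norml; apply/andP; split; lra.
  have hy : `|dy - t * b| <= eta * t by rewrite /dy ler_norml; apply/andP; split; lra.
  have etat : eta * t <= t by rewrite ger_pMl.
  have dxN : `|dx| <= t * N.
    have -> : dx = t * a + (dx - t * a) by ring.
    apply: (le_trans (ler_normD _ _)); rewrite normrM (gtr0_norm tt0) /N.
    have := mulr_ge0 (ltW tt0) (normr_ge0 b); lra.
  have dyN : `|dy| <= t * N.
    have -> : dy = t * b + (dy - t * b) by ring.
    apply: (le_trans (ler_normD _ _)); rewrite normrM (gtr0_norm tt0) /N.
    have := mulr_ge0 (ltW tt0) (normr_ge0 a); lra.
  have [p_gt0 T] := diff p (t * N) (ltW tr) dxN dyN.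
  have lipK : enorm (f p - f p0) <= K * t.
    apply: (le_trans (graph_lip graph_map_graph dgx dgy gx_bound gy_bound p_gt0 p00)).
    rewrite -/dx -/dy; apply: (@le_trans _ _ ((1 + G) * (2 * (t * N)))).
      by rewrite ler_pM2l//; lra.
    have := mulr_ge0 (ltW G1) (mulr_ge0 (ltW tt0) (ltW N0)); rewrite /K; lra.
  split=> //; first by apply: (le_lt_trans lipK); rewrite mulrC.
  rewrite graph_mapB -/dx -/dy /tangent_vec scalemxAl -mulmxBl enorm_isometry// vec3Z vec3B.
  apply: (le_lt_trans (enorm_vec3_le _ _ _)).
  set A := gx p0.1 p0.2; set B := gy p0.1 p0.2; set dg := g p.1 p.2 - _.
  have div_le (z z' : R) : `|z - t * z'| <= eta * t -> `|t^-1 * z - z'| <= eta.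
    have -> : t^-1 * z - z' = (z - t * z') / t by field; rewrite gt_eqF.
    by rewrite normrM normfV (gtr0_norm tt0) ler_pdivrMr.
  have k0 := div_le _ _ hx; have k1 := div_le _ _ hy.
  have k2 : `|t^-1 * dg - (A * a + B * b)| <= 2 * C * t * N ^+ 2 + 2 * G * eta.
    have -> : t^-1 * dg - (A * a + B * b) = (dg - (A * dx + B * dy)) / t +
       (A * (t^-1 * dx - a) + B * (t^-1 * dy - b)) by field; rewrite gt_eqF.
    apply: (le_trans (ler_normD _ _)); apply: lerD.
      rewrite normrM normfV (gtr0_norm tt0) ler_pdivrMr//.
      apply: (le_trans T); rewrite -/dx -/dy.
      have : C * (t * N) * (`|dx| + `|dy|) <= C * (t * N) * (2 * (t * N)).
        by rewrite ler_wpM2l ?mulr_ge0 ?(ltW N0) ?(ltW tt0)//; lra.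
      rewrite expr2; lra.
    apply: (le_trans (ler_normD _ _)); rewrite !normrM.
    have := ler_pM (normr_ge0 A) (normr_ge0 _) (gx_bound p0.2 p00) k0.
    have := ler_pM (normr_ge0 B) (normr_ge0 _) (gy_bound p0.2 p00) k1.
    rewrite -/A -/B; lra.
  have := mulr_ge0 (ltW G1) (ltW eta0); lra.
have mBt t : measurable (Bt t) by apply: measurableX; exact: measurable_itv.
have aBt t : 0 < t -> area (Bt t) = ((2 * eta * t) ^+ 2)%:E.
  move=> tt0; rewrite /Bt areaX; [|exact: measurable_itv|exact: measurable_itv].
  have len (x : R) : leb [set` `[x - eta * t, x + eta * t]] = (2 * eta * t)%:E.
    apply: (etrans (lebesgue_measure_itv _)) => /=; rewrite lte_fin.
    have et0 : 0 < eta * t by rewrite mulr_gt0.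
    rewrite ifT; last by lra.
    by rewrite -EFinB; congr EFin; ring.
  by rewrite !len -EFinM expr2.
pose kap := (2 * eta) ^+ 2 / (pi * K ^+ 2).
have kap0 : 0 < kap by rewrite divr_gt0 ?exprn_gt0 ?mulr_gt0 ?pi_gt0 ?exprn_gt0.
have lower t : 0 < t -> t < t0 -> (kap%:E <= ((alpha R 2 * (K * t) ^+ 2)^-1)%:E *
    restriction (restriction (hausdorff 2) Sigma) (~` S) [set x | (enorm (x - f p0) <= K * t)%R])%E.
  move=> tt0 tlt; apply: (@le_trans _ _ (((alpha R 2 * (K * t) ^+ 2)^-1)%:E * area (Bt t))%E).
    rewrite aBt// -EFinM lee_fin /kap /= mulr1 (_ : 2 * pi / 2 = pi); last by field.
    have pi_neq0 : pi != 0 :> R by rewrite gt_eqF// pi_gt0.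
    have K_neq0 : K != 0 by rewrite gt_eqF.
    have t_neq0 : t != 0 by rewrite gt_eqF.
    rewrite le_eqVlt; apply/orP; left; apply/eqP.
    move: (pi : R) pi_neq0 => P P_neq0; field.
    by rewrite P_neq0 K_neq0 t_neq0.
  apply: lee_wpmul2l; first by rewrite lee_fin invr_ge0; apply: mulr_ge0; [exact: alpha_ge0|exact: sqr_ge0].
  have Bt0 : Bt t `<=` @open_half_plane R by move=> p /(close _ _ tt0 tlt)[].
  apply: (@le_trans _ _ (graph_measure measurable_gx measurable_gy (Bt t))).
    rewrite -[leLHS]mul1e; apply: graph_measure_ge => // p /Bt0; exact: jac_fun_ge1.
  rewrite -(image_hausdorff_graph graph_map_graph dgx dgy gx_bound gy_bound grad_lip)//.
  rewrite /restriction /image_hausdorff; apply: le_hausdorff.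
  move=> _ [p Bp <-]; have [pp0 pe pK pv] := close _ _ tt0 tlt Bp.
  split; last by exists p.
  split => // Sfp; apply: no; exists (f p), t^-1; split => //.
  by rewrite invr_gt0.
have nbkap : nbhs (0%E : \bar R) [set y | (y < kap%:E)%E].
  by apply: open_ereal_lt'; rewrite lte_fin.
near (0 : R)^'+ => r.
have r_gt0 : 0 < r by near: r; exact: nbhs_right_gt.
have r_lt : r < K * t0 by near: r; apply: nbhs_right_lt; rewrite mulr_gt0.
have : (((alpha R 2 * r ^+ 2)^-1)%:E *
    restriction (restriction (hausdorff 2) Sigma) (~` S) [set x | (enorm (x - f p0) <= r)%R] < kap%:E)%E.
  by near: r; exact: dens _ nbkap.
have rK0 : 0 < r / K by rewrite divr_gt0.
have := lower (r / K) rK0; rewrite ltr_pdivrMr// mulrC => /(_ r_lt).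
rewrite (mulrC K) divfK ?gt_eqF// => h1 h2.
by have := le_lt_trans h1 h2; rewrite ltxx.
Unshelve. all: by end_near. Qed.

Theorem approx_tangent_cone_graph p0 : 0 < (p0.1 : R) ->
  approx_tangent_cone 2 (restriction (hausdorff 2) Sigma) (f p0) =
  [set v | exists a b, v = tangent_vec p0 a b].
Proof.
move=> p00; apply/seteqP; split=> v.
  move=> tv; apply: (tangent_cone_graph_sub p00); apply: tv => /=.
  rewrite /density_zero [X in X @ _ --> _](_ : _ = cst 0%E); last first.
    apply/funext => r; rewrite /restriction -setIA setICl setI0.
    rewrite (_ : hausdorff 2 set0 = 0%E) ?mule0//.
    by have := @image_hausdorff0 R 3 2 _ id; rewrite /image_hausdorff image_set0.
  exact: cvg_cst.
by move=> [a [b ->]] S dens; exact: tangent_cone_graph_sup.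
Qed.

Lemma tangent_setE p0 :
  [set v | exists a b, v = tangent_vec p0 a b] =
  [set v | v *m (vec3 (- gx p0.1 p0.2) (- gy p0.1 p0.2) 1 *m Q)^T = 0].
Proof.
apply/seteqP; split=> v /=.
  move=> [a [b ->]]; rewrite /tangent_vec trmx_mul mulmxA -(mulmxA _ Q) QQ mulmx1.
  by apply/rowP => i; rewrite !mxE sum3 !mxE /=; ring.
rewrite trmx_mul mulmxA => /rowP/(_ 0); rewrite mxE [RHS]mxE sum3 ![_^T _ _]mxE !vec3E => h.
exists ((v *m Q^T) 0 0), ((v *m Q^T) 0 1).
have {1}-> : v = v *m Q^T *m Q by rewrite -mulmxA (isometry_mxV QQ) mulmx1.
rewrite /tangent_vec; congr (_ *m Q); apply: rv3P; rewrite !vec3E//; lra.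
Qed.

Lemma proj_approx_tangent_cone_graph p0 : 0 < (p0.1 : R) ->
  proj_onto (approx_tangent_cone 2 (restriction (hausdorff 2) Sigma) (f p0)) =
  proj_normal (vec3 (- gx p0.1 p0.2) (- gy p0.1 p0.2) 1 *m Q).
Proof.
move=> p00; rewrite approx_tangent_cone_graph// tangent_setE proj_onto_normal//.
apply/eqP => /(congr1 (mulmx^~ Q^T)); rewrite mul0mx -mulmxA QQ mulmx1.
by move=> /rowP/(_ 2); rewrite vec3E mxE => /eqP; rewrite oner_eq0.
Qed.

End TangentCone.


Section Frame.
Context {R : realType} (Phi Phi' Psi : R -> R) (H : profile Phi Phi' Psi).
Variable Q : 'M[R]_3.

Definition slope (l : bool) : R -> R := if l then slope_y Phi else slope_x Phi Psi.

Arguments slope : simpl never.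

(** [homog l s / x] is the derivative of [s = y / x] in the direction [l]. *)
Definition homog (l : bool) (s : R) : R := if l then 1 else - s.

Definition axis (l : bool) : 'I_3 := if l then 1 else 0.

Let k' := slope_y' Phi'.

Lemma is_derive_slope l (s : R) : is_derive s 1 (slope l) (homog l s * k' s).
Proof.
case: l; last exact: is_derive_slope_x H s.
by rewrite mul1r; exact: is_derive_slope_y H s.
Qed.

Definition normal_sq (s : R) : R := 1 + slope false s ^+ 2 + slope true s ^+ 2.
Definition area_el (s : R) : R := jac (slope false s) (slope true s).
Definition normal (a : 'I_3) (s : R) : R :=
  Q 2 a - slope false s * Q 0 a - slope true s * Q 1 a.
Definition tilt (a : 'I_3) (s : R) : R := Q 1 a - s * Q 0 a.
Definition cross (s : R) : R := s * slope false s - slope true s.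

Lemma sqr_area_el s : area_el s ^+ 2 = normal_sq s.
Proof. exact: sqr_jac. Qed.

Lemma area_el_gt0 s : 0 < area_el s.
Proof. exact: jac_gt0. Qed.

Lemma area_el_neq0 s : area_el s != 0.
Proof. by rewrite gt_eqF// area_el_gt0. Qed.

Lemma is_derive_normal a (s : R) : is_derive s 1 (normal a) (- (k' s * tilt a s)).
Proof.
have h0 := is_derive_slope false s; have h1 := is_derive_slope true s.
have -> : normal a = cst (Q 2 a) - Q 0 a *: slope false - Q 1 a *: slope true.
  apply/funext => t; rewrite /normal !fctE /GRing.scale /=; ring.
apply: is_derive_eq; rewrite /GRing.scale /= /tilt /homog; move: (k' s) => K; ring.
Qed.

Lemma is_derive_normal_sq (s : R) : is_derive s 1 normal_sq (- 2 * k' s * cross s).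
Proof.
have h0 := is_derive_slope false s; have h1 := is_derive_slope true s.
have hD := is_deriveD (is_deriveD (is_derive_cst (1 : R) s 1) (is_deriveM h0 h0)) (is_deriveM h1 h1).
apply: (is_derive_eq hD).
rewrite /GRing.scale /= /cross /homog; move: (slope true s) (slope false s) (k' s) => k h K; ring.
Qed.

Lemma is_derive_area_el (s : R) : is_derive s 1 area_el (- (k' s * cross s) / area_el s).
Proof.
have h := is_derive_normal_sq s.
have J0 : 0 < normal_sq s by rewrite -sqr_area_el exprn_gt0// area_el_gt0.
have h' := is_derive1_sqrt J0.
have -> : area_el = Num.sqrt \o normal_sq by [].
apply: is_derive_eq; rewrite /= -/(area_el s); field; exact: area_el_neq0.
Qed.

Definition tangent (l : bool) (j : 'I_3) (s : R) : R := Q (axis l) j + slope l s * Q 2 j.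

(** The entries of the orthogonal projection onto the tangent plane. *)
Definition tproj (i j : 'I_3) (s : R) : R :=
  (i == j)%:R - normal i s * normal j s / area_el s ^+ 2.

Definition tproj' (i j : 'I_3) (s : R) : R :=
  k' s * (tilt i s * normal j s + normal i s * tilt j s) / area_el s ^+ 2
  - 2 * k' s * cross s * normal i s * normal j s / area_el s ^+ 4.

Lemma is_derive_tproj i j (s : R) : is_derive s 1 (tproj i j) (tproj' i j s).
Proof.
have h0 := is_derive_normal i s; have h1 := is_derive_normal j s.
have h := is_derive_area_el s; have J0 := area_el_neq0 s.
have hV : is_derive s 1 (fun t => (area_el t)^-1)
    (- area_el s ^- 2 *: (- (k' s * cross s) / area_el s)) by apply: is_deriveV.
have -> : tproj i j = cst (i == j)%:R -
    normal i * normal j * ((fun t => (area_el t)^-1) * (fun t => (area_el t)^-1)).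
  by apply/funext => t; rewrite /tproj !fctE expr2 invfM.
apply: is_derive_eq; rewrite /tproj' !fctE /GRing.scale /=; field; exact: J0.
Qed.

(** The tangential part of [area_el * e_l], where [e_l] is a coordinate vector
    of the parameter domain. *)
Definition weight (l : bool) (a : 'I_3) (s : R) : R :=
  area_el s * Q (axis l) a + slope l s * normal a s / area_el s.

Definition weight' (l : bool) (a : 'I_3) (s : R) : R :=
  - (k' s * cross s) / area_el s * Q (axis l) a
  + k' s * (homog l s * normal a s - slope l s * tilt a s) / area_el s
  + slope l s * normal a s * (k' s * cross s) / area_el s ^+ 3.

Lemma is_derive_weight l a (s : R) : is_derive s 1 (weight l a) (weight' l a s).
Proof.
have h0 := is_derive_normal a s; have h1 := is_derive_slope l s.
have h := is_derive_area_el s; have J0 := area_el_neq0 s.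
have hV : is_derive s 1 (fun t => (area_el t)^-1)
    (- area_el s ^- 2 *: (- (k' s * cross s) / area_el s)) by apply: is_deriveV.
have -> : weight l a = Q (axis l) a *: area_el +
    slope l * normal a * (fun t => (area_el t)^-1).
  by apply/funext => t; rewrite /weight !fctE mulrC.
have hD := is_deriveD (is_deriveZ (Q (axis l) a) h) (is_deriveM (is_deriveM h1 h0) hV).
apply: (is_derive_eq hD); rewrite /weight' !fctE /GRing.scale /=; field; exact: J0.
Qed.

Definition tilt_tan (a : 'I_3) (s : R) : R := tilt a s - cross s * normal a s / area_el s ^+ 2.

Hypothesis QQ : isometry_mx Q.

Lemma isometry_row i j : Q i 0 * Q j 0 + Q i 1 * Q j 1 + Q i 2 * Q j 2 = (i == j)%:R.
Proof. by move/matrixP/(_ i j): QQ; rewrite !mxE sum3 !mxE. Qed.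

Lemma isometry_col i j : Q 0 i * Q 0 j + Q 1 i * Q 1 j + Q 2 i * Q 2 j = (i == j)%:R.
Proof. by move/matrixP/(_ i j): (isometry_mxV QQ); rewrite !mxE sum3 !mxE. Qed.

Lemma weight_tangent j a s :
  weight false a s * tangent false j s + weight true a s * tangent true j s =
  area_el s * tproj a j s.
Proof.
have J0 := area_el_neq0 s; have := sqr_area_el s; rewrite /normal_sq.
move: J0; rewrite /weight /tangent /tproj -isometry_col /axis /normal.
move: (area_el s) (slope false s) (slope true s) => J h k J0 J2.
set N := Q 2 a - h * Q 0 a - k * Q 1 a.
apply: (@etrans _ _ (J * (Q 0 a * Q 0 j + Q 1 a * Q 1 j + Q 2 a * Q 2 j -
   N * (Q 2 j - h * Q 0 j - k * Q 1 j) / J ^+ 2) +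
   N * Q 2 j / J * (1 + h ^+ 2 + k ^+ 2 - J ^+ 2))).
  by rewrite /N; field.
by rewrite J2 subrr mulr0 addr0.
Qed.

Lemma weight_homog a s :
  weight false a s * homog false s + weight true a s * homog true s =
  area_el s * tilt_tan a s.
Proof.
have J0 := area_el_neq0 s; rewrite /weight /homog /tilt_tan /tilt /cross /axis; field; exact: J0.
Qed.

Lemma dot_normal s : normal 0 s ^+ 2 + normal 1 s ^+ 2 + normal 2 s ^+ 2 = area_el s ^+ 2.
Proof.
rewrite sqr_area_el /normal_sq /normal; move: (slope false s) (slope true s) => h k.
have r00 := isometry_row 0 0; have r11 := isometry_row 1 1; have r22 := isometry_row 2 2.
have r01 := isometry_row 0 1; have r02 := isometry_row 0 2; have r12 := isometry_row 1 2.
rewrite /= in r00 r11 r22 r01 r02 r12.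
apply: (@etrans _ _ (Q 2 0 * Q 2 0 + Q 2 1 * Q 2 1 + Q 2 2 * Q 2 2 +
  h ^+ 2 * (Q 0 0 * Q 0 0 + Q 0 1 * Q 0 1 + Q 0 2 * Q 0 2) +
  k ^+ 2 * (Q 1 0 * Q 1 0 + Q 1 1 * Q 1 1 + Q 1 2 * Q 1 2) +
  - 2 * h * (Q 0 0 * Q 2 0 + Q 0 1 * Q 2 1 + Q 0 2 * Q 2 2) +
  - 2 * k * (Q 1 0 * Q 2 0 + Q 1 1 * Q 2 1 + Q 1 2 * Q 2 2) +
  2 * h * k * (Q 0 0 * Q 1 0 + Q 0 1 * Q 1 1 + Q 0 2 * Q 1 2))); first by ring.
by rewrite r00 r11 r22 r01 r02 r12 /=; ring.
Qed.

Lemma dot_tilt_normal s :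
  tilt 0 s * normal 0 s + tilt 1 s * normal 1 s + tilt 2 s * normal 2 s = cross s.
Proof.
rewrite /tilt /normal /cross; move: (slope false s) (slope true s) => h k.
have r00 := isometry_row 0 0; have r11 := isometry_row 1 1.
have r01 := isometry_row 0 1; have r02 := isometry_row 0 2; have r12 := isometry_row 1 2.
rewrite /= in r00 r11 r01 r02 r12.
apply: (@etrans _ _ (s * h * (Q 0 0 * Q 0 0 + Q 0 1 * Q 0 1 + Q 0 2 * Q 0 2) -
  k * (Q 1 0 * Q 1 0 + Q 1 1 * Q 1 1 + Q 1 2 * Q 1 2) +
  (s * k - h) * (Q 0 0 * Q 1 0 + Q 0 1 * Q 1 1 + Q 0 2 * Q 1 2) -
  s * (Q 0 0 * Q 2 0 + Q 0 1 * Q 2 1 + Q 0 2 * Q 2 2) +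
  (Q 1 0 * Q 2 0 + Q 1 1 * Q 2 1 + Q 1 2 * Q 2 2))); first by ring.
by rewrite r00 r11 r01 r02 r12 /=; ring.
Qed.

Lemma dot_tilt s : tilt 0 s ^+ 2 + tilt 1 s ^+ 2 + tilt 2 s ^+ 2 = 1 + s ^+ 2.
Proof.
rewrite /tilt.
have r00 := isometry_row 0 0; have r11 := isometry_row 1 1; have r01 := isometry_row 0 1.
rewrite /= in r00 r11 r01.
apply: (@etrans _ _ (s ^+ 2 * (Q 0 0 * Q 0 0 + Q 0 1 * Q 0 1 + Q 0 2 * Q 0 2) +
  (Q 1 0 * Q 1 0 + Q 1 1 * Q 1 1 + Q 1 2 * Q 1 2) -
  2 * s * (Q 0 0 * Q 1 0 + Q 0 1 * Q 1 1 + Q 0 2 * Q 1 2))); first by ring.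
by rewrite r00 r11 r01 /=; ring.
Qed.

(** The contraction of the derivative of the tangent projection is the
    divergence of the weights, that is, the mean curvature. *)
Lemma weight'_homog a s :
  weight' false a s * homog false s + weight' true a s * homog true s =
  area_el s * \sum_j tilt_tan j s * tproj' a j s.
Proof.
have J0 := area_el_neq0 s; rewrite sum3 /tilt_tan /tproj'.
have d1 := dot_normal s; have d2 := dot_tilt_normal s; have d3 := dot_tilt s.
set c := cross s in d2 *; set J := area_el s in J0 d1 *.
set K := k' s; set N := normal in d1 d2 *; set V := tilt in d2 d3 *.
apply: (@etrans _ _ (K * N a s * ((1 + s ^+ 2) - c ^+ 2 / J ^+ 2) / J)).
  rewrite /weight' /homog -/J -/K -/N /tilt /axis /c /cross.
  by move: (slope false s) (slope true s) (N a s) => h k n; field; exact: J0.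
rewrite -{}d3.
apply/esym; apply: (@etrans _ _ (J * (K * N a s / J ^+ 2 *
   ((V 0 s ^+ 2 + V 1 s ^+ 2 + V 2 s ^+ 2) - c / J ^+ 2 * (V 0 s * N 0 s + V 1 s * N 1 s + V 2 s * N 2 s)) +
   (K * V a s / J ^+ 2 - 2 * K * c * N a s / J ^+ 4) *
   ((V 0 s * N 0 s + V 1 s * N 1 s + V 2 s * N 2 s) - c / J ^+ 2 * (N 0 s ^+ 2 + N 1 s ^+ 2 + N 2 s ^+ 2))))).
  by field.
by rewrite d1 d2; field.
Qed.

End Frame.


Lemma cvg_mx_entries (R : realType) (T : Type) (F : set_system T) {FF : Filter F} m n
    (M : T -> 'M[R]_(m, n)) (A : 'M[R]_(m, n)) :
  (forall i j, (fun t => M t i j) @ F --> A i j) -> M @ F --> A.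
Proof.
move=> cM; rewrite (matrix_sum_delta A).
rewrite (_ : M = fun t => \sum_i \sum_j M t i j *: delta_mx i j); last first.
  by apply/funext => t; exact: matrix_sum_delta.
have ca : continuous (fun x : 'M[R]_(m, n) * 'M[R]_(m, n) => +%R x.1 x.2).
  by move=> x; apply: cvgD; [exact: cvg_fst|exact: cvg_snd].
apply: (@cvg_big 'M[R]_(m, n) 'I_m +%R 0 xpredT ca T F _
  (fun i t => \sum_j M t i j *: delta_mx i j) (fun i => \sum_j A i j *: delta_mx i j)) => i _.
apply: (@cvg_big 'M[R]_(m, n) 'I_n +%R 0 xpredT ca T F _
  (fun j t => M t i j *: delta_mx i j) (fun j => A i j *: delta_mx i j)) => j _.
by apply: cvgZr_tmp; exact: cM.
Qed.

Lemma measurable_borel_continuous (R : realType) (T : normedModType R) (f : T -> R) :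
  continuous f -> measurable_fun setT (f : borel T -> line R).
Proof.
move=> /continuousP cf; apply: (measurability _ (RGenOpens.measurableE R)).
move=> _ [_ [a [b ->] <-]]; rewrite setTI; apply: sub_sigma_algebra.
by apply: cf; exact: interval_open.
Qed.

Section ChainRule.
Context {R : realType} {n : nat}.
Implicit Types phi : 'rV[R]_n * 'M[R]_n -> R.

Lemma is_derive_test_curve phi (u : R -> 'rV[R]_n) (M : R -> 'M[R]_n)
    (u' : 'I_n -> R) (M' : 'I_n -> 'I_n -> R) (t : R) :
  differentiable phi (u t, M t) ->
  (forall j, is_derive t 1 (fun t => u t 0 j) (u' j)) ->
  (forall j k, is_derive t 1 (fun t => M t j k) (M' j k)) ->
  is_derive t 1 (fun t => phi (u t, M t))
    (\sum_j Dx j phi (u t, M t) * u' j + \sum_j \sum_k DP j k phi (u t, M t) * M' j k).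
Proof.
move=> dphi du dM.
have du1 : derivable u t 1 by apply/derivable_mxP => i j; rewrite ord1; case: (du j).
have dM1 : derivable M t 1 by apply/derivable_mxP => i j; case: (dM i j).
have Eu : 'D_1 u t = \row_j u' j.
  by rewrite derive_mx//; apply/rowP => j; rewrite !mxE; case: (du j).
have EM : 'D_1 M t = \matrix_(j, k) M' j k.
  by rewrite derive_mx//; apply/matrixP => j k; rewrite !mxE; case: (dM j k).
move/derivable1_diffP : du1 => du1; move/derivable1_diffP : dM1 => dM1.
have dc : differentiable (fun t => (u t, M t)) t by exact: differentiable_pair.
have dphic : differentiable (phi \o (fun t => (u t, M t))) t by exact: differentiable_comp.
split; first exact/derivable1_diffP.
rewrite deriveE// diff_comp//= diff_pair//= -!deriveE// Eu EM.
rewrite (_ : (\row_j u' j, \matrix_(j, k) M' j k) =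
  \sum_j u' j *: (delta_mx 0 j : 'rV[R]_n, 0 : 'M[R]_n) +
  \sum_j \sum_k M' j k *: (0 : 'rV[R]_n, delta_mx j k : 'M[R]_n)); last first.
  have sum1 (I : finType) (f : I -> 'rV[R]_n * 'M[R]_n) :
      \sum_i f i = (\sum_i (f i).1, \sum_i (f i).2).
    by elim/big_rec3 : _ => // i a b c _ ->.
  rewrite sum1 (eq_bigr _ (fun j _ => sum1 _ _)) sum1 /=.
  congr pair.
    rewrite [X in _ + X]big1 ?addr0; last by move=> j _; rewrite big1// => k _; rewrite scaler0.
    apply/rowP => j; rewrite !mxE summxE (bigD1 j)//= big1 ?addr0 ?mxE ?eqxx ?mulr1//.
    by move=> i ij; rewrite !mxE eqxx eq_sym (negbTE ij) mulr0.
  rewrite [\sum_(i < n) u' i *: 0]big1 ; last by move=> j _; rewrite scaler0.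
  transitivity (0 + \sum_j \sum_k M' j k *: delta_mx j k : 'M[R]_n); last by [].
  rewrite add0r.
  rewrite [LHS]matrix_sum_delta; apply: eq_bigr => j _; apply: eq_bigr => k _.
  by rewrite mxE.
set d := 'd phi (u t, M t).
have dD (a b : 'rV[R]_n * 'M[R]_n) : d (a + b) = d a + d b by exact: linearD.
have dZ c (a : 'rV[R]_n * 'M[R]_n) : d (c *: a) = c * d a by exact: linearZ.
have dsum (I : finType) (f : I -> 'rV[R]_n * 'M[R]_n) : d (\sum_i f i) = \sum_i d (f i).
  exact: linear_sum.
rewrite deriveE// -/d dD !dsum /=; congr (_ + _); apply: eq_bigr => j _.
  by rewrite dZ /Dx deriveE// mulrC.
rewrite dsum; apply: eq_bigr => k _.
by rewrite dZ /DP deriveE// mulrC.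
Qed.

Lemma near0_outside_support phi (z : 'rV[R]_n * 'M[R]_n) :
  ~ closure [set z | phi z != 0] z -> \forall w \near z, phi w = 0.
Proof.
move=> nz; have : nbhs z (~` closure [set z | phi z != 0]).
  by apply: open_nbhs_nbhs; split => //; apply: closed_openC; exact: closed_closure.
apply: filterS => w nw; apply/eqP; apply: contrapT => /negP pw.
by apply: nw; exact: subset_closure.
Qed.

Lemma test_function_support U phi : test_function U phi ->
  exists2 M : R, 0 < M & forall z : 'rV[R]_n * 'M[R]_n, M < `|z.1| ->
    \forall w \near z, phi w = 0.
Proof.
move=> [_ cK _]; have [M [_ MK]] := compact_bounded cK.
exists (`|M| + 1); first by rewrite ltr_wpDl.
move=> z Mz; apply: near0_outside_support => /(MK (`|M| + 1)).
rewrite (le_lt_trans (ler_norm M)) ?ltrDl// => /(_ isT) zM.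
have : `|z.1| <= `|z| by case: (z) => a b; rewrite prod_normE /= le_max lexx.
by move=> /le_trans/(_ zM); rewrite leNgt Mz.
Qed.

Lemma near0_derive phi (z v : 'rV[R]_n * 'M[R]_n) : (\forall w \near z, phi w = 0) -> 'D_v phi z = 0.
Proof. by move=> z0; rewrite (near_eq_derive (g := cst 0))// derive_cst. Qed.

Lemma compact_support_bounded (K : set ('rV[R]_n * 'M[R]_n)) (f : 'rV[R]_n * 'M[R]_n -> R) :
  compact K -> continuous f -> (forall z, ~ K z -> f z = 0) ->
  exists2 C, 0 <= C & forall z, `|f z| <= C.
Proof.
move=> cK cf f0.
have cfK : compact (f @` K).
  by apply: continuous_compact => //; exact: continuous_subspaceT.
have [M [_ MK]] := compact_bounded cfK.
exists (`|M| + 1); first by rewrite addr_ge0.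
move=> z; have [Kz|/f0 ->] := pselect (K z); last by rewrite normr0 addr_ge0.
by apply: (MK (`|M| + 1)); [rewrite (le_lt_trans (ler_norm M)) ?ltrDl|exists z].
Qed.

Lemma test_function_bounded U phi : test_function U phi ->
  (exists2 C, 0 <= C & forall z, `|phi z| <= C) /\
  (forall v, exists2 C, 0 <= C & forall z, `|'D_v phi z| <= C).
Proof.
move=> [[dphi cD] cK _].
have cphi : continuous phi by move=> z; exact: differentiable_continuous.
split; first by apply: (compact_support_bounded cK cphi) => z /near0_outside_support/nbhs_singleton.
by move=> v; apply: (compact_support_bounded cK (cD v)) => z /near0_outside_support/near0_derive.
Qed.

End ChainRule.


Lemma cvg_continuous_at (R : realType) (T : Type) (F : set_system T) (FF : Filter F)
    (u : R -> R) (s : T -> R) s0 :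
  continuous u -> s @ F --> s0 -> u (s t) @[t --> F] --> u s0.
Proof. by move=> cu cs; apply: cvg_comp cs (cu s0). Qed.

Section Contact.
Context {R : realType} (Phi Phi' Psi : R -> R) (H : profile Phi Phi' Psi).
Variable Q : 'M[R]_3.

(** The point of the surface over [(x, y)] and its tangent plane, the ratio
    [s = y / x] being a separate argument since both extend to [x = 0] in this form. *)
Definition lift (x y s : R) : 'rV[R]_3 := vec3 x y (csl * (x * Psi s)) *m Q.
Definition tproj_mx (s : R) : 'M[R]_3 := \matrix_(i, j) tproj Phi Psi Q i j s.
Definition contact (x y s : R) : 'rV[R]_3 * 'M[R]_3 := (lift x y s, tproj_mx s).

Lemma liftE x y s j : lift x y s 0 j = x * Q 0 j + y * Q 1 j + csl * (x * Psi s) * Q 2 j.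
Proof. by rewrite /lift mxE sum3 !vec3E. Qed.

Lemma cvg_contact {T : Type} {F : set_system T} {FF : Filter F} (x y s : T -> R) x0 y0 s0 :
  x @ F --> x0 -> y @ F --> y0 -> s @ F --> s0 ->
  contact (x t) (y t) (s t) @[t --> F] --> contact x0 y0 s0.
Proof.
move=> cx cy cs.
apply: (@cvg_pair _ _ _ F (nbhs (lift x0 y0 s0)) (nbhs (tproj_mx s0)));
  apply: cvg_mx_entries => i j.
  rewrite ord1 liftE; under eq_cvg do rewrite liftE.
  have cPsi := cvg_continuous_at FF (is_derive_continuous (is_derive_Psi H)) cs.
  apply: cvgD; first by apply: cvgD; apply: cvgM => //; exact: cvg_cst.
  by apply: cvgM; [apply: cvgM; [exact: cvg_cst|exact: (cvgM cx cPsi)]|exact: cvg_cst].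
rewrite mxE; under eq_cvg do rewrite mxE.
exact: (cvg_continuous_at FF (is_derive_continuous (is_derive_tproj H Q i j)) cs).
Qed.

Lemma continuous_slope l : continuous (slope Phi Psi l).
Proof. exact: is_derive_continuous (is_derive_slope H l). Qed.

Lemma continuous_homog l : continuous (homog (R:=R) l).
Proof.
case: l => s; first exact: cvg_cst.
by rewrite /homog; apply: cvgN; exact: cvg_id.
Qed.

Lemma continuous_tilt a : continuous (tilt Q a).
Proof.
by move=> s; apply: cvgB; [exact: cvg_cst|apply: cvgM; [exact: cvg_id|exact: cvg_cst]].
Qed.

Lemma continuous_cross : continuous (cross Phi Psi).
Proof.
move=> s; apply: cvgB; last exact: continuous_slope.
by apply: cvgM; [exact: cvg_id|exact: continuous_slope].
Qed.

Let cA := is_derive_continuous (is_derive_area_el H).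
Let cN a := is_derive_continuous (is_derive_normal H Q a).
Let cK := continuous_slope_y' H.

Lemma continuous_tproj' i j : continuous (tproj' Phi Phi' Psi Q i j).
Proof.
move=> s; have J0 n : area_el Phi Psi s ^+ n != 0 by rewrite expf_neq0// area_el_neq0.
have cV n : (area_el Phi Psi t ^+ n)^-1 @[t --> s] --> (area_el Phi Psi s ^+ n)^-1.
  by apply: cvgV => //; exact: (cvg_continuous_at _ (@exprn_continuous R n) (@cA s)).
have cn a := @cN a s; have ct a := @continuous_tilt a s; have ck := @cK s; have cc := @continuous_cross s.
refine (cvgB (cvgM (cvgM ck (cvgD (cvgM (ct i) (cn j)) (cvgM (cn i) (ct j)))) (cV 2%N))
  (cvgM (cvgM (cvgM (cvgM (cvgM (@cvg_cst R (2 : R) _ _ _) ck) cc) (cn i)) (cn j)) (cV 4%N))).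
Qed.

Lemma continuous_weight l a : continuous (weight Phi Psi Q l a).
Proof. exact: is_derive_continuous (is_derive_weight H Q l a). Qed.

Lemma continuous_tangent l j : continuous (tangent Phi Psi Q l j).
Proof.
move=> s; apply: cvgD; first exact: cvg_cst.
by apply: cvgM; [exact: continuous_slope|exact: cvg_cst].
Qed.

Lemma continuous_weight' l a : continuous (weight' Phi Phi' Psi Q l a).
Proof.
move=> s; have J0 n : area_el Phi Psi s ^+ n != 0 by rewrite expf_neq0// area_el_neq0.
have cV n : (area_el Phi Psi t ^+ n)^-1 @[t --> s] --> (area_el Phi Psi s ^+ n)^-1.
  by apply: cvgV => //; exact: (cvg_continuous_at _ (@exprn_continuous R n) (@cA s)).
have cn := @cN a s; have ct := @continuous_tilt a s; have ck := @cK s; have cc := @continuous_cross s.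
have ch := @continuous_homog l s; have cs := @continuous_slope l s.
have cV1 : (area_el Phi Psi t)^-1 @[t --> s] --> (area_el Phi Psi s)^-1 by exact: (cV 1%N).
refine (cvgD (cvgD (cvgM (cvgM (cvgN (cvgM ck cc)) cV1) (@cvg_cst R (Q (axis l) a) _ _ _))
  (cvgM (cvgM ck (cvgB (cvgM ch cn) (cvgM cs ct))) cV1))
  (cvgM (cvgM (cvgM cs cn) (cvgM ck cc)) (cV 3%N))).
Qed.

Implicit Types phi : 'rV[R]_3 * 'M[R]_3 -> R.

(** The derivative in the direction [l] of the flux [phi * weight l a] along
    the surface, [r] being the inverse of [x]. *)
Definition dflux phi l a (z : 'rV[R]_3 * 'M[R]_3) (s r : R) : R :=
  (\sum_j Dx j phi z * tangent Phi Psi Q l j s) * weight Phi Psi Q l a s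
  + r * ((\sum_j \sum_k DP j k phi z * tproj' Phi Phi' Psi Q j k s) *
           (weight Phi Psi Q l a s * homog l s)
         + phi z * (weight' Phi Phi' Psi Q l a s * homog l s)).

Lemma is_derive_flux phi l a (x y s : R -> R) (t r : R) :
  (forall z, differentiable phi z) ->
  (forall j, is_derive t 1 (fun t => lift (x t) (y t) (s t) 0 j) (tangent Phi Psi Q l j (s t))) ->
  is_derive t 1 s (homog l (s t) * r) ->
  is_derive t 1 (fun t => phi (contact (x t) (y t) (s t)) * weight Phi Psi Q l a (s t))
    (dflux phi l a (contact (x t) (y t) (s t)) (s t) r).
Proof.
move=> dphi du ds.
have dw : is_derive t 1 (weight Phi Psi Q l a \o s) (weight' Phi Phi' Psi Q l a (s t) * (homog l (s t) * r)).
  have h := is_derive_weight H Q l a (s t); exact: is_derive1_comp.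
have dP i j : is_derive t 1 (fun t => tproj_mx (s t) i j) (tproj' Phi Phi' Psi Q i j (s t) * (homog l (s t) * r)).
  have h := is_derive_tproj H Q i j (s t).
  rewrite (_ : (fun t => tproj_mx (s t) i j) = tproj Phi Psi Q i j \o s).
    exact: is_derive1_comp.
  by apply/funext => u; rewrite mxE.
have dc := @is_derive_test_curve R 3 phi (fun t => lift (x t) (y t) (s t)) (tproj_mx \o s) _ _ t (dphi _) du dP.
apply: (is_derive_eq (is_deriveM dc dw)).
rewrite /dflux /= -/(contact (x t) (y t) (s t)) /GRing.scale /=.
set z := contact _ _ _; set S := \sum_j _ * tangent _ _ _ _ _ _.
rewrite (_ : \sum_j \sum_k _ = (\sum_j \sum_k DP j k phi z * tproj' Phi Phi' Psi Q j k (s t)) * (homog l (s t) * r)).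
  by move: (\sum_j \sum_k _) => U; ring.
rewrite mulr_suml; apply: eq_bigr => j _; rewrite mulr_suml; apply: eq_bigr => k _.
by rewrite mulrA.
Qed.

Lemma cvg_dflux phi l a {T : Type} {F : set_system T} {FF : Filter F} (x y s r : T -> R) x0 y0 s0 r0 :
  C1 phi -> x @ F --> x0 -> y @ F --> y0 -> s @ F --> s0 -> r @ F --> r0 ->
  dflux phi l a (contact (x t) (y t) (s t)) (s t) (r t) @[t --> F] -->
  dflux phi l a (contact x0 y0 s0) s0 r0.
Proof.
move=> [dphi cD] cx cy cs cr; have cc := cvg_contact cx cy cs.
have cphi : continuous phi by move=> z; exact: differentiable_continuous.
have cf (f : 'rV[R]_3 * 'M[R]_3 -> R) : continuous f ->
    f (contact (x t) (y t) (s t)) @[t --> F] --> f (contact x0 y0 s0).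
  by move=> cont_f; apply: cvg_comp; [exact: cc|exact: cont_f].
have cw := cvg_continuous_at FF (continuous_weight (l := l) (a := a)) cs.
have cw' := cvg_continuous_at FF (continuous_weight' (l := l) (a := a)) cs.
have ch := cvg_continuous_at FF (continuous_homog (l := l)) cs.
have sum3_cvg (f : 'I_3 -> T -> R) f0 : (forall j, f j @ F --> f0 j) ->
    (\sum_j f j t) @[t --> F] --> \sum_j f0 j.
  move=> h; rewrite sum3; under eq_cvg do rewrite sum3.
  by apply: cvgD => //; apply: cvgD.
rewrite /dflux; apply: cvgD; apply: cvgM => //.
  apply: (sum3_cvg) => j; apply: cvgM; first exact/cf/cD.
  exact: (cvg_continuous_at FF (continuous_tangent (l := l) (j := j)) cs).
apply: cvgD; apply: cvgM; try by apply: cvgM.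
  apply: (sum3_cvg) => j; apply: (sum3_cvg) => k; apply: cvgM; first exact/cf/cD.
  exact: (cvg_continuous_at FF (continuous_tproj' (i := j) (j := k)) cs).
exact: cf.
Qed.

End Contact.


Section HalfPlaneMeasurability.
Context {R : realType}.

Lemma measurable_inv : measurable_fun setT (GRing.inv : line R -> line R).
Proof.
have -> : [set: line R] = [set~ 0] `|` [set 0] by rewrite setUC setUv.
have m0 : measurable ([set 0] : set (line R)) by exact: measurable_set1.
apply/measurable_funU; [exact: measurableC|exact: m0|split].
  apply: open_continuous_measurable_fun; first exact: closed_openC (@closed_eq R 0).
  by move=> x; rewrite inE /= => /eqP x0; exact: inv_continuous.
exact: measurable_fun_set1.
Qed.

Lemma measurable_quot : measurable_fun setT (fun p : coord_plane R => (p.2 : R) / p.1 : line R).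
Proof.
apply: measurable_funM; first exact: measurable_snd.
by apply: (measurableT_comp measurable_inv); exact: measurable_fst.
Qed.

Lemma nbhs_dyadic2_cell (p : coord_plane R) (U : set (R * R)) : nbhs (p : R * R) U ->
  exists k, cell dyadic2 k (dyadic2 k p) `<=` (U : set (coord_plane R)).
Proof.
move=> /nbhs_ballP[e /= e0 eU]; have [k _ ke] := exists_pow2_lt 0 e0.
exists k => q; rewrite dyadic2_cellE => -[/dyadic_close q1 /dyadic_close q2].
apply: eU; split; rewrite /ball /= distrC; exact: lt_trans ke.
Qed.

Lemma measurable_half_plane_continuous (T : topologicalType) (f : R * R -> T) (U : set T) :
  (forall p, 0 < p.1 -> {for p, continuous f}) -> open U ->
  measurable ([set p | 0 < (p.1 : R) /\ U (f p)] : set (coord_plane R)).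
Proof.
move=> cf oU; apply: (@measurable_cell_open _ _ _ dyadic2 0).
- exact: dyadic2_refines.
- exact: measurable_dyadic2_cell.
move=> p [p0 Up]; suff : nbhs (p : R * R) [set q | 0 < q.1 /\ U (f q)].
  by move=> /nbhs_dyadic2_cell[k kU]; exists k.
apply: filterI; last by apply: (cf p p0); exact: open_nbhs_nbhs.
have : nbhs (p.1 : R) [set x : R | 0 < x] by apply: open_nbhs_nbhs; split => //; exact: open_gt.
exact: cvg_fst.
Qed.

Lemma measurable_half_plane_preimage (T : topologicalType) (f : R * R -> T) (c : T) (U : set T) :
  (forall p, 0 < p.1 -> {for p, continuous f}) -> open U ->
  measurable ((fun p : coord_plane R => if 0 < (p.1 : R) then f p else c) @^-1` U).
Proof.
move=> cf oU.
rewrite [X in measurable X](_ : _ = [set p | 0 < (p.1 : R) /\ U (f p)] `|`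
    (if `[< U c >] then ~` @open_half_plane R else set0)).
  apply: measurableU; first exact: measurable_half_plane_continuous.
  by case: ifP => // _; apply: measurableC; exact: measurable_open_half_plane.
apply/seteqP; split=> p /=.
  case: ifPn => [p0 Up|p0 Uc]; first by left.
  by right; case: asboolP => // _; exact/negP.
move=> [[p0 Up]|]; first by rewrite p0.
by case: asboolP => // Uc /negP/negbTE; rewrite /open_half_plane /= => ->.
Qed.

Lemma measurable_half_plane_borel (T : normedModType R) (f : R * R -> T) (c : T) :
  (forall p, 0 < p.1 -> {for p, continuous f}) ->
  measurable_fun setT ((fun p => if 0 < (p.1 : R) then f p else c) : coord_plane R -> borel T).
Proof.
move=> cf; apply: (@measurability _ _ _ (borel T) setT _ (@open T)) => //.
by move=> _ [U oU <-]; rewrite setTI; exact: measurable_half_plane_preimage.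
Qed.

Lemma measurable_half_plane_line (f : R * R -> R) (c : R) :
  (forall p, 0 < p.1 -> {for p, continuous f}) ->
  measurable_fun setT ((fun p => if 0 < (p.1 : R) then f p else c) : coord_plane R -> line R).
Proof.
move=> cf; apply: (measurability _ (RGenOpens.measurableE R)).
move=> _ [_ [a [b ->] <-]]; rewrite setTI.
by apply: measurable_half_plane_preimage => //; exact: interval_open.
Qed.

End HalfPlaneMeasurability.


Section Domination.
Context {R : realType}.

Lemma ge0_integral_interval_cst (r c : R) : 0 <= r -> 0 <= c ->
  (\int[lebesgue_measure]_(y in [set` `[(- r)%R, r]]) c%:E = (c * (2 * r))%:E)%E.
Proof.
move=> r0 c0; rewrite integral_cst//= lebesgue_measure_itv/= lte_fin.
case: ifPn => [_|]; first by rewrite -EFinB -EFinM; congr EFin; ring.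
rewrite -leNgt => rr; have -> : r = 0 by apply/eqP; rewrite eq_le r0 andbT; lra.
by rewrite mule0 !mulr0.
Qed.

(** The singularity [1 / x] is integrable since the interval of those [y] with
    [`|y| < x] has length [2 x]. *)
Lemma integrable_wedge (f : coord_plane R -> line R) (M C : R) : 0 < M -> 0 <= C ->
  measurable_fun setT f ->
  (forall p, 0 < (p.1 : R) \/ f p = 0) ->
  (forall p, M < `|p.1 : R| \/ M < `|p.2 : R| -> f p = 0) ->
  (forall p, 0 < (p.1 : R) ->
    `|f p : R| <= C + (if `|p.2 : R| < p.1 then C / p.1 else 0)) ->
  (@area R).-integrable setT (EFin \o f).
Proof.
move=> M0 C0 mf fpos fbox fbound; apply/integrableP; split; first exact/measurable_EFinP.
have mF : measurable_fun setT (fun p => `|(f p)%:E|)%E.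
  by apply: measurableT_comp => //; exact/measurable_EFinP.
rewrite (_ : integral _ _ _ = \int[area]_p `|(f p)%:E|)%E//.
rewrite (@fubini_tonelli1 _ _ _ _ _ (@lebesgue_measure R) (@lebesgue_measure R))//.
pose K := C * (2 * M) + 2 * C; have K0 : 0 <= K by rewrite addr_ge0// mulr_ge0// mulr_ge0// ltW.
apply: (@le_lt_trans _ _ (\int[lebesgue_measure]_(x in `[(- M)%R, M]) K%:E)%E); last first.
  by rewrite (ge0_integral_interval_cst (ltW M0) K0) ltry.
rewrite [leRHS]integral_mkcond; apply: ge0_le_integral => //.
- by move=> x _; exact: integral_ge0.
- exact: measurable_fun_fubini_tonelli_F.
- by apply/(measurable_restrictT _ _).1.
move=> x _; rewrite /fubini_F patchE.
have zero : (forall y, f (x, y) = 0) -> (\int[lebesgue_measure]_y `|(f (x, y))%:E| = 0)%E.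
  by move=> h; rewrite integral0_eq// => y _; rewrite h abse0.
have [x0|x0] := leP (x : R) 0.
  rewrite zero; first by case: ifP; rewrite // lee_fin.
  by move=> y; case: (fpos (x, y)) => //=; rewrite ltNge x0.
have [xM|xM] := leP `|x : R| M; last first.
  rewrite zero; first by case: ifP; rewrite // lee_fin.
  by move=> y; apply: fbox; left.
rewrite ifT; last by rewrite inE /= in_itv/= -ler_norml.
pose g1 (r c : R) : line R -> \bar R := (cst c%:E \_ `[(- r)%R, r])%E.
have mg r c : measurable_fun setT (g1 r c).
  by apply/(measurable_restrictT _ _).1.
have g0 r c : 0 <= c -> forall y, (0 <= g1 r c y)%E.
  by move=> c0 y; rewrite /g1 patchE; case: ifP; rewrite // lee_fin.
have Cx : 0 <= C / x by rewrite divr_ge0// ltW.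
apply: (@le_trans _ _ (\int[lebesgue_measure]_y (g1 M C y + g1 x (C / x)%R y)%E)%E).
  apply: ge0_le_integral => //.
  - by apply: (measurableT_comp mF); exact: measurable_pair1.
  - exact: emeasurable_funD.
  move=> y _; have [yM|yM] := ltP M `|y : R|.
    by rewrite fbox ?abse0 ?adde_ge0 ?g0//; right.
  rewrite /g1 patchE ifT; last by rewrite inE /= in_itv/= -ler_norml.
  apply: (@le_trans _ _ (C + (if `|y : R| < x then C / x else 0))%:E); first exact: fbound.
  rewrite EFinD leeD2l// patchE; case: ifPn => yx; last first.
    by case: ifP; rewrite // lee_fin.
  by rewrite ifT// inE /= in_itv/= -ler_norml ltW.
rewrite ge0_integralD//; [|by move=> y _; exact: g0|by move=> y _; exact: g0].
rewrite -!integral_mkcond (ge0_integral_interval_cst (ltW M0) C0) (ge0_integral_interval_cst (ltW x0) Cx).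
rewrite -EFinD lee_fin.
rewrite /K lerD2l le_eqVlt; apply/orP; left; apply/eqP; field; rewrite gt_eqF//.
Qed.

Lemma bounded_constant_tails (u : R -> R) : continuous u ->
  (forall s, 1 <= s -> u s = u 1) -> (forall s, s <= -1 -> u s = u (-1)) ->
  exists2 C, 0 <= C & forall s, `|u s| <= C.
Proof.
move=> cu u1 um1.
have cI : compact (u @` [set` `[(-1 : R), 1]]).
  apply: continuous_compact; last exact: segment_compact.
  exact: continuous_subspaceT.
have [M [_ MK]] := compact_bounded cI.
have bound s : -1 <= s <= 1 -> `|u s| <= `|M| + 1.
  move=> s1; apply: (MK (`|M| + 1)); first by rewrite (le_lt_trans (ler_norm M)) ?ltrDl.
  by exists s => //; rewrite /= in_itv.
exists (`|M| + 1); first by rewrite addr_ge0.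
move=> s; have [s1|s1] := ltP 1 s; first by rewrite (u1 _ (ltW s1)) bound// lexx andbT; lra.
have [s2|s2] := ltP s (-1); first by rewrite (um1 _ (ltW s2)) bound// lexx; lra.
by rewrite bound// s1 s2.
Qed.

End Domination.


Definition bounded_fun {R : realType} {T : Type} (f : T -> R) : Prop :=
  exists2 C, 0 <= C & forall t, `|f t| <= C.

Section BoundedFun.
Context {R : realType} {T : Type}.
Implicit Types f g : T -> R.

Lemma bounded_funD f g : bounded_fun f -> bounded_fun g -> bounded_fun (fun t => f t + g t).
Proof.
move=> [C C0 fC] [D D0 gD]; exists (C + D); first exact: addr_ge0.
by move=> t; apply: le_trans (ler_normD _ _) _; exact: lerD.
Qed.

Lemma bounded_funM f g : bounded_fun f -> bounded_fun g -> bounded_fun (fun t => f t * g t).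
Proof.
move=> [C C0 fC] [D D0 gD]; exists (C * D); first exact: mulr_ge0.
by move=> t; rewrite normrM ler_pM.
Qed.

Lemma bounded_fun_sum3 (f : 'I_3 -> T -> R) : (forall i, bounded_fun (f i)) ->
  bounded_fun (fun t => \sum_i f i t).
Proof.
move=> fb; rewrite (_ : (fun t => \sum_i f i t) = fun t => f 0 t + f 1 t + f 2 t).
  by apply: bounded_funD => //; exact: bounded_funD.
by apply/funext => t; rewrite sum3.
Qed.

End BoundedFun.

Lemma norm_coord (R : realType) n (v : 'rV[R]_n) j : `|v 0 j| <= `|v|.
Proof. by rewrite [leRHS]/Num.norm /= mx_normrE; apply/bigmax_geP; right => /=; exists (0, j). Qed.

Lemma enorm_le_norm (R : realType) (v : 'rV[R]_3) : enorm v <= 2 * `|v|.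
Proof.
rewrite enorm_le_sqr ?mulr_ge0// sqr_enorm sum3 -!(sqr_norm (v 0 _)).
have := norm_coord v 0; have := norm_coord v 1; have := norm_coord v 2.
have := normr_ge0 (v 0 0); have := normr_ge0 (v 0 1); have := normr_ge0 (v 0 2).
move: `|v 0 0| `|v 0 1| `|v 0 2| `|v| => a b c d a0 b0 c0 ca cb cc; nra.
Qed.

Section FluxBounds.
Context {R : realType} (Phi Phi' Psi : R -> R) (H : profile Phi Phi' Psi).
Variable Q : 'M[R]_3.
Notation X := ('rV[R]_3 * 'M[R]_3)%type.
Notation tproj := (tproj Phi Psi Q).
Notation tproj' := (tproj' Phi Phi' Psi Q).
Notation weight := (weight Phi Psi Q).
Notation weight' := (weight' Phi Phi' Psi Q).
Notation tangent := (tangent Phi Psi Q).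
Notation dflux := (dflux Phi Phi' Psi Q).

Lemma slope_tails l (s : R) :
  (1 <= s -> slope Phi Psi l s = slope Phi Psi l 1) /\
  (s <= -1 -> slope Phi Psi l s = slope Phi Psi l (-1)).
Proof.
have out t : 1 <= `|t| -> slope Phi Psi l t = if l then 0 else if 0 < t then csl / 2 else - (csl / 2).
  by move=> /(slope_outside H)[h1 h2]; case: l.
split=> s1; rewrite !out ?normrN1 ?normr1//.
- by rewrite ltr01 (lt_le_trans ltr01 s1).
- by rewrite ler_normr s1.
- have -> : 0 < s = false by apply/negbTE; rewrite -leNgt; lra.
  by have -> : 0 < -1 :> R = false by apply/negbTE; rewrite -leNgt; lra.
- by rewrite ler_normr; apply/orP; right; lra.
Qed.

(** Whatever depends on the two slopes is constant for [s >= 1] and for [s <= -1]. *)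
Lemma slopes_tails (F : R -> R -> R) (u := fun s => F (slope Phi Psi false s) (slope Phi Psi true s)) s :
  (1 <= s -> u s = u 1) /\ (s <= -1 -> u s = u (-1)).
Proof.
have [f1 f2] := slope_tails false s; have [t1 t2] := slope_tails true s.
by split=> s1; rewrite /u; [rewrite f1// t1|rewrite f2// t2].
Qed.

Lemma tproj'_outside i j s : 1 <= `|s| -> tproj' i j s = 0.
Proof. by move=> s1; rewrite /tproj' (slope_y'_outside H s1); ring. Qed.

Lemma weight'_outside l a s : 1 <= `|s| -> weight' l a s = 0.
Proof. by move=> s1; rewrite /weight' (slope_y'_outside H s1); ring. Qed.

Lemma bounded_slopes (F : R -> R -> R) (u := fun s => F (slope Phi Psi false s) (slope Phi Psi true s)) :
  continuous u -> bounded_fun u.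
Proof. by move=> cu; apply: bounded_constant_tails cu _ _ => s; have [] := slopes_tails F s. Qed.

Lemma bounded_tangent l j : bounded_fun (tangent l j).
Proof.
have := continuous_tangent H (Q := Q) (l := l) (j := j); case: l => ct.
  exact: (@bounded_slopes (fun h k => Q 1 j + k * Q 2 j) ct).
exact: (@bounded_slopes (fun h k => Q 0 j + h * Q 2 j) ct).
Qed.

Lemma bounded_weight l a : bounded_fun (weight l a).
Proof.
have := continuous_weight H (Q := Q) (l := l) (a := a).
pose n h k := Q 2 a - h * Q 0 a - k * Q 1 a; case: l => cw.
  exact: (@bounded_slopes (fun h k => jac h k * Q 1 a + k * n h k / jac h k) cw).
exact: (@bounded_slopes (fun h k => jac h k * Q 0 a + h * n h k / jac h k) cw).
Qed.

Lemma bounded_area_el : bounded_fun (area_el Phi Psi).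
Proof.
exact: (@bounded_slopes jac (is_derive_continuous (is_derive_area_el H))).
Qed.

Lemma bounded_outside (u : R -> R) : continuous u -> (forall s, 1 <= `|s| -> u s = 0) -> bounded_fun u.
Proof.
move=> cu u0; apply: bounded_constant_tails => // s s1; rewrite !u0 ?normr1 ?normrN1//.
  by rewrite ler_normr s1.
by rewrite ler_normr; apply/orP; right; lra.
Qed.

Lemma bounded_tproj'_weight l a i j : bounded_fun (fun s => tproj' i j s * (weight l a s * homog l s)).
Proof.
apply: bounded_outside; last by move=> s s1; rewrite tproj'_outside// mul0r.
move=> s; have ch := @continuous_homog R l s.
exact: (cvgM (@continuous_tproj' _ _ _ _ H Q i j s) (cvgM (@continuous_weight _ _ _ _ H Q l a s) ch)).
Qed.

Lemma bounded_weight'_homog l a : bounded_fun (fun s => weight' l a s * homog l s).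
Proof.
apply: bounded_outside; last by move=> s s1; rewrite weight'_outside// mul0r.
move=> s; have ch := @continuous_homog R l s.
exact: (cvgM (@continuous_weight' _ _ _ _ H Q l a s) ch).
Qed.

Lemma dflux_bound U phi l a : test_function U phi ->
  exists2 C, 0 <= C & forall z s r, 0 <= r ->
    `|dflux phi l a z s r| <= C + (if `|s| < 1 then C * r else 0).
Proof.
move=> /test_function_bounded[bphi bD].
pose f1 (t : X * R) := (\sum_j Dx j phi t.1 * tangent l j t.2) * weight l a t.2.
pose f2 (t : X * R) := (\sum_j \sum_k DP j k phi t.1 * tproj' j k t.2) *
           (weight l a t.2 * homog l t.2) + phi t.1 * (weight' l a t.2 * homog l t.2).
have bfst (u : X -> R) : bounded_fun u -> bounded_fun (fun t : X * R => u t.1).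
  by move=> [C C0 uC]; exists C.
have bsnd (u : R -> R) : bounded_fun u -> bounded_fun (fun t : X * R => u t.2).
  by move=> [C C0 uC]; exists C.
have [C1 C10 f1C] : bounded_fun f1.
  apply: bounded_funM; last exact: (bsnd _ (bounded_weight l a)).
  apply: bounded_fun_sum3 => j; apply: bounded_funM; first exact: (bfst _ (bD _)).
  exact: (bsnd _ (bounded_tangent l j)).
have [C2 C20 f2C] : bounded_fun f2.
  apply: bounded_funD; last first.
    by apply: bounded_funM; [exact: (bfst _ bphi)|exact: (bsnd _ (bounded_weight'_homog l a))].
  rewrite (_ : (fun t => _) = fun t : X * R => \sum_j \sum_k DP j k phi t.1 *
      (tproj' j k t.2 * (weight l a t.2 * homog l t.2))).
    apply: bounded_fun_sum3 => j; apply: bounded_fun_sum3 => k; apply: bounded_funM.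
      exact: (bfst _ (bD _)).
    exact: (bsnd _ (bounded_tproj'_weight l a j k)).
  apply/funext => t; rewrite mulr_suml; apply: eq_bigr => j _.
  by rewrite mulr_suml; apply: eq_bigr => k _; rewrite -mulrA.
exists (C1 + C2); first exact: addr_ge0.
move=> z s r r0; have -> : dflux phi l a z s r = f1 (z, s) + r * f2 (z, s) by [].
apply: (le_trans (ler_normD _ _)); rewrite -addrA; apply: lerD => //.
have [s1|s1] := ltP `|s| 1; last first.
  rewrite /f2 /= (_ : \sum_j \sum_k _ = 0); last first.
    by rewrite big1// => j _; rewrite big1// => k _; rewrite tproj'_outside// mulr0.
  by rewrite weight'_outside// !(mul0r, mulr0, addr0) normr0.
rewrite normrM (ger0_norm r0) -[leLHS]add0r; apply: lerD => //.
by rewrite mulrC; apply: ler_wpM2r => //; apply: (le_trans (f2C _)); rewrite lerDr.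
Qed.

Lemma dflux_support phi l a z s r : (\forall w \near z, phi w = 0) -> dflux phi l a z s r = 0.
Proof.
move=> z0; rewrite /dflux (nbhs_singleton z0) !mul0r addr0.
rewrite big1; last by move=> j _; rewrite /Dx near0_derive// mul0r.
rewrite mul0r add0r big1 ?mul0r ?mulr0// => j _.
by rewrite big1// => k _; rewrite /DP near0_derive// mul0r.
Qed.

Hypothesis QQ : isometry_mx Q.

Lemma lift_coord x y s : `|x| <= 2 * `|lift Psi Q x y s| /\ `|y| <= 2 * `|lift Psi Q x y s|.
Proof.
have := enorm_le_norm (lift Psi Q x y s); rewrite /lift enorm_isometry// => h.
split; apply: (le_trans _ h).
  by have := enorm_coord (vec3 x y (csl * (x * Psi s))) 0; rewrite vec3E.
by have := enorm_coord (vec3 x y (csl * (x * Psi s))) 1; rewrite vec3E.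
Qed.

End FluxBounds.


Lemma integral_push_measure d1 d2 (X : measurableType d1) (Y : measurableType d2) (R : realType)
    (phi : X -> Y) (mphi : measurable_fun setT phi) (mu : {measure set X -> \bar R})
    (D : set Y) (h : Y -> \bar R) :
  measurable D -> (forall x, D (phi x)) -> measurable_fun setT h ->
  (\int[push_measure mphi mu]_(y in D) h y = \int[mu]_x h (phi x))%E.
Proof.
move=> mD Dphi mh; have DT : phi @^-1` D = setT by apply/seteqP; split=> // x _; exact: Dphi.
rewrite integralE [RHS]integralE; congr (_ - _)%E.
  rewrite [LHS](ge0_integral_pushforward mphi mu mD) ?DT//.
    by apply: eq_integral => x _; rewrite /= !funeposE.
  exact/measurable_funTS/measurable_funepos.
rewrite [LHS](ge0_integral_pushforward mphi mu mD) ?DT//.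
  by apply: eq_integral => x _; rewrite /= !funenegE.
exact/measurable_funTS/measurable_funeneg.
Qed.

Section SurfaceMeasure.
Context {R : realType} (Phi Phi' Psi : R -> R) (H : profile Phi Phi' Psi).
Variable Q : 'M[R]_3.
Notation X := (borel ('rV[R]_3 * 'M[R]_3)%type).
Notation tproj := (tproj Phi Psi Q).
Notation tproj' := (tproj' Phi Phi' Psi Q).
Notation tilt_tan := (tilt_tan Phi Psi Q).
Notation dflux := (dflux Phi Phi' Psi Q).
Notation contact := (contact Phi Psi Q).

Definition contact_at (p : R * R) : 'rV[R]_3 * 'M[R]_3 := contact p.1 p.2 (p.2 / p.1).

Let cvg_ratio (p : R * R) : 0 < p.1 -> q.2 / q.1 @[q --> p] --> p.2 / p.1.
Proof.
move=> p0; apply: cvgM; first exact: cvg_snd.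
by apply: cvgV; [rewrite gt_eqF|exact: cvg_fst].
Qed.

Lemma continuous_contact_at (p : R * R) : 0 < p.1 -> {for p, continuous contact_at}.
Proof.
by move=> p0; apply: (cvg_contact H); [exact: cvg_fst|exact: cvg_snd|exact: cvg_ratio].
Qed.

Definition chart (p : coord_plane R) : X :=
  if 0 < (p.1 : R) then contact_at p else contact 0 0 0.

Lemma measurable_chart : measurable_fun setT chart.
Proof.
refine (@measurable_half_plane_borel R ('rV[R]_3 * 'M[R]_3)%type contact_at (contact 0 0 0) _).
exact: continuous_contact_at.
Qed.

Lemma measurable_slope_quot l :
  measurable_fun setT (fun p : coord_plane R => slope Phi Psi l (p.2 / p.1) : line R).
Proof.
have ms : measurable_fun setT (slope Phi Psi l : line R -> line R).
  by apply: continuous_measurable_fun; exact: continuous_slope H l.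
exact: (measurableT_comp ms measurable_quot).
Qed.

Definition parameter_measure : {measure set (coord_plane R) -> \bar R} :=
  @graph_measure R (surface_x Phi Psi) (surface_y Phi)
    (measurable_slope_quot false) (measurable_slope_quot true).

Definition surface_measure : {measure set X -> \bar R} :=
  push_measure measurable_chart parameter_measure.

Lemma integral_surface_measure (D : set X) (h : X -> R) : measurable D ->
  (forall p, D (chart p)) -> measurable_fun setT (h : X -> line R) ->
  (\int[surface_measure]_(z in D) (h z)%:E = \int[area]_p
    (if (0 < (p.1 : R))%R then h (contact_at p) * area_el Phi Psi (p.2 / p.1) else 0)%:E)%E.
Proof.
move=> mD Dc mh; rewrite integral_push_measure//; last exact/measurable_EFinP.
rewrite (@integral_density _ _ _ _ _ _ _ (h \o chart)); last first.
  by apply: measurableT_comp => //; exact: measurable_chart.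
apply: eq_integral => p _; congr EFin; rewrite /jac_fun /= /chart.
by case: ifP => // _; rewrite mulr0.
Qed.

Lemma integrable_surface_measure (D : set X) (h : X -> R) : measurable D ->
  measurable_fun setT (h : X -> line R) ->
  (@area R).-integrable setT (fun p =>
    (if (0 < (p.1 : R)) && (contact_at p \in D)
     then h (contact_at p) * area_el Phi Psi (p.2 / p.1) else 0)%:E) ->
  surface_measure.-integrable D (EFin \o h).
Proof.
move=> mD mh ih; apply/integrableP; split; first exact/measurable_funTS/measurable_EFinP.
have mhD : measurable_fun setT ((fun z : X => `|h z|%:E) \_ D)%E.
  apply/(measurable_restrictT _ _).1 => //; apply/measurable_funTS/measurable_EFinP.
  exact: measurableT_comp.
rewrite (_ : integral _ _ _ = \int[surface_measure]_(z in D) `|h z|%:E)%E//.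
rewrite integral_mkcond integral_push_measure//.
rewrite ge0_integral_density; last 2 first.
- by apply: measurableT_comp => //; exact: measurable_chart.
- by move=> p; rewrite patchE; case: ifP; rewrite // lee_fin.
case/integrableP: ih => mih; apply: le_lt_trans; apply: ge0_le_integral => //.
- by move=> p _; apply: mule_ge0; [rewrite patchE; case: ifP; rewrite // lee_fin|rewrite lee_fin jac_fun_ge0].
- apply: emeasurable_funM; first by apply: measurableT_comp => //; exact: measurable_chart.
  apply/measurable_EFinP.
  exact: (@measurable_jac_fun R (surface_x Phi Psi) (surface_y Phi) (measurable_slope_quot false) (measurable_slope_quot true)).
- exact: measurableT_comp.
move=> p _; rewrite /jac_fun patchE /chart; case: (ltP 0 (p.1 : R)) => p0 /=; last by rewrite mule0.
case: ifPn => _; last by rewrite mul0e.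
by rewrite normrM (gtr0_norm (area_el_gt0 _ _ _)) -EFinM.
Qed.

Definition coord (i : 'I_3) (z : X) : R :=
  z.1 0 0 * Q i 0 + z.1 0 1 * Q i 1 + z.1 0 2 * Q i 2.

Definition wedge : set X := [set z | 0 < coord 0 z /\ `|coord 2 z| <= coord 0 z / Num.sqrt 3].

(** The coefficients are extended by zero outside a wedge around the surface;
    the wedges of the surfaces of a family are disjoint. *)
Definition curv (a j k : 'I_3) (z : X) : R :=
  if (0 < coord 0 z) && (`|coord 2 z| <= coord 0 z / Num.sqrt 3) then
    (coord 0 z)^-1 * (tilt_tan a (coord 1 z / coord 0 z) * tproj' j k (coord 1 z / coord 0 z))
  else 0.

Lemma curv_outside a j k z : ~ wedge z -> curv a j k z = 0.
Proof. by rewrite /curv; case: ifP => // /andP[h1 h2] []. Qed.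

Lemma measurable_coord i : measurable_fun setT (coord i : X -> line R).
Proof.
have m j : measurable_fun setT (fun z : X => z.1 0 j : line R).
  apply: (@measurable_borel_continuous R ('rV[R]_3 * 'M[R]_3)%type (fun z => z.1 0 j)) => z.
  by apply: (@cvg_comp _ _ _ _ (fun v : 'rV[R]_3 => v 0 j) _ (nbhs z.1)); [exact: cvg_fst|exact: coord_continuous].
have mQ j : measurable_fun setT (fun z : X => z.1 0 j * Q i j : line R).
  by apply: measurable_funM; [exact: m|exact: measurable_cst].
exact: (measurable_funD (measurable_funD (mQ 0) (mQ 1)) (mQ 2)).
Qed.

Lemma continuous_tilt_tan a : continuous (tilt_tan a).
Proof.
move=> s; have J0 : area_el Phi Psi s ^+ 2 != 0 by rewrite expf_neq0// area_el_neq0.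
have cA := @is_derive_continuous _ _ _ (is_derive_area_el H) s.
have cV : (area_el Phi Psi t ^+ 2)^-1 @[t --> s] --> (area_el Phi Psi s ^+ 2)^-1.
  by apply: cvgV => //; exact: (cvg_continuous_at _ (@exprn_continuous R 2) cA).
exact: (cvgB (@continuous_tilt _ Q a s) (cvgM (cvgM (@continuous_cross _ _ _ _ H s)
  (@is_derive_continuous _ _ _ (is_derive_normal H Q a) s)) cV)).
Qed.

Lemma measurable_curv a j k : measurable_fun setT (curv a j k : X -> line R).
Proof.
have mV : measurable_fun setT (fun z : X => (coord 0 z)^-1 : line R).
  exact: (measurableT_comp measurable_inv (measurable_coord 0)).
have ms : measurable_fun setT (fun z : X => coord 1 z / coord 0 z : line R).
  by apply: measurable_funM => //; exact: measurable_coord.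
have mc (u : R -> R) : continuous u -> measurable_fun setT (fun z : X => u (coord 1 z / coord 0 z) : line R).
  by move=> cu; exact: (measurableT_comp (continuous_measurable_fun cu) ms).
apply: measurable_fun_ifT; last exact: measurable_cst.
- apply: measurable_and.
    by apply: measurable_fun_ltr; [exact: measurable_cst|exact: measurable_coord].
  apply: measurable_fun_ler; first by apply: measurableT_comp => //; exact: measurable_coord.
  by apply: measurable_funM => //; exact: measurable_coord.
- apply: measurable_funM => //; apply: measurable_funM; apply: mc.
    exact: continuous_tilt_tan.
  exact: continuous_tproj'.
Qed.

Hypothesis QQ : isometry_mx Q.

Lemma coord_lift i x y s P : coord i (lift Psi Q x y s, P) = vec3 x y (csl * (x * Psi s)) 0 i.
Proof.
have : lift Psi Q x y s *m Q^T = vec3 x y (csl * (x * Psi s)).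
  by rewrite /lift -mulmxA QQ mulmx1.
by move=> <-; rewrite mxE sum3 ![Q^T _ _]mxE.
Qed.

Lemma wedge_contact x y : 0 < x -> wedge (contact x y (y / x)).
Proof.
move=> x0; rewrite /wedge /= !coord_lift !vec3E; split=> //.
rewrite normrM (gtr0_norm csl_gt0) normrM (gtr0_norm x0) mulrA ler_pdivlMr ?sqrt3_gt0//.
rewrite (_ : csl * x * `|_| * _ = x * (2 * `|Psi (y / x)|)); last first.
  by rewrite /csl; field; rewrite gt_eqF// sqrt3_gt0.
rewrite ger_pMr//; have := Psi_bound H (y / x); lra.
Qed.

Lemma curv_contact a j k x y : 0 < x -> curv a j k (contact x y (y / x)) =
  x^-1 * (tilt_tan a (y / x) * tproj' j k (y / x)).
Proof.
move=> x0; rewrite /curv; have [/= -> ->] := wedge_contact y x0.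
by rewrite !coord_lift !vec3E.
Qed.

(** The integrand of the curvature equation is, up to the area element, the
    divergence of the flux. *)
Lemma curvature_integrand phi a x y (A : 'I_3 -> 'I_3 -> 'I_3 -> R) : 0 < x ->
  (forall a j k, A a j k = x^-1 * (tilt_tan a (y / x) * tproj' j k (y / x))) ->
  let z := contact x y (y / x) in
  (\sum_j z.2 a j * Dx j phi z + \sum_j \sum_k DP j k phi z * A a j k
    + \sum_j phi z * A j a j) * area_el Phi Psi (y / x) =
  dflux phi false a z (y / x) x^-1 + dflux phi true a z (y / x) x^-1.
Proof.
move=> x0 AE /=; set z := contact x y (y / x); set s := y / x.
pose S := \sum_j \sum_k DP j k phi z * tproj' j k s.
rewrite (_ : \sum_j \sum_k _ = x^-1 * tilt_tan a s * S); last first.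
  rewrite mulr_sumr; apply: eq_bigr => j _; rewrite mulr_sumr; apply: eq_bigr => k _.
  by rewrite AE -/s; ring.
rewrite (_ : \sum_j phi z * _ = x^-1 * phi z * \sum_j tilt_tan j s * tproj' a j s); last first.
  rewrite mulr_sumr; apply: eq_bigr => j _; rewrite AE -/s; ring.
rewrite (_ : \sum_j tproj_mx _ _ _ _ a j * _ = \sum_j tproj a j s * Dx j phi z); last first.
  by apply: eq_bigr => j _; rewrite mxE.
have e1 : (\sum_j tproj a j s * Dx j phi z) * area_el Phi Psi s =
  (\sum_j Dx j phi z * tangent Phi Psi Q false j s) * weight Phi Psi Q false a s +
  (\sum_j Dx j phi z * tangent Phi Psi Q true j s) * weight Phi Psi Q true a s.
  rewrite !mulr_suml -big_split /=; apply: eq_bigr => j _.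
  rewrite mulrAC (mulrC (tproj a j s)) -(weight_tangent _ _ QQ); ring.
have e2 := weight_homog Phi Psi Q a s.
have e3 := weight'_homog Phi Phi' Psi QQ a s.
set T1 := \sum_j tproj a j s * _ in e1 *; set Sig := \sum_j tilt_tan j s * _ in e3 *.
apply: (@etrans _ _ (T1 * area_el Phi Psi s + x^-1 * S * (area_el Phi Psi s * tilt_tan a s)
  + x^-1 * phi z * (area_el Phi Psi s * Sig))); first by rewrite -/s; ring.
rewrite e1 -e2 -e3 /dflux -/S.
by move: (\sum_j _) (\sum_j _) S => u v S'; rewrite -/s; ring.
Qed.

End SurfaceMeasure.


Section Divergence.
Context {R : realType} (Phi Phi' Psi : R -> R) (H : profile Phi Phi' Psi).
Variable Q : 'M[R]_3.
Hypothesis QQ : isometry_mx Q.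
Notation X := (borel ('rV[R]_3 * 'M[R]_3)%type).
Notation weight := (weight Phi Psi Q).
Notation dflux := (dflux Phi Phi' Psi Q).
Notation contact := (contact Phi Psi Q).
Notation contact_at := (contact_at Phi Psi Q).

Definition same_tail (s t : R) : Prop := (1 <= s /\ 1 <= t) \/ (s <= -1 /\ t <= -1).

Lemma same_tail_outside s t : same_tail s t -> 1 <= `|s| /\ 1 <= `|t|.
Proof. by rewrite !ler_normr => -[[h1 h2]|[h1 h2]]; split; apply/orP; (left; lra) || (right; lra). Qed.

Lemma same_tail_slope l s t : same_tail s t -> slope Phi Psi l s = slope Phi Psi l t.
Proof.
have [f1 f2] := slope_tails H l s; have [t1 t2] := slope_tails H l t.
by case=> -[h1 h2]; [rewrite f1// t1|rewrite f2// t2].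
Qed.

Lemma same_tail_contact x y s t : same_tail s t -> contact x y s = contact x y t.
Proof.
move=> st; have P : Psi s = Psi t.
  have [[h1 h2]|[h1 h2]] := st; first by rewrite !(Psi_outside H).
  rewrite -[s]opprK -[t]opprK (Psi_odd H (- s)) (Psi_odd H (- t)) !(Psi_outside H)//; lra.
rewrite /contact /lift P; congr pair; apply/matrixP => i j; rewrite !mxE.
by rewrite /tproj /normal /area_el !(same_tail_slope _ st).
Qed.

Lemma same_tail_weight l a s t : same_tail s t -> weight l a s = weight l a t.
Proof. by move=> st; rewrite /weight /normal /area_el !(same_tail_slope _ st). Qed.

Lemma dflux_outside phi l a z s r : 1 <= `|s| ->
  dflux phi l a z s r = (\sum_j Dx j phi z * tangent Phi Psi Q l j s) * weight l a s.
Proof.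
move=> s1; rewrite /dflux weight'_outside//.
rewrite [X in _ + r * (X * _ + _)]big1 ?mul0r ?mulr0 ?addr0 ?mulr0 ?addr0// => j _.
by rewrite big1// => k _; rewrite tproj'_outside// mulr0.
Qed.

Lemma same_tail_dflux phi l a x y s t r r' : same_tail s t ->
  dflux phi l a (contact x y s) s r = dflux phi l a (contact x y t) t r'.
Proof.
move=> st; have [s1 t1] := same_tail_outside st.
rewrite !dflux_outside// (same_tail_contact x y st) (same_tail_weight l a st).
congr (_ * _); apply: eq_bigr => j _.
by rewrite /tangent (same_tail_slope l st).
Qed.

Definition divergence phi l a (p : coord_plane R) : R :=
  if 0 < (p.1 : R) then dflux phi l a (contact_at p) (p.2 / p.1) p.1^-1 else 0.

Variables (U : set 'rV[R]_3) (phi : 'rV[R]_3 * 'M[R]_3 -> R) (a : 'I_3).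
Hypothesis phi_test : test_function U phi.

Let C1phi : C1 phi. Proof. by case: phi_test. Qed.
Let dphi z : differentiable phi z. Proof. by case: C1phi. Qed.

Lemma measurable_divergence l : measurable_fun setT (divergence phi l a : coord_plane R -> line R).
Proof.
apply: (@measurable_half_plane_line R (fun p => dflux phi l a (contact_at p) (p.2 / p.1) p.1^-1)) => p p0.
have c1 : q.1^-1 @[q --> p] --> p.1^-1 by apply: cvgV; [rewrite gt_eqF|exact: cvg_fst].
apply: (cvg_dflux H) => //; first exact: cvg_fst; first exact: cvg_snd.
by apply: cvgM => //; exact: cvg_snd.
Qed.

Lemma divergence_box : exists2 M, 0 < M & forall x y s, M < `|x| \/ M < `|y| ->
  \forall w \near contact x y s, phi w = 0.
Proof.
have [M M0 hM] := test_function_support phi_test; exists (2 * M); first by rewrite mulr_gt0.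
move=> x y s xy; apply: hM; have [hx hy] := lift_coord Psi QQ x y s.
by rewrite /=; case: xy => h; have := lt_le_trans h _; [move/(_ _ hx)|move/(_ _ hy)]; rewrite ltr_pM2l.
Qed.

Lemma integrable_divergence l : (@area R).-integrable setT (EFin \o divergence phi l a).
Proof.
have [M M0 box] := divergence_box.
have [C C0 bound] := dflux_bound H Q l a phi_test.
apply: (@integrable_wedge R _ M C) => //.
- exact: measurable_divergence.
- by move=> p; rewrite /divergence; case: ifPn => _; [left|right].
- move=> p pM; rewrite /divergence; case: ifP => // _; apply: dflux_support; exact: box.
move=> p p0; rewrite /divergence p0; apply: (le_trans (bound _ _ _ _)).
  by rewrite invr_ge0 ltW.
by rewrite normrM normfV (gtr0_norm p0) ltr_pdivrMr// mul1r.
Qed.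

Lemma integral_divergence_y (x : R) :
  (\int[lebesgue_measure]_y (divergence phi true a (x, y))%:E = 0)%E.
Proof.
have [x0|x0] := ltP 0 x; last first.
  by apply: integral0_eq => y _; rewrite /divergence /= ltNge x0.
have [M M0 box] := divergence_box; pose N := M + 1.
have MN : M < N by rewrite /N; lra.
pose F y := phi (contact x y (y / x)) * weight true a (y / x).
pose f y := dflux phi true a (contact x y (y / x)) (y / x) x^-1.
have dF (y : R) : is_derive y 1 F (f y).
  apply: (@is_derive_flux R Phi Phi' Psi H Q phi true a (cst x) id (fun y => y / x)) => //; last first.
    by rewrite /homog mul1r; exact: is_derive_quot_y.
  move=> j; have h := is_derive_surface_y H y x0.
  rewrite (_ : (fun t => _) = cst (x * Q 0 j) + Q 1 j *: id + Q 2 j *: surface Psi x).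
    have hD := is_deriveD (is_deriveD (is_derive_cst (x * Q 0 j) y 1)
      (is_deriveZ (Q 1 j) (is_derive_id y 1))) (is_deriveZ (Q 2 j) h).
    apply: (is_derive_eq hD); rewrite /GRing.scale /= /tangent /slope /surface_y /axis; ring.
  by apply/funext => t; rewrite liftE !fctE /GRing.scale /= /surface; ring.
have cf : continuous f.
  move=> y; apply: (@cvg_dflux _ _ _ _ H Q phi true a R (nbhs y) _ (cst x) id (fun t => t / x) (cst x^-1));
    [exact: C1phi|exact: cvg_cst|exact: cvg_id| |exact: cvg_cst].
  by apply: cvgM; [exact: cvg_id|exact: cvg_cst].
have NN : - N <= N by rewrite /N; lra.
have := integral_is_derive NN dF cf.
have F0 y : M < `|y| -> F y = 0.
  by move=> yM; rewrite /F (nbhs_singleton (box _ _ _ (or_intror yM))) mul0r.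
have N0 : 0 < N by rewrite /N; lra.
rewrite !F0; last 2 first.
- by rewrite normrN gtr0_norm.
- by rewrite gtr0_norm.
rewrite subrr => E; apply: etrans E; rewrite [RHS]integral_mkcond; apply: eq_integral => y _.
rewrite patchE /divergence /= x0; case: ifPn => //.
rewrite notin_setE /= in_itv/= -ler_norml => /negP; rewrite -ltNge => yN.
by rewrite dflux_support//; apply: box; right; exact: lt_trans yN.
Qed.

Definition end_slope (y : R) : R := if 0 < y then 1 else -1.

Lemma end_slopeE (y : R) : y != 0 -> y / `|y| = end_slope y.
Proof.
rewrite /end_slope => y0; have [h|h] := ltP 0 y; first by rewrite gtr0_norm// divff.
by rewrite ler0_norm// invrN mulrN divff.
Qed.

(** For fixed [y != 0] the flux stays differentiable across [x = 0] once the
    ratio [y / x] is cut off at the value 1 or -1 it has at [x = `|y|]. *)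
Lemma integral_divergence_x (y : R) : y != 0 ->
  (\int[lebesgue_measure]_x (divergence phi false a (x, y))%:E =
   (- (phi (contact 0 y (end_slope y)) * weight false a (end_slope y)))%:E)%E.
Proof.
move=> y0; have ny0 : 0 < `|y| by rewrite normr_gt0.
have [M M0 box] := divergence_box; pose N := M + 1.
have MN : M < N by rewrite /N; lra.
pose m x := Num.max x `|y|; have m0 x : 0 < m x by rewrite lt_max ny0 orbT.
pose S x := y / m x.
have small x : x <= `|y| -> S x = end_slope y.
  by move=> xy; rewrite /S /m (max_idPr xy) end_slopeE.
have large x : `|y| <= x -> S x = y / x by move=> yx; rewrite /S /m (max_idPl yx).
have tail x : 0 < x -> x <= `|y| -> same_tail (y / x) (end_slope y).
  move=> x0; rewrite /end_slope; case: ifPn => [yp|]; first by rewrite gtr0_norm// => h; left; rewrite ler_pdivlMr// mul1r.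
  rewrite -leNgt => yn; rewrite ler0_norm// => h; right; split=> //.
  by rewrite ler_pdivrMr//; lra.
have out : 1 <= `|end_slope y| by rewrite /end_slope; case: ifP; rewrite ?normrN ?normr1.
pose F x := phi (contact x y (S x)) * weight false a (S x).
pose f x := dflux phi false a (contact x y (S x)) (S x) (m x)^-1.
have dF (x : R) : is_derive x 1 F (f x).
  have [xy|yx] := ltP x `|y|.
    apply: (near_eq_is_derive (f := fun x => phi (contact x y (end_slope y)) * weight false a (end_slope y))).
      have : \forall t \near x, t < `|y| by apply: open_nbhs_nbhs; split => //; exact: open_lt.
      by apply: filterS => t ty; rewrite /F small// ltW.
    rewrite /f small ?ltW// dflux_outside// -(dflux_outside _ _ _ _ 0)//.
    apply: (@is_derive_flux R Phi Phi' Psi H Q phi false a id (cst y) (cst (end_slope y))) => //; last first.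
      by apply: is_derive_eq; rewrite mulr0.
    move=> j; rewrite (_ : (fun t => _) = (Q 0 j + csl * Psi (end_slope y) * Q 2 j) *: id + cst (y * Q 1 j)).
      have hD := is_deriveD (is_deriveZ (Q 0 j + csl * Psi (end_slope y) * Q 2 j) (is_derive_id x 1))
        (is_derive_cst (y * Q 1 j) x 1).
      apply: (is_derive_eq hD).
      rewrite /GRing.scale /= /tangent /slope /slope_x (Phi_outside H out) /axis; ring.
    by apply/funext => t; rewrite liftE !fctE /GRing.scale /=; ring.
  have x0 : 0 < x by exact: lt_le_trans yx.
  apply: (near_eq_is_derive (f := fun x => phi (contact x y (y / x)) * weight false a (y / x))).
    have : \forall t \near x, 0 < t by apply: open_nbhs_nbhs; split => //; exact: open_gt.
    apply: filterS => t t0; rewrite /F; have [ty|yt] := ltP t `|y|; last by rewrite large.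
    have st := tail t t0 (ltW ty).
    by rewrite small ?ltW// (same_tail_contact _ _ st) (same_tail_weight _ _ st).
  rewrite /f large// /m (max_idPl yx).
  apply: (@is_derive_flux R Phi Phi' Psi H Q phi false a id (cst y) (fun x => y / x)) => //; last first.
    rewrite /homog; apply: is_derive_quot_x; exact: lt0r_neq0.
  move=> j; have h := is_derive_surface_x H y x0.
  rewrite (_ : (fun t => _) = cst (y * Q 1 j) + Q 0 j *: id + Q 2 j *: (surface Psi)^~ y).
    have hD := is_deriveD (is_deriveD (is_derive_cst (y * Q 1 j) x 1)
      (is_deriveZ (Q 0 j) (is_derive_id x 1))) (is_deriveZ (Q 2 j) h).
    apply: (is_derive_eq hD); rewrite /GRing.scale /= /tangent /slope /surface_x /axis; ring.
  by apply/funext => t; rewrite liftE !fctE /GRing.scale /= /surface; ring.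
have cm : continuous m.
  move=> x; apply: (@continuous_max _ _ (id : R -> R^o) (cst `|y| : R -> R^o)).
    exact: cvg_id.
  exact: cvg_cst.
have cf : continuous f.
  move=> x; have cV : (m t)^-1 @[t --> x] --> (m x)^-1.
    by apply: cvgV; [rewrite gt_eqF|exact: cm].
  apply: (@cvg_dflux _ _ _ _ H Q phi false a R (nbhs x) _ id (cst y) S (fun t => (m t)^-1));
    [exact: C1phi|exact: cvg_id|exact: cvg_cst| |exact: cV].
  by apply: cvgM; [exact: cvg_cst|exact: cV].
have N0 : 0 <= N by rewrite /N; lra.
have := integral_is_derive N0 dF cf.
have -> : F N = 0.
  have NM : M < `|N| by rewrite ger0_norm.
  by rewrite /F (nbhs_singleton (box _ _ _ (or_introl NM))) mul0r.
rewrite {1}/F small ?normr_ge0// sub0r => <-.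
rewrite -(@integral_itv_obnd_cbnd R 0 (BRight N)); last first.
  by apply/measurable_EFinP/measurable_funTS; exact: continuous_measurable_fun.
rewrite [RHS]integral_mkcond; apply: eq_integral => x _.
rewrite patchE /divergence /=; case: ifPn => x0.
  case: ifPn => xN; last first.
    rewrite dflux_support//; apply: box; left; rewrite gtr0_norm//.
    move: xN; rewrite notin_setE /= in_itv/= x0 /= => /negP; rewrite -ltNge.
    exact: lt_trans.
  congr EFin; rewrite /f /contact_at /=; have [xy|yx] := ltP x `|y|.
    rewrite small ?ltW//; apply: same_tail_dflux; apply: tail => //; exact: ltW.
  by rewrite large// /m (max_idPl yx).
by rewrite ifF//; apply/negbTE; rewrite notin_setE /= in_itv/= (negbTE x0).
Qed.

End Divergence.


Section MeasurableGrassmannian.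
Context {R : realType}.
Notation X := (borel ('rV[R]_3 * 'M[R]_3)%type).

Lemma idempotent_trace n (P : 'M[R]_n) : P *m P = P -> \tr P = (\rank P)%:R.
Proof.
move=> PP; have E : row_base P *m col_base P = 1%:M.
  apply: (row_full_inj (col_base_full P)); apply: (row_free_inj (row_base_free P)).
  rewrite /= mulmx1; transitivity ((col_base P *m row_base P) *m (col_base P *m row_base P)).
    by rewrite !mulmxA.
  by rewrite !mulmx_base.
have := mxtrace_mulC (col_base P) (row_base P).
by rewrite E mulmx_base mxtrace1.
Qed.

Lemma measurable_entry i j : measurable_fun setT (fun z : X => z.2 i j : line R).
Proof.
apply: (@measurable_borel_continuous R ('rV[R]_3 * 'M[R]_3)%type (fun z => z.2 i j)) => z.
apply: (@cvg_comp _ _ _ _ (fun v : 'M[R]_3 => v i j) _ (nbhs z.2)); first exact: cvg_snd.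
exact: coord_continuous.
Qed.

Lemma measurable_Gm m : measurable (Gm m [set: 'rV[R]_3] : set X).
Proof.
pose h (z : X) : R := \sum_i \sum_j ((z.2 i j - z.2 j i) ^+ 2 +
  ((\sum_k z.2 i k * z.2 k j) - z.2 i j) ^+ 2) + (\sum_i z.2 i i - m%:R) ^+ 2.
have mh : measurable_fun setT (h : X -> line R).
  have me := measurable_entry.
  apply: measurable_funD.
    apply: measurable_sum => i; apply: measurable_sum => j; apply: measurable_funD.
      by apply: measurable_funX; apply: measurable_funB; exact: me.
    apply: measurable_funX; apply: measurable_funB; last exact: me.
    by apply: measurable_sum => k; apply: measurable_funM; exact: me.
  apply: measurable_funX; apply: measurable_funB; last exact: measurable_cst.
  by apply: measurable_sum => k; exact: me.
rewrite (_ : Gm _ _ = h @^-1` [set 0]); last first.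
  apply/seteqP; split=> z /=.
    move=> [_ [[PT PP] rk]]; rewrite /h.
    have -> : \sum_i z.2 i i = m%:R by rewrite -rk -idempotent_trace.
    rewrite subrr expr0n addr0 big1// => i _; rewrite big1// => j _.
    rewrite -{2}PT mxE subrr expr0n add0r (_ : \sum_k _ = z.2 i j) ?subrr ?expr0n//.
    by rewrite -{3}PP mxE.
  move=> /eqP; rewrite /h paddr_eq0 ?sqr_ge0//; last first.
    by apply: sumr_ge0 => i _; apply: sumr_ge0 => j _; rewrite addr_ge0 ?sqr_ge0.
  move=> /andP[/eqP h0]; rewrite sqrf_eq0 subr_eq0 => /eqP tr.
  have {}h0 i j : z.2 i j = z.2 j i /\ \sum_k z.2 i k * z.2 k j = z.2 i j.
    have s0 i' : 0 <= \sum_j ((z.2 i' j - z.2 j i') ^+ 2 + ((\sum_k z.2 i' k * z.2 k j) - z.2 i' j) ^+ 2).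
      by apply: sumr_ge0 => j' _; rewrite addr_ge0 ?sqr_ge0.
    have /(_ i isT) := psumr_eq0P (fun i _ => s0 i) h0.
    have t0 j' : 0 <= (z.2 i j' - z.2 j' i) ^+ 2 + ((\sum_k z.2 i k * z.2 k j') - z.2 i j') ^+ 2.
      by rewrite addr_ge0 ?sqr_ge0.
    move=> /(psumr_eq0P (fun j' _ => t0 j'))/(_ j isT)/eqP.
    rewrite paddr_eq0 ?sqr_ge0// !sqrf_eq0 !subr_eq0 => /andP[/eqP -> /eqP ->].
    by split.
  have PP : z.2 *m z.2 = z.2 by apply/matrixP => i j; rewrite mxE; case: (h0 i j).
  split=> //; split; first by split=> //; apply/matrixP => i j; rewrite mxE; case: (h0 j i).
  by apply/eqP; rewrite -(eqr_nat R) -idempotent_trace// -tr.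
by rewrite -[X in measurable X]setTI; apply: mh => //; exact: measurable_set1.
Qed.

Lemma measurable_compact (K : set ('rV[R]_3 * 'M[R]_3)) : compact K -> measurable (K : set X).
Proof.
move=> cK; rewrite -(setCK K); apply: measurableC; apply: sub_sigma_algebra.
by apply: closed_openC; apply: compact_closed => //; exact: norm_hausdorff.
Qed.

Lemma compact_fst_bounded (K : set ('rV[R]_3 * 'M[R]_3)) : compact K ->
  exists2 M : R, 0 < M & forall z, K z -> `|z.1| <= M.
Proof.
move=> cK; have [M [_ MK]] := compact_bounded cK.
exists (`|M| + 1); first by rewrite ltr_wpDl.
move=> z /(MK (`|M| + 1)); rewrite (le_lt_trans (ler_norm M)) ?ltrDl// => /(_ isT).
by apply: le_trans; case: (z) => a b; rewrite prod_normE /= le_max lexx.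
Qed.

End MeasurableGrassmannian.

Section SurfaceRadon.
Context {R : realType} (Phi Phi' Psi : R -> R) (H : profile Phi Phi' Psi).
Variable Q : 'M[R]_3.
Hypothesis QQ : isometry_mx Q.
Notation X := (borel ('rV[R]_3 * 'M[R]_3)%type).
Notation tproj := (tproj Phi Psi Q).
Notation tproj' := (tproj' Phi Phi' Psi Q).
Notation tilt_tan := (tilt_tan Phi Psi Q).
Notation weight := (weight Phi Psi Q).
Notation contact := (contact Phi Psi Q).
Notation contact_at := (contact_at Phi Psi Q).
Notation chart := (chart Phi Psi Q).

Definition normal_vec (s : R) : 'rV[R]_3 :=
  vec3 (- slope Phi Psi false s) (- slope Phi Psi true s) 1 *m Q.

Lemma normal_vecE s j : normal_vec s 0 j = normal Phi Psi Q j s.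
Proof. by rewrite /normal_vec mxE sum3 !vec3E /normal; ring. Qed.

Lemma tproj_mxE s : tproj_mx Phi Psi Q s = proj_normal (normal_vec s).
Proof.
apply/matrixP => i j; rewrite /proj_normal !mxE big_ord1 mxE !normal_vecE /tproj.
rewrite sqr_enorm sum3 !normal_vecE (dot_normal _ _ QQ); congr (_ - _).
by rewrite mulrC.
Qed.

Lemma normal_vec_neq0 s : normal_vec s != 0.
Proof.
apply/eqP => n0; have := dot_normal Phi Psi QQ s; rewrite -!normal_vecE n0 !mxE !expr0n !addr0.
by move=> /esym/eqP; rewrite expf_eq0 /= (negbTE (area_el_neq0 _ _ _)).
Qed.

Lemma Gm_contact x y s : Gm 2 setT (contact x y s).
Proof. by split=> //=; rewrite tproj_mxE; exact: Grass_proj_normal (normal_vec_neq0 s). Qed.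

Lemma Gm_chart p : Gm 2 setT (chart p).
Proof. by rewrite /chart; case: ifP => _; exact: Gm_contact. Qed.

Lemma integrable_coefficient (K : set X) (A : X -> R) j i k :
  compact (K : set ('rV[R]_3 * 'M[R]_3)) -> measurable_fun setT (A : X -> line R) ->
  (forall p : R * R, 0 < p.1 -> A (contact_at p) =
     p.1^-1 * (tilt_tan i (p.2 / p.1) * tproj' j k (p.2 / p.1))) ->
  (surface_measure H Q).-integrable K (EFin \o A).
Proof.
move=> cK mA AE; have [M M0 KM] := compact_fst_bounded cK.
have mK := measurable_compact cK.
have [C C0 bC] : bounded_fun (fun s => (tilt_tan i s * tproj' j k s) * area_el Phi Psi s).
  apply: bounded_funM; last exact: bounded_area_el H.
  apply: bounded_outside; last by move=> s s1; rewrite (tproj'_outside H)// mulr0.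
  by move=> s; exact: (cvgM (@continuous_tilt_tan _ _ _ _ H Q i s) (@continuous_tproj' _ _ _ _ H Q j k s)).
apply: integrable_surface_measure => //.
apply: (@integrable_wedge R _ (2 * M) C) => //; first by rewrite mulr_gt0.
- apply: (@eq_measurable_fun _ _ _ _ _
    (fun p : coord_plane R => (\1_K (chart p) * (A (chart p))) * jac_fun (surface_x Phi Psi) (surface_y Phi) p)).
    move=> p _; rewrite /jac_fun /chart indicE; case: (ltP 0 (p.1 : R)) => p0 /=; last by rewrite mulr0.
    by case: (_ \in _) => /=; rewrite ?mul1r// !mul0r.
  have mc := measurable_chart H Q.
  apply: measurable_funM; last first.
    exact: (@measurable_jac_fun R (surface_x Phi Psi) (surface_y Phi)
      (measurable_slope_quot H false) (measurable_slope_quot H true)).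
  apply: measurable_funM; last exact: (measurableT_comp mA mc).
  exact: (measurableT_comp (measurable_indic mK) mc).
- by move=> p; case: (ltP 0 (p.1 : R)) => _ /=; [left|right].
- move=> p pM; case: ifP => // /andP[p0]; rewrite inE => /KM.
  have [hx hy] := lift_coord Psi QQ (p.1 : R) (p.2 : R) ((p.2 : R) / p.1).
  by rewrite leNgt /=; case: pM => h; rewrite -(ltr_pM2l (ltr0n R 2)) (lt_le_trans h).
move=> p p0; have s1 : (`|(p.2 : R) / p.1| < 1) = (`|p.2 : R| < p.1).
  by rewrite normrM normfV (gtr0_norm p0) ltr_pdivrMr// mul1r.
case: ifP => [_|_]; last by rewrite normr0 addr_ge0//; case: ifP => // _; rewrite divr_ge0// ltW.
rewrite AE// -mulrA; case: ifPn => yp; last first.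
  rewrite -s1 -leNgt in yp; rewrite (tproj'_outside H)// mulr0 mul0r mulr0 normr0.
  by rewrite addr0.
rewrite normrM normfV (gtr0_norm p0) mulrC -[leLHS]add0r lerD//.
by rewrite ler_wpM2r// invr_ge0 ltW.
Qed.

Lemma radon_surface : radon 2 setT (surface_measure H Q).
Proof.
split.
  rewrite push_measureE (_ : chart @^-1` _ = set0) ?measure0//.
  by apply/seteqP; split=> // p; have := Gm_chart p.
move=> K cK _; have [M M0 KM] := compact_fst_bounded cK.
have [C C0 bC] := bounded_area_el H.
pose B : set (coord_plane R) := [set` `[(- (2 * M)), 2 * M]] `*` [set` `[(- (2 * M)), 2 * M]].
have mB : measurable B by apply: measurableX; exact: measurable_itv.
have mc : measurable (chart @^-1` K).
  by rewrite -[X in measurable X]setTI; exact: (measurable_chart H Q measurableT (measurable_compact cK)).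
rewrite [surface_measure H Q K]push_measureE.
have -> : parameter_measure H (chart @^-1` K) = parameter_measure H (chart @^-1` K `&` @open_half_plane R).
  rewrite !density_measureE integral_mkcondr; apply: eq_integral => p _; rewrite patchE.
  by case: ifPn => //; rewrite notin_setE /open_half_plane /= /jac_fun => /negP/negbTE ->.
apply: (@le_lt_trans _ _ (C%:E * area B)%E); last first.
  rewrite areaX; [|exact: measurable_itv|exact: measurable_itv].
  have fin : (leb [set` `[(- (2 * M))%R, (2 * M)%R]] < +oo)%E.
    by rewrite [ltLHS]lebesgue_measure_itv /=; case: ifP => _; rewrite ?ltry// -EFinB ltry.
  by rewrite lte_mul_pinfty// ?lee_fin// lte_mul_pinfty// ge0_fin_numE.
apply: le_trans (@graph_measure_le R (surface_x Phi Psi) (surface_y Phi)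
  (measurable_slope_quot H false) (measurable_slope_quot H true) B C mB C0 _); last first.
  move=> p _; rewrite /jac_fun; case: ifP => // p0.
  exact: (le_trans (ler_norm _) (bC ((p.2 : R) / p.1))).
apply: le_measure; rewrite ?inE//; first by apply: measurableI => //; exact: measurable_open_half_plane.
move=> p [/= Kp]; rewrite /open_half_plane /= => p0.
have := KM _ Kp; rewrite /chart p0 /=.
have [hx hy] := lift_coord Psi QQ (p.1 : R) (p.2 : R) ((p.2 : R) / p.1) => h.
have h' : 2 * `|lift Psi Q p.1 p.2 ((p.2 : R) / p.1)| <= 2 * M by rewrite ler_pM2l.
by split; rewrite /= in_itv/= -ler_norml; [exact: le_trans hx h'|exact: le_trans hy h'].
Qed.

End SurfaceRadon.


Lemma measurable_continuous_borel (R : realType) (T : normedModType R) (f : R -> T) :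
  continuous f -> measurable_fun setT (f : line R -> borel T).
Proof.
move=> /continuousP cf; apply: (@measurability _ _ _ (borel T) setT _ (@open T)) => //.
by move=> _ [V oV <-]; rewrite setTI; apply: open_measurable; exact: cf.
Qed.

Section Edge.
Context {R : realType} (Phi Phi' Psi : R -> R) (H : profile Phi Phi' Psi).
Variable Q : 'M[R]_3.
Hypothesis QQ : isometry_mx Q.
Notation X := (borel ('rV[R]_3 * 'M[R]_3)%type).
Notation tproj' := (tproj' Phi Phi' Psi Q).
Notation tilt_tan := (tilt_tan Phi Psi Q).
Notation weight := (weight Phi Psi Q).
Notation contact := (contact Phi Psi Q).
Notation contact_at := (contact_at Phi Psi Q).

Definition edge (t : line R) : X := contact 0 t (end_slope t).

Definition edge_weight (a : 'I_3) (t : line R) : line R :=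
  if 0 < (t : R) then weight false a 1 else if (t : R) < 0 then weight false a (-1) else 0.

Let continuous_contact_cst (s : R) : continuous (fun t => contact 0 t s).
Proof.
move=> t; apply: (@cvg_contact _ _ _ _ H Q R (nbhs t) _ (cst 0) id (cst s)).
- exact: cvg_cst.
- exact: cvg_id.
- exact: cvg_cst.
Qed.

Lemma measurable_edge : measurable_fun setT edge.
Proof.
rewrite (_ : edge = fun t => if 0 < (t : R) then contact 0 t 1 else contact 0 t (-1)).
  apply: measurable_fun_ifT.
  - by apply: measurable_fun_ltr; [exact: measurable_cst|exact: measurable_id].
  - exact: (@measurable_continuous_borel R ('rV[R]_3 * 'M[R]_3)%type (fun t => contact 0 t 1) (@continuous_contact_cst 1)).
  - exact: (@measurable_continuous_borel R ('rV[R]_3 * 'M[R]_3)%type (fun t => contact 0 t (-1)) (@continuous_contact_cst (-1))).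
by apply/funext => t; rewrite /edge /end_slope; case: ifP.
Qed.

Lemma measurable_edge_weight a : measurable_fun setT (edge_weight a).
Proof.
apply: measurable_fun_ifT; [|exact: measurable_cst|].
  by apply: measurable_fun_ltr; [exact: measurable_cst|exact: measurable_id].
apply: measurable_fun_ifT; [|exact: measurable_cst|exact: measurable_cst].
by apply: measurable_fun_ltr; [exact: measurable_id|exact: measurable_cst].
Qed.

(** The positive part of the edge weight for [sg = 1], its negative part for [sg = -1]. *)
Definition edge_part (sg : R) (a : 'I_3) (t : line R) : line R := Num.max (sg * edge_weight a t) 0.

Lemma edge_part_ge0 sg a t : 0 <= (edge_part sg a t : R).
Proof. by rewrite le_max lexx orbT. Qed.

Lemma measurable_edge_part sg a : measurable_fun setT (edge_part sg a).
Proof.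
apply: measurable_maxr; last exact: measurable_cst.
by apply: measurable_funM; [exact: measurable_cst|exact: measurable_edge_weight].
Qed.

Lemma edge_partB a t : (edge_part 1 a t : R) - edge_part (-1) a t = edge_weight a t.
Proof.
rewrite /edge_part mul1r mulN1r; have [h|h] := leP (0 : R) (edge_weight a t).
  by rewrite (max_idPr _) ?oppr_le0// subr0.
by rewrite (max_idPl _) ?oppr_ge0 ?ltW// sub0r opprK.
Qed.

Lemma edge_part_bounded sg a : bounded_fun (edge_part sg a : line R -> R).
Proof.
exists (`|sg| * (`|weight false a 1| + `|weight false a (-1)|)).
  by rewrite mulr_ge0// addr_ge0.
move=> t; rewrite ger0_norm ?edge_part_ge0// ge_max; apply/andP; split; last first.
  by rewrite mulr_ge0// addr_ge0.
apply: (le_trans (ler_norm _)); rewrite normrM ler_wpM2l// /edge_weight.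
by case: ifP => _; [|case: ifP => _]; rewrite ?lerDl ?lerDr ?normr0// addr_ge0.
Qed.

Definition edge_line_measure (sg : R) (a : 'I_3) : {measure set (line R) -> \bar R} :=
  density_measure leb (measurable_edge_part sg a) (edge_part_ge0 sg a).

Definition edge_measure (sg : R) (a : 'I_3) : {measure set X -> \bar R} :=
  push_measure measurable_edge (edge_line_measure sg a).

Lemma Gm_edge t : Gm 2 setT (edge t).
Proof. exact: Gm_contact. Qed.

Lemma edge_line_le sg a (M : R) : exists2 C : R, 0 <= C & forall B : set (line R), measurable B ->
  (forall t, B t -> `|t : R| <= M) -> (edge_line_measure sg a B <= C%:E)%E.
Proof.
have [C C0 bC] := edge_part_bounded sg a.
exists (C * (2 * `|M|)); first by rewrite mulr_ge0// mulr_ge0.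
move=> B mB BM; rewrite -ge0_integral_interval_cst//.
have sub : B `<=` [set` `[(- `|M|), `|M|]].
  by move=> t /BM h; rewrite /= in_itv/= -ler_norml (le_trans h)// ler_norm.
apply: (@le_trans _ _ (\int[leb]_(x in B) C%:E)%E).
  rewrite density_measureE; apply: ge0_le_integral => //.
  - by move=> t _; rewrite lee_fin edge_part_ge0.
  - by apply/measurable_EFinP; apply: measurable_funTS; exact: measurable_edge_part.
  - by move=> t _; rewrite lee_fin (le_trans (ler_norm _)).
apply: ge0_subset_integral => //.
Qed.

Lemma radon_edge sg a : radon 2 setT (edge_measure sg a).
Proof.
split.
  rewrite push_measureE (_ : edge @^-1` _ = set0) ?measure0//.
  by apply/seteqP; split=> // t; have := Gm_edge t.
move=> K cK _; have [M M0 KM] := compact_fst_bounded cK.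
have [C C0 bC] := edge_line_le sg a (2 * M).
rewrite push_measureE; apply: (@le_lt_trans _ _ C%:E); last exact: ltry.
apply: bC.
  by rewrite -[X in measurable X]setTI; exact: (measurable_edge measurableT (measurable_compact cK)).
move=> t /KM h; have [_] := lift_coord Psi QQ 0 (t : R) (end_slope t).
by move=> /le_trans; apply; rewrite ler_pM2l.
Qed.

Variables (U : set 'rV[R]_3) (phi : 'rV[R]_3 * 'M[R]_3 -> R).
Hypothesis phi_test : test_function U phi.

Let C1phi : C1 phi. Proof. by case: phi_test. Qed.

Lemma measurable_test : measurable_fun setT (phi : X -> line R).
Proof.
apply: (@measurable_borel_continuous R ('rV[R]_3 * 'M[R]_3)%type) => z.
by apply: differentiable_continuous; case: C1phi.
Qed.

Lemma measurable_test_derivative v :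
  measurable_fun setT ((fun z => 'D_v phi z) : X -> line R).
Proof.
apply: (@measurable_borel_continuous R ('rV[R]_3 * 'M[R]_3)%type (fun z => 'D_v phi z)).
by case: C1phi => _; apply.
Qed.

Let measurable_phi_edge : measurable_fun setT (fun t : line R => phi (edge t) : line R).
Proof. exact: (measurableT_comp measurable_test measurable_edge). Qed.

Lemma integrable_edge sg a :
  (@leb R).-integrable setT (fun t => (phi (edge t) * edge_part sg a t)%:E).
Proof.
have [M M0 box] := divergence_box Phi Psi QQ phi_test.
have [C C0 bC] := edge_part_bounded sg a.
have [[D D0 bD] _] := test_function_bounded phi_test.
apply/integrableP; split.
  apply/measurable_EFinP; apply: measurable_funM; first exact: measurable_phi_edge.
  exact: measurable_edge_part.
apply: (@le_lt_trans _ _ (\int[lebesgue_measure]_(x in `[(- M)%R, M]) (D * C)%:E)%E); last first.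
  by rewrite (ge0_integral_interval_cst (ltW M0) (mulr_ge0 D0 C0)) ltry.
rewrite [leRHS]integral_mkcond; apply: ge0_le_integral => //.
- apply: measurableT_comp => //; apply/measurable_EFinP.
  by apply: measurable_funM; [exact: measurable_phi_edge|exact: measurable_edge_part].
- by apply/(measurable_restrictT _ _).1.
move=> t _; rewrite patchE; case: ifPn.
  by move=> _; rewrite lee_fin normrM ler_pM.
rewrite notin_setE /= in_itv/= -ler_norml => /negP; rewrite -ltNge => tM.
by rewrite (nbhs_singleton (box _ _ _ (or_intror tM))) mul0r /= normr0.
Qed.

Lemma integral_edge sg a : (\int[edge_measure sg a]_(z in Gm 2 setT) (phi z)%:E =
  \int[leb]_t (phi (edge t) * edge_part sg a t)%:E)%E.
Proof.
rewrite integral_push_measure//; [|exact: measurable_Gm|exact: Gm_edge|]; last first.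
  by apply/measurable_EFinP; exact: measurable_test.
by rewrite (@integral_density _ _ _ _ _ _ _ (fun t => phi (edge t))).
Qed.

Lemma integrable_edge_measure sg a :
  (edge_measure sg a).-integrable (Gm 2 setT : set X) (EFin \o phi).
Proof.
apply/integrableP; split; first by apply/measurable_EFinP; apply: measurable_funTS; exact: measurable_test.
rewrite integral_push_measure; [|exact: measurable_Gm|exact: Gm_edge|]; last first.
  by apply: measurableT_comp => //; apply/measurable_EFinP; exact: measurable_test.
rewrite ge0_integral_density//; last first.
  by apply: measurableT_comp => //; apply/measurable_EFinP; exact: measurable_phi_edge.
have /integrableP[_] := integrable_edge sg a; congr (_ < _)%E.
apply: eq_integral => t _; rewrite /= normrM EFinM; congr (_ * _)%E.
by rewrite ger0_norm ?edge_part_ge0.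
Qed.

(** The first variation identity: integrate the divergence of the flux, along
    [y] for the second component and along [x] for the first one. *)
Lemma integral_divergence a :
  (\int[area]_p (divergence Phi Phi' Psi Q phi false a p)%:E =
   \int[leb]_t (- (phi (edge t) * edge_weight a t))%:E)%E /\
  (\int[area]_p (divergence Phi Phi' Psi Q phi true a p)%:E = 0)%E.
Proof.
have ie l := integrable_divergence H QQ a phi_test l.
split; last first.
  rewrite -(integral12_prod_meas1 (ie true)); apply: integral0_eq => x _.
  exact: (integral_divergence_y H QQ a phi_test).
rewrite -(integral21_prod_meas1 (ie false)).
have mb : measurable_fun setT (fun t : line R => - (phi (edge t) * edge_weight a t) : line R).
  apply: measurableT_comp => //; apply: measurable_funM; first exact: measurable_phi_edge.
  exact: measurable_edge_weight.
have mD : measurable ([set~ 0] : set (line R)) by apply: measurableC; exact: measurable_set1.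
rewrite -[LHS](@integral_setD1 _ _ 0); last 2 first.
- by rewrite setTD.
- by apply: measurable_funTS; exact: (measurable_fubini_G (ie false)).
rewrite -[RHS](@integral_setD1 _ _ 0); last 2 first.
- by rewrite setTD.
- by apply/measurable_EFinP; exact: measurable_funTS.
apply: eq_integral => t; rewrite inE => -[_ /= t0].
have {}t0 : (t : R) != 0 by apply/eqP.
rewrite /fubini_G (integral_divergence_x H QQ a phi_test t0); congr (- _)%:E.
rewrite /edge /edge_weight /end_slope; congr (_ * _); case: ifPn => // tn.
by rewrite ifT// lt_neqAle t0 leNgt.
Qed.

Section Equation.
Variables (a : 'I_3) (A : 'I_3 -> 'I_3 -> 'I_3 -> X -> R).
Hypothesis mA : forall i j k, measurable_fun setT (A i j k : X -> line R).
Hypothesis AE : forall (p : R * R) i j k, 0 < p.1 ->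
  A i j k (contact_at p) = p.1^-1 * (tilt_tan i (p.2 / p.1) * tproj' j k (p.2 / p.1)).

Definition curvature_term (z : X) : R :=
  \sum_j z.2 a j * Dx j phi z + \sum_j \sum_k DP j k phi z * A a j k z
    + \sum_j phi z * A j a j z.

Lemma measurable_curvature_term : measurable_fun setT (curvature_term : X -> line R).
Proof.
apply: measurable_funD; last first.
  by apply: measurable_sum => j; apply: measurable_funM; [exact: measurable_test|exact: mA].
apply: measurable_funD; apply: measurable_sum => j.
  by apply: measurable_funM; [exact: measurable_entry|exact: measurable_test_derivative].
by apply: measurable_sum => k; apply: measurable_funM; [exact: measurable_test_derivative|exact: mA].
Qed.

Let termE (p : coord_plane R) : (if 0 < (p.1 : R) then
      curvature_term (contact_at p) * area_el Phi Psi (p.2 / p.1) else 0) =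
  divergence Phi Phi' Psi Q phi false a p + divergence Phi Phi' Psi Q phi true a p.
Proof.
rewrite /divergence; case: ifP => p0; last by rewrite addr0.
apply: (curvature_integrand QQ phi a (A := fun i j k => A i j k (contact_at p)) p0) => i j k.
exact: AE.
Qed.

Lemma integrable_curvature_term :
  (surface_measure H Q).-integrable (Gm 2 setT : set X) (EFin \o curvature_term).
Proof.
apply: integrable_surface_measure.
- exact: measurable_Gm.
- exact: measurable_curvature_term.
have ie l := integrable_divergence H QQ a phi_test l.
apply: eq_integrable (integrableD _ (ie false) (ie true)) => // p _.
rewrite /= -EFinD -termE; congr EFin; case: (ltP 0 (p.1 : R)) => p0 //=.
by rewrite ifT// inE; exact: Gm_contact.
Qed.

Lemma curvature_equation :
  \int[surface_measure H Q]_(z in Gm 2 setT) curvature_term z =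
  - (\int[edge_measure 1 a]_(z in Gm 2 setT) phi z
     - \int[edge_measure (-1) a]_(z in Gm 2 setT) phi z).
Proof.
have ie l := integrable_divergence H QQ a phi_test l.
have [i1 i2] := integral_divergence a.
rewrite /Rintegral !integral_edge integral_surface_measure; last 3 first.
- exact: measurable_Gm.
- exact: Gm_chart.
- exact: measurable_curvature_term.
rewrite (eq_integral (fun p => (divergence Phi Phi' Psi Q phi false a p)%:E +
  (divergence Phi Phi' Psi Q phi true a p)%:E)%E); last first.
  by move=> p _; rewrite termE EFinD.
rewrite integralD//; [|exact: ie|exact: ie].
rewrite i1 i2 adde0.
have e1 := integrable_edge 1 a; have e2 := integrable_edge (-1) a.
rewrite opprB -fineB; [|exact: integrable_fin_num|exact: integrable_fin_num].
rewrite -integralB//; congr fine; apply: eq_integral => t _.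
by rewrite /= -EFinB -mulrBr -(edge_partB a t) -mulrN opprB.
Qed.

End Equation.
End Edge.


Section FiniteSums.
Context d (T : measurableType d) (R : realType).
Variables (m_ : nat -> {measure set T -> \bar R}) (N : nat).

Lemma integrable_msum (D : set T) (f : T -> \bar R) : measurable D -> measurable_fun D f ->
  (forall n : 'I_N, (m_ n).-integrable D f) -> (msum m_ N).-integrable D f.
Proof.
move=> mD mf fi; apply/integrableP; split => //.
rewrite ge0_integral_measure_sum//; last exact: measurableT_comp.
by apply: lte_sum_pinfty => n _; have /integrableP[] := fi n.
Qed.

Lemma Rintegral_msum (D : set T) (f : T -> R) : measurable D ->
  measurable_fun D f -> (forall n : 'I_N, (m_ n).-integrable D (EFin \o f)) ->
  \int[msum m_ N]_(x in D) f x = \sum_(n < N) \int[m_ n]_(x in D) f x.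
Proof.
move=> mD mf fi; have mE : measurable_fun D (EFin \o f) by exact/measurable_EFinP.
rewrite /Rintegral integralE !ge0_integral_measure_sum//; last 2 first.
- exact: measurable_funeneg.
- exact: measurable_funepos.
have finp (n : 'I_N) : (\int[m_ n]_(x in D) (EFin \o f)^\+ x \is a fin_num)%E.
  exact: integrable_pos_fin_num.
have finn (n : 'I_N) : (\int[m_ n]_(x in D) (EFin \o f)^\- x \is a fin_num)%E.
  exact: integrable_neg_fin_num.
under eq_bigr => n _ do rewrite -(fineK (finp n)).
under [X in (_ - X)%E]eq_bigr => n _ do rewrite -(fineK (finn n)).
rewrite !sumEFin -EFinB /= -sumrB; apply: eq_bigr => n _.
by rewrite [in RHS]integralE (fineB (finp n) (finn n)).
Qed.

End FiniteSums.

Section Family.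
Context {R : realType} (Phi Phi' Psi : R -> R) (H : profile Phi Phi' Psi).
Variables (N : nat) (Q : nat -> 'M[R]_3).
Notation X := (borel ('rV[R]_3 * 'M[R]_3)%type).
Hypothesis QQ : forall n, isometry_mx (Q n).
Hypothesis disjoint_wedges : forall n m : 'I_N, n != m ->
  forall z : X, wedge (Q n) z -> ~ wedge (Q m) z.

Definition family_curv (i j k : 'I_3) (z : X) : R := \sum_(n < N) curv Phi Phi' Psi (Q n) i j k z.

Lemma measurable_family_curv i j k : measurable_fun setT (family_curv i j k : X -> line R).
Proof. by apply: measurable_sum => n; exact: measurable_curv H (Q n) i j k. Qed.

Lemma family_curv_contact (n : 'I_N) (p : R * R) i j k : 0 < p.1 ->
  family_curv i j k (contact_at Phi Psi (Q n) p) =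
  p.1^-1 * (tilt_tan Phi Psi (Q n) i (p.2 / p.1) * tproj' Phi Phi' Psi (Q n) j k (p.2 / p.1)).
Proof.
move=> p0; rewrite /family_curv (bigD1 n)//= big1 ?addr0.
  exact: (curv_contact H (QQ n) i j k p.2 p0).
move=> m mn; apply: curv_outside; apply: (disjoint_wedges (n := n)); first by rewrite eq_sym.
exact: (wedge_contact H (QQ n) p.2 p0).
Qed.

Lemma curvature_varifold_family (V : set X -> \bar R) (dV : 'I_3 -> set X -> R) :
  (forall B : set X, measurable B -> V B = (\sum_(n < N) surface_measure H (Q n) B)%E) ->
  (forall a (B : set X), measurable B -> relatively_compact 2 [set: 'rV[R]_3] B ->
     dV a B = \sum_(n < N) (fine (edge_measure H (Q n) 1 a B) - fine (edge_measure H (Q n) (-1) a B))) ->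
  curvature_varifold 2 [set: 'rV[R]_3] V dV.
Proof.
move=> VE dVE; exists (msum (fun n => surface_measure H (Q n)) N); split.
- split.
    by rewrite /= /msum big1// => n _; have [] := radon_surface H (QQ n).
  move=> K cK KG; apply: lte_sum_pinfty => n _.
  by have [_] := radon_surface H (QQ n); apply.
- by move=> B mB; rewrite VE.
exists family_curv; split.
  move=> i j k K cK _; apply: integrable_msum.
  - exact: measurable_compact.
  - by apply/measurable_EFinP; apply: measurable_funTS; exact: measurable_family_curv.
  move=> n; apply: (integrable_coefficient H (QQ n) (j := j) (i := i) (k := k)) => //.
    exact: measurable_family_curv.
  by move=> p p0; exact: family_curv_contact.
move=> a; exists (msum (fun n => edge_measure H (Q n) 1 a) N), (msum (fun n => edge_measure H (Q n) (-1) a) N).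
have radon_sum sg : radon 2 [set: 'rV[R]_3] (msum (fun n => edge_measure H (Q n) sg a) N).
  split; first by rewrite /= /msum big1// => n _; have [] := radon_edge H (QQ n) sg a.
  move=> K cK KG; apply: lte_sum_pinfty => n _.
  by have [_] := radon_edge H (QQ n) sg a; apply.
split.
  split=> // B mB rB; have [K [cK KG BK]] := rB; rewrite dVE//.
  have fin sg (n : 'I_N) : (edge_measure H (Q n) sg a B \is a fin_num)%E.
    rewrite ge0_fin_numE//; apply: (@le_lt_trans _ _ (edge_measure H (Q n) sg a K)).
      by apply: le_measure; rewrite ?inE//; exact: measurable_compact.
    by have [_] := radon_edge H (QQ n) sg a; apply.
  have fine_sum sg : fine (msum (fun n => edge_measure H (Q n) sg a) N B) =
      \sum_(n < N) fine (edge_measure H (Q n) sg a B).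
    by rewrite sum_fine// => n _; exact: fin.
  by rewrite !fine_sum -sumrB.
move=> phi phi_test.
have mphi := measurable_test phi_test.
rewrite !Rintegral_msum.
- rewrite -sumrB -sumrN; apply: eq_bigr => n _.
  apply: (curvature_equation H (QQ n) phi_test a measurable_family_curv) => p i j k p0.
  exact: family_curv_contact.
- exact: measurable_Gm.
- exact: measurable_funTS.
- by move=> n; exact: (integrable_edge_measure H (QQ n) phi_test).
- exact: measurable_Gm.
- exact: measurable_funTS.
- by move=> n; exact: (integrable_edge_measure H (QQ n) phi_test).
- exact: measurable_Gm.
- apply: measurable_funTS; exact: (measurable_curvature_term phi_test a measurable_family_curv).
- move=> n; apply: (integrable_curvature_term H (QQ n) phi_test a measurable_family_curv) => p i j k p0.
  exact: family_curv_contact.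
Qed.

End Family.


Section Sheet.
Context {R : realType} (Phi Phi' Psi : R -> R) (H : profile Phi Phi' Psi).
Variable Q : 'M[R]_3.
Hypothesis QQ : isometry_mx Q.
Notation X := (borel ('rV[R]_3 * 'M[R]_3)%type).
Notation weight := (weight Phi Psi Q).
Notation contact := (contact Phi Psi Q).
Notation contact_at := (contact_at Phi Psi Q).
Notation chart := (chart Phi Psi Q).

Definition sheet : set 'rV[R]_3 := graph_map (surface Psi) Q @` @open_half_plane R.

Let tan_sheet (p : coord_plane R) : 0 < (p.1 : R) ->
  (graph_map (surface Psi) Q p, proj_onto
     (approx_tangent_cone 2 (restriction (hausdorff 2) sheet) (graph_map (surface Psi) Q p))) =
  contact_at p :> 'rV[R]_3 * 'M[R]_3.
Proof.
move=> p0; rewrite /sheet.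
rewrite (proj_approx_tangent_cone_graph (is_derive_surface_x H) (is_derive_surface_y H)
  (fun x y _ => slope_x_le2 H (y / x)) (fun x y _ => slope_y_le2 H (y / x))
  (surface_grad_lip H) (measurable_slope_quot H false) (measurable_slope_quot H true) QQ p0).
by rewrite /contact_at /contact (tproj_mxE _ _ QQ).
Qed.

Lemma upsilon_sheet (B : set X) : measurable B -> upsilon 2 sheet B = surface_measure H Q B.
Proof.
move=> mB; have mc : measurable (chart @^-1` B).
  by rewrite -[X in measurable X]setTI; exact: (measurable_chart H Q measurableT mB).
have mo := @measurable_open_half_plane R.
rewrite [RHS]push_measureE.
have -> : parameter_measure H (chart @^-1` B) = parameter_measure H (chart @^-1` B `&` @open_half_plane R).
  rewrite !density_measureE integral_mkcondr; apply: eq_integral => p _; rewrite patchE.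
  by case: ifPn => //; rewrite notin_setE /open_half_plane /= /jac_fun => /negP/negbTE ->.
rewrite -(image_hausdorff_graph (graph_map_graph (surface Psi) QQ) (is_derive_surface_x H) (is_derive_surface_y H)
  (fun x y _ => slope_x_le2 H (y / x)) (fun x y _ => slope_y_le2 H (y / x))
  (surface_grad_lip H) (measurable_slope_quot H false) (measurable_slope_quot H true)); last 2 first.
- exact: measurableI.
- by move=> p [].
rewrite /upsilon /pushforward {1}/restriction /image_hausdorff; congr (hausdorff 2 _).
apply/seteqP; split=> x /=.
  move=> [Bx [p p0 px]]; exists p => //; split=> //.
  by move: Bx; rewrite -px (tan_sheet p0) /= /chart ifT.
move=> [p [Bp p0] <-]; split; last by exists p.
by rewrite (tan_sheet p0); move: Bp; rewrite /= /chart ifT.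
Qed.

End Sheet.

Section EdgeBoundary.
Context {R : realType} (Phi Phi' Psi : R -> R) (H : profile Phi Phi' Psi).
Variables (Q : 'M[R]_3) (i : nat).
Hypothesis QQ : isometry_mx Q.
Hypothesis row1 : forall k, Q 1 k = (k == 1)%:R.
Hypothesis nuE : forall s, nu R s i = vec3 (Num.sqrt 3 / 2) 0 (Defs.half R s) *m Q.
Notation X := (borel ('rV[R]_3 * 'M[R]_3)%type).
Notation weight := (weight Phi Psi Q).
Notation edge := (edge Phi Psi Q).

Definition sgb (s : bool) : R := if s then 1 else -1.

Let slope_end s : slope Phi Psi true (sgb s) = 0 /\ slope Phi Psi false (sgb s) = sgb s * (csl / 2).
Proof.
have s1 : 1 <= `|sgb s| by rewrite /sgb; case: s; rewrite ?normrN normr1.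
have [h1 h2] := slope_outside H s1; split=> //; rewrite /slope h2 /sgb.
case: s {s1 h1 h2}; rewrite ?ltr01 ?mul1r// ifF ?mulN1r//.
by apply/negbTE; rewrite -leNgt; lra.
Qed.

Let sgb2 s : sgb s ^+ 2 = 1.
Proof. by rewrite /sgb; case: s; rewrite ?sqrrN expr1n. Qed.

Let area_end s : area_el Phi Psi (sgb s) = csl.
Proof.
have [h1 h2] := slope_end s; apply/eqP.
rewrite -(eqrXn2 (_ : 0 < 2)%N) ?(ltW csl_gt0) ?(ltW (area_el_gt0 _ _ _))//.
by rewrite sqr_area_el /normal_sq h1 h2 exprMn sgb2 sqr_csl expr_div_n sqr_csl; apply/eqP; field.
Qed.

Let half_sgb s : Defs.half R s = sgb s / 2.
Proof. by rewrite /Defs.half /sgb; case: s => //; rewrite mulN1r mul1r. Qed.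

Let sqrt3_csl : Num.sqrt 3 * csl = 2 :> R.
Proof. by rewrite mulrC /csl divfK// gt_eqF// sqrt3_gt0. Qed.

Lemma weight_end s j : weight false j (sgb s) = nu R s i 0 j.
Proof.
have [h1 h2] := slope_end s.
rewrite nuE mxE sum3 !vec3E half_sgb /weight /normal area_end h1 h2 /axis.
have c0 : csl != 0 :> R by rewrite gt_eqF// csl_gt0.
have -> : Num.sqrt 3 / 2 = 3 / 4 * csl :> R.
  have : Num.sqrt 3 * (Num.sqrt 3 * csl) = 3 * csl :> R by rewrite mulrA -expr2 sqr_sqrt3.
  by rewrite sqrt3_csl; lra.
have := sgb2 s; move: (sgb s) => u u2.
apply: (@etrans _ _ ((csl - u ^+ 2 * csl / 4) * Q 0 j + u / 2 * Q 2 j)); first by field.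
by rewrite u2; field.
Qed.

Let row1_mul (a b c : R) : vec3 a b c *m Q = vec3 a 0 c *m Q + vec3 0 b 0.
Proof.
apply/rowP => k; rewrite mxE [RHS]mxE [X in _ = X + _]mxE !sum3 !vec3E row1.
have -> : vec3 0 b 0 0 k = b * (k == 1)%:R.
  by rewrite mxE; case: k => [[|[|[|//]]]] ? /=; rewrite ?mulr0 ?mulr1.
ring.
Qed.

Lemma proj_plane s : proj_onto (@plane R s i) = tproj_mx Phi Psi Q (sgb s).
Proof.
rewrite (tproj_mxE _ _ QQ) -(proj_onto_normal (normal_vec_neq0 _ _ QQ _)); congr proj_onto.
have [h1 h2] := slope_end s; rewrite /normal_vec h1 h2.
have s3 := sqrt3_csl.
have u2 := sgb2 s; set u := sgb s in u2 *.
apply/seteqP; split=> v /=.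
  move=> [lam [mu ->]]; rewrite nuE trmx_mul mulmxA.
  have -> : lam *: (vec3 (Num.sqrt 3 / 2) 0 (Defs.half R s) *m Q) + mu *: vec3 0 1 0 =
      vec3 (lam * (Num.sqrt 3 / 2)) mu (lam * (u / 2)) *m Q.
    by rewrite [RHS]row1_mul half_sgb scalemxAl !vec3Z !mulr0 mulr1.
  rewrite -(mulmxA _ Q) QQ mulmx1; apply/rowP => k; rewrite !mxE sum3 !mxE /=.
  apply: (@etrans _ _ (lam / 4 * u * (2 - Num.sqrt 3 * csl))); first by field.
  by rewrite s3 subrr mulr0.
rewrite trmx_mul mulmxA => /rowP/(_ 0); rewrite mxE [RHS]mxE sum3 ![_^T _ _]mxE !vec3E => h.
set w := v *m Q^T in h; have vw : v = w *m Q by rewrite -mulmxA (isometry_mxV QQ) mulmx1.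
exists (w 0 0 * csl), (w 0 1).
have -> : v = vec3 (w 0 0) (w 0 1) (w 0 2) *m Q by rewrite {1}vw; congr (_ *m Q); apply: rv3P; rewrite !vec3E.
rewrite row1_mul nuE half_sgb scalemxAl !vec3Z !mulr0 mulr1 -/u; congr (_ *m Q + _).
apply: rv3P; rewrite !vec3E//; last by lra.
by rewrite mulrA -(mulrA (w 0 0)) (mulrC csl) s3 mulfK.
Qed.

Lemma edgeE (t : R) : edge t = (embed1 t, tproj_mx Phi Psi Q (end_slope t)).
Proof.
rewrite /edge /contact /lift mul0r mulr0; congr pair.
rewrite row1_mul (_ : vec3 0 0 0 = 0) ?mul0mx ?add0r//.
by apply: rv3P; rewrite ?vec3E mxE.
Qed.

Definition edge_ray (s : bool) (B : set X) : set (line R) :=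
  [set t | (if s then 0 < (t : R) else (t : R) < 0) /\ B (edge t)].

Lemma measurable_edge_ray s (B : set X) : measurable B -> measurable (edge_ray s B).
Proof.
move=> mB; rewrite (_ : edge_ray s B = [set` if s then `]0, +oo[ else `]-oo, (0 : R)[] `&` edge @^-1` B).
  apply: measurableI; first exact: measurable_itv.
  by rewrite -[X in measurable X]setTI; exact: (measurable_edge H Q measurableT mB).
by apply/seteqP; split=> t /=; case: s; rewrite /edge_ray /= in_itv/= ?andbT.
Qed.

Lemma pushforward_TanW s (B : set X) : measurable B ->
  pushforward (restriction (hausdorff 1) (@L R s)) (@TanW R i) B = leb (edge_ray s B).
Proof.
move=> mB; rewrite -(image_hausdorff_line (measurable_edge_ray s mB)).
rewrite /pushforward /restriction /image_hausdorff; congr (hausdorff 1 _).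
have sign_slope t : (if s then 0 < t else t < 0) -> (0 < t) = s /\ end_slope t = sgb s.
  rewrite /end_slope; case: s => h; first by rewrite h.
  by have -> : 0 < t = false by apply/negbTE; rewrite -leNgt ltW.
apply/seteqP; split=> x /=.
  move=> [Bx [x0 x2 x1]]; have [s1 s2] := sign_slope _ x1.
  have ex : embed1 (x 0 1) = x by apply: rv3P; rewrite ?vec3E.
  exists (x 0 1) => //; split=> //; rewrite edgeE s2 ex.
  by move: Bx; rewrite /TanW s1 proj_plane.
move=> [t [t0 Bt] <-]; have [s1 s2] := sign_slope _ t0.
split; last by split; rewrite vec3E.
by move: Bt; rewrite edgeE s2 /TanW vec3E s1 proj_plane.
Qed.

Lemma edge_measure_ray sg j (B : set X) : measurable B ->
  edge_measure H Q sg j B = ((Num.max (sg * nu R true i 0 j) 0)%:E * leb (edge_ray true B) +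
    (Num.max (sg * nu R false i 0 j) 0)%:E * leb (edge_ray false B))%E.
Proof.
move=> mB; rewrite push_measureE density_measureE.
have mr s := measurable_edge_ray s mB.
pose c s : R := Num.max (sg * nu R s i 0 j) 0.
have c0 s : 0 <= c s by rewrite le_max lexx orbT.
rewrite integral_mkcond.
rewrite (eq_integral (fun t => (c true)%:E * (\1_(edge_ray true B) t)%:E +
   (c false)%:E * (\1_(edge_ray false B) t)%:E)%E); last first.
  move=> t _; rewrite patchE !indicE.
  have mem s : (t \in edge_ray s B) = (if s then 0 < (t : R) else (t : R) < 0) && (t \in edge @^-1` B).
    by apply/idP/andP; rewrite !inE => -[].
  rewrite !mem; case: (t \in edge @^-1` B); last by rewrite !andbF !mule0 adde0.
  have e1 : weight false j 1 = nu R true i 0 j := weight_end true j.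
  have e2 : weight false j (-1) = nu R false i 0 j := weight_end false j.
  rewrite !andbT /edge_part /edge_weight e1 e2 /c.
  case: (ltgtP (t : R) 0) => _ /=; rewrite ?mulr0 ?maxxx ?mule0 ?mule1 ?adde0 ?add0e//.
have m1 s : measurable_fun setT (fun t => (\1_(edge_ray s B) t)%:E : \bar R).
  by apply/measurable_EFinP; exact: measurable_indic.
have mc s : measurable_fun setT (fun t => ((c s)%:E * (\1_(edge_ray s B) t)%:E)%E).
  by apply: emeasurable_funM => //; exact: m1.
have g0 s t : setT t -> (0 <= (c s)%:E * (\1_(edge_ray s B) t)%:E)%E.
  by move=> _; rewrite mule_ge0// lee_fin.
rewrite (ge0_integralD leb measurableT (g0 true) (mc true) (g0 false) (mc false)).
have i0 s t : setT t -> (0 <= (\1_(edge_ray s B) t)%:E :> \bar R)%E by rewrite lee_fin.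
rewrite (ge0_integralZl_EFin leb measurableT (i0 true) (m1 true) (c0 true)).
rewrite (ge0_integralZl_EFin leb measurableT (i0 false) (m1 false) (c0 false)).
by rewrite !integral_indic// !setIT.
Qed.

Lemma bdryW_edge j (B : set X) : measurable B -> relatively_compact 2 [set: 'rV[R]_3] B ->
  bdryW i j B = fine (edge_measure H Q 1 j B) - fine (edge_measure H Q (-1) j B).
Proof.
move=> mB [K [cK _ BK]]; have [M M0 KM] := compact_fst_bounded cK.
have fin s : (leb (edge_ray s B) \is a fin_num)%E.
  rewrite ge0_fin_numE//; apply: (@le_lt_trans _ _ (leb [set` `[(- (2 * M))%R, (2 * M)%R]])); last first.
    by rewrite [ltLHS]lebesgue_measure_itv /=; case: ifP => _; rewrite ?ltry// -EFinB ltry.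
  apply: le_measure; rewrite ?inE//; first exact: measurable_edge_ray.
  move=> t [_ /BK/KM h]; have [_] := lift_coord Psi QQ 0 (t : R) (end_slope t).
  by move=> /le_trans h'; rewrite /= in_itv/= -ler_norml h'// ler_pM2l.
have maxB (x : R) : Num.max (1 * x) 0 - Num.max (-1 * x) 0 = x.
  rewrite mul1r mulN1r; have [h|h] := leP 0 x; first by rewrite (max_idPr _) ?oppr_le0// subr0.
  by rewrite (max_idPl _) ?oppr_ge0 ?ltW// sub0r opprK.
rewrite /bdryW !edge_measure_ray// big_bool !pushforward_TanW//.
have [l1 ->] : exists l, leb (edge_ray true B) = l%:E by exists (fine (leb (edge_ray true B))); rewrite fineK.
have [l2 ->] : exists l, leb (edge_ray false B) = l%:E by exists (fine (leb (edge_ray false B))); rewrite fineK.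
rewrite /=.
have := maxB (nu R true i 0 j); have := maxB (nu R false i 0 j).
move: (Num.max (1 * nu R true i 0 j) 0) (Num.max (-1 * nu R true i 0 j) 0).
move: (Num.max (1 * nu R false i 0 j) 0) (Num.max (-1 * nu R false i 0 j) 0) => x y u v <- <-.
ring.
Qed.

End EdgeBoundary.


Section SixSheets.
Context {R : realType}.

Definition rows3 (u v w : 'rV[R]_3) : 'M[R]_3 := \matrix_(i < 3) nth 0 [:: u; v; w] i.

Lemma mul_rows3 (a b c : R) u v w : vec3 a b c *m rows3 u v w = a *: u + b *: v + c *: w.
Proof. by apply/rowP => j; rewrite mxE sum3 !vec3E !mxE. Qed.

Definition rot_mx : 'M[R]_3 :=
  rows3 (vec3 (- (1 / 2)) 0 (Num.sqrt 3 / 2)) (vec3 0 1 0) (vec3 (- (Num.sqrt 3 / 2)) 0 (- (1 / 2))).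

Definition flip_mx : 'M[R]_3 := rows3 (vec3 1 0 0) (vec3 0 1 0) (vec3 0 0 (-1)).

Lemma vec3_eta (x : 'rV[R]_3) : x = vec3 (x 0 0) (x 0 1) (x 0 2).
Proof. by apply: rv3P; rewrite vec3E. Qed.

Lemma mul_rot_mx (x : 'rV[R]_3) : x *m rot_mx = rotR x.
Proof.
rewrite [in LHS](vec3_eta x) mul_rows3 /rotR !vec3Z !vec3D; congr vec3; ring.
Qed.

Lemma mul_flip_mx (a b c : R) : vec3 a b c *m flip_mx = vec3 a b (- c).
Proof. by rewrite mul_rows3 !vec3Z !vec3D; congr vec3; ring. Qed.

Lemma isometry_rows3 u v w :
  (forall i j : 'I_3, \sum_k rows3 u v w i k * rows3 u v w j k = (i == j)%:R) ->
  isometry_mx (rows3 u v w).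
Proof.
move=> h; apply/matrixP => i j; rewrite mxE [RHS]mxE -h.
by apply: eq_bigr => k _; rewrite [_^T _ _]mxE.
Qed.

Lemma isometry_rot : isometry_mx rot_mx.
Proof.
have s3 := @sqr_sqrt3 R; rewrite expr2 in s3.
apply: isometry_rows3 => i j; rewrite sum3 !mxE.
case: i => [[|[|[|//]]]] ? /=; case: j => [[|[|[|//]]]] ? /=; rewrite ?mxE /=; try (by ring).
all: apply: (@etrans _ _ (1 / 4 + Num.sqrt 3 * Num.sqrt 3 / 4)); [by field|by rewrite s3; field].
Qed.

Lemma isometry_flip : isometry_mx flip_mx.
Proof.
apply: isometry_rows3 => i j; rewrite sum3 !mxE.
by case: i => [[|[|[|//]]]] ? /=; case: j => [[|[|[|//]]]] ? /=; rewrite ?mxE /=; ring.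
Qed.

(** The orthogonal matrix taking the graph of the height function to the i-th surface. *)
Fixpoint sheet_mx (i : nat) : 'M[R]_3 :=
  match i with
  | 0 | 1 => 1%:M
  | 2 => flip_mx
  | k.+2 => sheet_mx k *m rot_mx
  end.

Lemma sheet_mxSS k : (0 < k)%N -> sheet_mx k.+2 = sheet_mx k *m rot_mx.
Proof. by case: k. Qed.

Lemma sheet_ind (P : nat -> Prop) : P 1%N -> P 2%N ->
  (forall k, (0 < k)%N -> P k -> P k.+2) -> forall k, (0 < k)%N -> P k.
Proof.
move=> P1 P2 PS k k0; suff [] : P k /\ P k.+1 by [].
by elim: k k0 => // -[_ _|k IH _]; [split|have [//|h1 h2] := IH; split=> //; exact: PS].
Qed.

Lemma isometry_mul (Q Q' : 'M[R]_3) : isometry_mx Q -> isometry_mx Q' -> isometry_mx (Q *m Q').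
Proof.
by move=> QQ QQ'; rewrite /isometry_mx trmx_mul mulmxA -(mulmxA Q) QQ' mulmx1.
Qed.

Lemma isometry_sheet i : isometry_mx (sheet_mx i).
Proof.
have i1 : isometry_mx (1%:M : 'M[R]_3) by rewrite /isometry_mx trmx1 mulmx1.
case: i => // i; apply: (@sheet_ind (fun i => isometry_mx (sheet_mx i))) => //.
  exact: isometry_flip.
by move=> k k0 IH; rewrite sheet_mxSS//; apply: isometry_mul => //; exact: isometry_rot.
Qed.

Lemma sheet_row1 i k : (0 < i)%N -> sheet_mx i 1 k = (k == 1)%:R.
Proof.
have e1 (Q : 'M[R]_3) : (forall k, Q 1 k = (k == 1)%:R) <-> vec3 0 1 0 *m Q = vec3 0 1 0.
  split=> [h|/rowP h j].
    apply/rowP => j; rewrite mxE sum3 !vec3E h mul0r mul1r mul0r add0r addr0.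
    by rewrite mxE; case: j => [[|[|[|//]]]].
  have := h j; rewrite mxE sum3 !vec3E mul0r mul1r mul0r add0r addr0 => ->.
  by rewrite mxE; case: j {h} => [[|[|[|//]]]].
move=> i0; move: k; apply/e1; move: i i0.
apply: sheet_ind; first by rewrite mulmx1.
  by rewrite mul_flip_mx oppr0.
move=> j j0 IH; rewrite sheet_mxSS// mulmxA IH mul_rot_mx /rotR !vec3E.
by congr vec3; ring.
Qed.

Lemma nu_sheet s i : (0 < i)%N -> nu R s i = vec3 (Num.sqrt 3 / 2) 0 (Defs.half R s) *m sheet_mx i.
Proof.
move: i; apply: sheet_ind; first by rewrite mulmx1.
  by rewrite mul_flip_mx /=; congr vec3; case: s => //=; rewrite opprK.
move=> k k0 IH; rewrite sheet_mxSS// mulmxA -IH mul_rot_mx.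
by case: k k0 {IH}.
Qed.

Lemma Sigma_sheet Phi Phi' Psi i : profile Phi Phi' Psi -> (0 < i)%N ->
  Sigma Phi i = sheet Psi (sheet_mx i).
Proof.
move=> H; move: i; apply: sheet_ind.
- apply/seteqP; split=> y /=.
    by move=> [x1 [x2 [x10 ->]]]; exists (x1, x2) => //; rewrite /graph_map mulmx1 (height_surface H).
  move=> [p p0 <-]; exists p.1, p.2; split=> //.
  by rewrite /graph_map mulmx1 (height_surface H).
- have odd x y : surface Psi x (- y) = - surface Psi x y.
    by rewrite /surface mulNr (Psi_odd H) !mulrN.
  apply/seteqP; split=> y /=.
    move=> [_ [x1 [x2 [x10 ->]]] <-]; exists (x1, - x2) => //.
    by rewrite /graph_map mul_flip_mx /= odd opprK /reflr !vec3E (height_surface H).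
  move=> [p p0 <-]; exists (vec3 p.1 (- (p.2 : R)) (height Phi p.1 (- (p.2 : R)))).
    by exists p.1, (- (p.2 : R)).
  by rewrite /reflr !vec3E (height_surface H)// opprK odd /graph_map mul_flip_mx.
move=> k k0 IH; have -> : Sigma Phi k.+2 = (@rotR R) @` Sigma Phi k by case: k k0 {IH}.
rewrite IH sheet_mxSS// /sheet image_comp; congr (_ @` _); apply/funext => p /=.
by rewrite /graph_map mulmxA mul_rot_mx.
Qed.

Notation X := (borel ('rV[R]_3 * 'M[R]_3)%type).

Lemma wedge_rot (Q : 'M[R]_3) (z : X) : wedge (Q *m rot_mx) z ->
  wedge Q ((z.1 *m rot_mx^T, z.2) : X).
Proof.
have E i : coord Q i ((z.1 *m rot_mx^T, z.2) : X) = coord (Q *m rot_mx) i z.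
  have coordE (Q' : 'M[R]_3) (z' : X) : coord Q' i z' = (z'.1 *m Q'^T) 0 i.
    by rewrite mxE sum3 !mxE.
  by rewrite !coordE /= trmx_mul mulmxA.
by rewrite /wedge /= !E.
Qed.

(** In the coordinates [a = x_1] and [d = sqrt 3 * x_3] the wedges become the sectors
    obtained from [`|d| <= a] by the rotation of order three. *)
Lemma wedge_sector (b : bool) (n : nat) (z : X) (a := z.1 0 0) (d := Num.sqrt 3 * z.1 0 2) :
  (n < 3)%N -> wedge (sheet_mx (n.*2 + b).+1) z ->
  match n with
  | 0 => 0 < a /\ `|d| <= a
  | 1 => 0 < d - a /\ `|3 * a + d| <= d - a
  | _ => 0 < - (a + d) /\ `|3 * a - d| <= - (a + d)
  end.
Proof.
have s3 : 0 < Num.sqrt 3 :> R by exact: sqrt3_gt0.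
have s33 : Num.sqrt 3 * Num.sqrt 3 = 3 :> R by rewrite -expr2 sqr_sqrt3.
have base (z' : X) : wedge (sheet_mx b.+1) z' ->
    0 < z'.1 0 0 /\ `|Num.sqrt 3 * z'.1 0 2| <= z'.1 0 0.
  have E : coord (sheet_mx b.+1) 0 z' = z'.1 0 0 /\ `|coord (sheet_mx b.+1) 2 z'| = `|z'.1 0 2|.
    rewrite /coord; case: b => /=; rewrite !mxE /= ?mxE /= !(mulr0, mulr1, add0r, addr0)//.
    by rewrite mulrN1 normrN.
  by rewrite /wedge /= !E.1 E.2 ler_pdivlMr// normrM gtr0_norm// mulrC.
have rotT (x : 'rV[R]_3) : (x *m rot_mx^T) 0 0 = - (1 / 2) * x 0 0 + Num.sqrt 3 / 2 * x 0 2 /\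
    (x *m rot_mx^T) 0 2 = - (Num.sqrt 3 / 2) * x 0 0 - 1 / 2 * x 0 2.
  by split; rewrite mxE sum3 !mxE /= ?mxE /=; ring.
have step (z' : X) : let w := z'.1 *m rot_mx^T in
    w 0 0 = (Num.sqrt 3 * z'.1 0 2 - z'.1 0 0) / 2 /\
    Num.sqrt 3 * w 0 2 = - (3 * z'.1 0 0 + Num.sqrt 3 * z'.1 0 2) / 2.
  have [e0 e2] := rotT z'.1; rewrite /= e0 e2; split; first by field.
  by apply: (@etrans _ _ (- (Num.sqrt 3 * Num.sqrt 3 * z'.1 0 0 + Num.sqrt 3 * z'.1 0 2) / 2));
    [field|rewrite s33].
have half_norm (x y : R) : `|x / 2| <= y / 2 -> `|x| <= y.
  by rewrite normrM (gtr0_norm (_ : 0 < 2^-1))// ler_pM2r.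
case: n => [|[|[|//]]] _.
- exact: base.
- rewrite (_ : (1.*2 + b).+1 = b.+1.+2)%N ?sheet_mxSS; [|by []|by rewrite add2n].
  move=> /wedge_rot/base; have [/= -> ->] := step z; rewrite -/a -/d => -[h1 h2].
  by split; [lra|apply: half_norm; move: h2; rewrite mulNr normrN].
rewrite (_ : (2.*2 + b).+1 = b.+1.+4)%N; last by rewrite -addSn.
rewrite !sheet_mxSS// => /wedge_rot/wedge_rot/base.
have [/= -> ->] := step ((z.1 *m rot_mx^T, z.2) : X); have [/= -> ->] := step z.
rewrite -/a -/d => -[h1 h2]; split; first by lra.
apply: half_norm; move: h2; set u := (X in `|X| <= _); set v := (X in _ <= X) => h2.
have -> : (3 * a - d) / 2 = u by rewrite /u; field.
by have -> : - (a + d) / 2 = v by rewrite /v; field.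
Qed.

Lemma disjoint_sheet_wedges (b : bool) (n m : 'I_3) : n != m ->
  forall z : X, wedge (sheet_mx (n.*2 + b).+1) z -> ~ wedge (sheet_mx (m.*2 + b).+1) z.
Proof.
move=> nm z wn wm; have := wedge_sector (ltn_ord n) wn; have := wedge_sector (ltn_ord m) wm; move: nm {wn wm}.
case: n => [[|[|[|//]]]] ? /=; case: m => [[|[|[|//]]]] ? //= _; rewrite !ler_norml => -[h1 /andP[h2 h3]] [h4 /andP[h5 h6]]; lra.
Qed.

End SixSheets.

Section BoundaryOfSixSheets.
Context {R : realType} (Phi Phi' Psi : R -> R) (H : profile Phi Phi' Psi).
Notation X := (borel ('rV[R]_3 * 'M[R]_3)%type).
Notation sheet_mx := (@sheet_mx R).

Definition end_plane (i : nat) : 'M[R]_3 := tproj_mx Phi Psi (sheet_mx i) 1.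

Let r : R := csl / 2.

Let r_sqrt : Num.sqrt 3 = 3 * r.
Proof.
have s3 : Num.sqrt 3 != 0 :> R by rewrite gt_eqF// sqrt3_gt0.
apply: (mulfI s3); rewrite -expr2 sqr_sqrt3 /r /csl; by field.
Qed.

Let r_sqr : r * r = 1 / 3.
Proof. by have := @sqr_csl R; rewrite expr2 /r => h; lra. Qed.

Lemma normal_vec_sheet : let N i := normal_vec Phi Psi (sheet_mx i) 1 in
  [/\ N 1%N = vec3 (- r) 0 1, N 3 = vec3 (- r) 0 (-1), N 5 = vec3 (2 * r) 0 0 &
   [/\ N 2 = vec3 (- r) 0 (-1), N 4 = vec3 (2 * r) 0 0 & N 6 = vec3 (- r) 0 1]].
Proof.
have n1 : 1 <= `|1 : R| by rewrite normr1.
have [k0 h0] := slope_outside H n1; rewrite ltr01 in h0.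
have rot a c : vec3 a 0 c *m rot_mx = vec3 (- (1 / 2) * a - 3 * r / 2 * c) 0 (3 * r / 2 * a - 1 / 2 * c).
  by rewrite mul_rot_mx /rotR !vec3E r_sqrt.
have N1 : normal_vec Phi Psi (sheet_mx 1) 1 = vec3 (- r) 0 1.
  by rewrite /normal_vec mulmx1 /slope k0 h0 oppr0.
have N2 : normal_vec Phi Psi (sheet_mx 2) 1 = vec3 (- r) 0 (-1).
  by rewrite /normal_vec mul_flip_mx /slope k0 h0 oppr0.
have NS k : (0 < k)%N -> normal_vec Phi Psi (sheet_mx k.+2) 1 = normal_vec Phi Psi (sheet_mx k) 1 *m rot_mx.
  by move=> k0'; rewrite /normal_vec sheet_mxSS// mulmxA.
have r1 : vec3 (- r) 0 1 *m rot_mx = vec3 (- r) 0 (-1).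
  by rewrite rot; congr vec3; have := r_sqr; lra.
have r2 : vec3 (- r) 0 (-1) *m rot_mx = vec3 (2 * r) 0 0.
  by rewrite rot; congr vec3; have := r_sqr; lra.
have r3 : vec3 (2 * r) 0 0 *m rot_mx = vec3 (- r) 0 1.
  by rewrite rot; congr vec3; have := r_sqr; lra.
by move=> N; rewrite /N (NS 3 isT) (NS 4 isT) (NS 1%N isT) (NS 2 isT) N1 N2 r1 r2 r3.
Qed.

(** The entry in position (0, 2) distinguishes the three planes meeting along
    a half-line. *)
Lemma end_plane_neq (b : bool) (n : 'I_3) : n != 0 ->
  end_plane (n.*2 + b).+1 <> end_plane b.+1.
Proof.
have J0 : area_el Phi Psi 1 ^+ 2 != 0 by rewrite expf_neq0// area_el_neq0.
have key i j : end_plane i = end_plane j ->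
    normal_vec Phi Psi (sheet_mx i) 1 0 0 * normal_vec Phi Psi (sheet_mx i) 1 0 2 =
    normal_vec Phi Psi (sheet_mx j) 1 0 0 * normal_vec Phi Psi (sheet_mx j) 1 0 2.
  move=> /matrixP/(_ 0 2); rewrite !normal_vecE !mxE /tproj /= !sub0r => /oppr_inj.
  by move=> /(congr1 (fun x => x * area_el Phi Psi 1 ^+ 2)); rewrite !divfK.
have r0 : 0 < r by rewrite divr_gt0// csl_gt0.
have [N1 N3 N5 [N2 N4 N6]] := normal_vec_sheet.
move=> n0 /key; move: n0; case: b; case: n => [[|[|[|//]]]] ? //= _;
  rewrite ?N1 ?N2 ?N3 ?N4 ?N5 ?N6 !vec3E; lra.
Qed.

(** The segment of the half-line between 1 and 2, with the plane of the sheet [i]. *)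
Definition segment (i : nat) : set X :=
  (fun t : R => contact Phi Psi (sheet_mx i) 0 t 1) @` [set` `[(1 : R), 2]].

Lemma compact_segment i : compact (segment i : set ('rV[R]_3 * 'M[R]_3)).
Proof.
apply: continuous_compact; last exact: segment_compact.
apply: continuous_subspaceT => t.
by apply: (@cvg_contact _ _ _ _ H _ R (nbhs t) _ (cst 0) id (cst 1));
  [exact: cvg_cst|exact: cvg_id|exact: cvg_cst].
Qed.

Lemma relatively_compact_segment i : relatively_compact 2 [set: 'rV[R]_3] (segment i).
Proof.
exists (segment i); split=> //; first exact: compact_segment.
by move=> _ [t _ <-]; apply: Gm_contact; exact: isometry_sheet.
Qed.

Lemma leb_edge_ray_segment s i j : (0 < i)%N -> (0 < j)%N ->
  leb (edge_ray Phi Psi (sheet_mx i) s (segment j)) =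
  if s && `[< end_plane i = end_plane j >] then 1%E else 0%E.
Proof.
move=> i0 j0.
have E k t (u : R) : (0 < k)%N -> 0 < t -> edge Phi Psi (sheet_mx k) t = (embed1 t, end_plane k).
  by move=> k0 t0; rewrite (edgeE _ _ (fun l => sheet_row1 l k0)) /end_slope t0.
have C (t : R) : 0 < t -> contact Phi Psi (sheet_mx j) 0 t 1 = (embed1 t, end_plane j).
  by move=> t0; rewrite -(E j t 0)// /edge /end_slope t0.
case: s; last first.
  rewrite (_ : edge_ray _ _ _ _ _ = set0) ?measure0//; apply/seteqP; split=> // t [/= t0 [u]].
  rewrite /= in_itv/= => /andP[u1 _]; rewrite C; last by lra.
  rewrite (edgeE _ _ (fun l => sheet_row1 l i0)) => -[/rowP/(_ 1)].
  by rewrite !vec3E => ut _; lra.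
case: asboolP => [ij|ij] /=.
  rewrite (_ : edge_ray _ _ _ _ _ = [set` `[(1 : R), 2]]).
    apply: (etrans (lebesgue_measure_itv _)) => /=; rewrite lte_fin ifT; last by lra.
    by rewrite -EFinB; congr EFin; lra.
  apply/seteqP; split=> t /=.
    move=> [/= t0 [u /=]]; rewrite in_itv/= => u12; rewrite C; last by case/andP: u12; lra.
    by rewrite E// => -[/rowP/(_ 1)]; rewrite !vec3E in_itv/= => <-.
  move=> t12; have t0 : 0 < t by move: t12; rewrite in_itv/= => /andP[]; lra.
  by split=> //; exists t => //; rewrite C// E// ij.
rewrite (_ : edge_ray _ _ _ _ _ = set0) ?measure0//; apply/seteqP; split=> // t [/= t0 [u]].
rewrite /= in_itv/= => /andP[u1 _]; rewrite C; last by lra.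
by rewrite E// => -[_ /esym].
Qed.

Definition family_index (b : bool) (n : nat) : nat := (n.*2 + b).+1.

Definition family_boundary (b : bool) (j : 'I_3) (B : set X) : R :=
  \sum_(n < 3) bdryW (family_index b n) j B.

Lemma nonzero_family_boundary b : nonzero_boundary 2 [set: 'rV[R]_3] (family_boundary b).
Proof.
exists 0, (segment b.+1); split.
- exact: measurable_compact (@compact_segment _).
- exact: relatively_compact_segment.
have bd n : bdryW (family_index b n) 0 (segment b.+1) =
    nu R true (family_index b n) 0 0 * (if `[< end_plane (family_index b n) = end_plane b.+1 >] then 1 else 0).
  rewrite /bdryW big_bool.
  rewrite !(pushforward_TanW H (isometry_sheet _) (fun l => sheet_row1 l _) (fun s => nu_sheet s _))//;
    try exact: measurable_compact (@compact_segment _).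
  rewrite !leb_edge_ray_segment// /= mulr0 addr0; by case: asboolP.
rewrite /family_boundary (bigD1 0)//= big1 ?addr0.
  rewrite bd asboolT ?mulr1; last by case: (b).
  have -> : nu R true (family_index b 0) 0 0 = Num.sqrt 3 / 2 by case: (b); rewrite /= vec3E.
  by rewrite gt_eqF// divr_gt0// sqrt3_gt0.
move=> n n0; rewrite bd asboolF ?mulr0//; exact: end_plane_neq.
Qed.

Lemma curvature_varifold_W i : (0 < i)%N ->
  curvature_varifold 2 [set: 'rV[R]_3] (W Phi i) (@bdryW R i).
Proof.
move=> i0; apply: (@curvature_varifold_family R Phi Phi' Psi H 1 (fun _ => sheet_mx i)).
- by move=> _; exact: isometry_sheet.
- by move=> n m; rewrite !ord1 eqxx.
- move=> B mB; rewrite big_ord1 /W (Sigma_sheet H i0).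
  exact: (upsilon_sheet H (isometry_sheet i)).
move=> j B mB rB; rewrite big_ord1.
apply: (bdryW_edge H (isometry_sheet i) (fun l => sheet_row1 l i0) (fun s => nu_sheet s i0) _ mB rB).
Qed.

Lemma curvature_varifold_family_boundary b : curvature_varifold 2 [set: 'rV[R]_3]
  (fun B => \sum_(n < 3) W Phi (family_index b n) B)%E (family_boundary b).
Proof.
apply: (@curvature_varifold_family R Phi Phi' Psi H 3 (fun n => sheet_mx (family_index b n))).
- by move=> n; exact: isometry_sheet.
- exact: disjoint_sheet_wedges.
- move=> B mB; apply: eq_bigr => n _; rewrite /W (Sigma_sheet H)//.
  exact: (upsilon_sheet H (isometry_sheet _)).
move=> j B mB rB; apply: eq_bigr => n _.
by apply: (bdryW_edge H (isometry_sheet _) _ _ _ mB rB) => [l|s]; [exact: sheet_row1|exact: nu_sheet].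
Qed.

End BoundaryOfSixSheets.

Theorem lemma3p4 (R : realType) (Phi : R -> R)
    (Phi_smooth : forall (k : nat) (t : R), derivable (derive1n k Phi) t 1)
    (Phi_bounds : forall t : R, 0 <= Phi t <= 1)
    (Phi_0 : Phi 0 = 1)
    (Phi_supp : closure [set t : R | Phi t != 0] `<=` `]-1, 1[)
    (Phi_even : forall t : R, Phi (- t) = Phi t)
    (Phi_decr : forall t : R, 0 <= t -> derive1 Phi t <= 0)
    (Phi_slope : forall t : R, `|derive1 Phi t| <= 4)
    (Phi_int : \int[lebesgue_measure]_t Phi t = 1) :
  (forall i : nat, (1 <= i <= 6)%N ->
     curvature_varifold 2 [set: 'rV[R]_3] (W Phi i) (@bdryW R i)) /\
  (exists dZ1, curvature_varifold 2 [set: 'rV[R]_3]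
                 (fun B => W Phi 1 B + W Phi 3 B + W Phi 5 B)%E dZ1 /\
               nonzero_boundary 2 [set: 'rV[R]_3] dZ1) /\
  (exists dZ2, curvature_varifold 2 [set: 'rV[R]_3]
                 (fun B => W Phi 2 B + W Phi 4 B + W Phi 6 B)%E dZ2 /\
               nonzero_boundary 2 [set: 'rV[R]_3] dZ2).
Proof.
have [Psi H] := profile_exists Phi_smooth Phi_bounds Phi_supp Phi_even Phi_slope Phi_int.
split; first by move=> i /andP[i0 _]; exact: (curvature_varifold_W H i0).
split.
  exists (@family_boundary R false); split; last exact: (nonzero_family_boundary H).
  rewrite (_ : (fun B => _) = fun B => (\sum_(n < 3) W Phi (family_index false n) B)%E).
    exact: (curvature_varifold_family_boundary H).
  by apply/funext => B; rewrite !big_ord_recl big_ord0 adde0 addeA.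
exists (@family_boundary R true); split; last exact: (nonzero_family_boundary H).
rewrite (_ : (fun B => _) = fun B => (\sum_(n < 3) W Phi (family_index true n) B)%E).
  exact: (curvature_varifold_family_boundary H).
by apply/funext => B; rewrite !big_ord_recl big_ord0 adde0 addeA.
Qed.
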